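(* Let $(M^{2n},\omega)$ be a symplectic manifold and $E\to M$ a vector bundle with fiber $V$ and a symplectically flat connection with curvature $F=\Phi\,\omega$. Let $U\subset M$ be an open set diffeomorphic to $\mathbb{R}^{2n}$, with an identification $E|_U\simeq U\times V$ by a frame in which $\Phi\in\mathrm{End}\,V$ is constant and the covariant derivative is $d_A=d+\Phi\lambda$, where $\lambda\in\Omega^1(U)$ satisfies $d\lambda=\omega$. Then $$PH^k_+(U,E)=\begin{cases}\ker\Phi,&k=0\\ \lambda\,\mathrm{coker}\,\Phi,&k=1\\ 0,&2\le k\le n\end{cases}\qquad\text{and}\qquad PH^k_-(U,E)=0\quad(0\le k\le n).$$ Here $\ker\Phi$ and $\mathrm{coker}\,\Phi$ are represented by constant sections: the map $\ker\Phi\to PH^0_+(U,E)$ sending $v$ to the constant section $v$, and the map $\mathrm{coker}\,\Phi=V/\Phi V\to PH^1_+(U,E)$ sending the class of $v$ to the class of $\lambda v$, are isomorphisms.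
   Context: $d_A$ is the covariant exterior derivative on $E$-valued forms (locally $d+A\wedge$), with curvature $F$. The connection is symplectically flat if there is $\Phi\in\Omega^0(M,\mathrm{End}\,E)$ with $F=\Phi\,\omega$ and $d_A\Phi=d\Phi+[A,\Phi]=0$. Around every point such $U$, frame and $\lambda$ exist. $P^s(U,E)$ ($0\le s\le n$) is the space of primitive $E$-valued $s$-forms on $U$, i.e. $\beta\in\Omega^s(U,E)$ with $\omega^{n-s+1}\wedge\beta=0$. Every $\eta\in\Omega^k(U,E)$ has a unique Lefschetz decomposition $\eta=\sum_{r}\omega^r\wedge\beta_{k-2r}$ with $\beta_{k-2r}\in P^{k-2r}(U,E)$ and $\max(0,k-n)\le r\le k/2$. Set $\Pi\eta=\beta_k$ (zero if $k>n$) and $L^{-1}\eta=\sum_{r\ge1}\omega^{r-1}\wedge\beta_{k-2r}$. Define $\partial_{+A}=\Pi\,d_A:P^k\to P^{k+1}$ and $\partial_{-A}=L^{-1}d_A:P^k\to P^{k-1}$. Let $P^k_\pm(U,E)$ denote two copies of $P^k(U,E)$. The twisted primitive complex is $$0\to P^0_+\xrightarrow{\partial_{+A}}\cdots\xrightarrow{\partial_{+A}}P^n_+\xrightarrow{-\partial_{+A}\partial_{-A}+\Phi}P^n_-\xrightarrow{-\partial_{-A}}\cdots\xrightarrow{-\partial_{-A}}P^0_-\to0,$$ and $PH^k_\pm(U,E)$ is its cohomology at $P^k_\pm(U,E)$. *)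

(* Defs.v *)
From HB Require Import structures.
From mathcomp Require Import all_boot all_order all_algebra.
From mathcomp Require Import all_classical all_reals all_analysis.

Set Implicit Arguments.
Unset Strict Implicit.
Unset Printing Implicit Defensive.

Import Order.TTheory GRing.Theory Num.Theory.
Import numFieldNormedType.Exports VectorInternalTheory.

Local Open Scope classical_set_scope.
Local Open Scope ring_scope.

Section smooth_functions.
Context {R : realType}.

Fixpoint Cn_on (k : nat) (U W : normedModType R) (D : set U) (f : U -> W) :
    Prop :=
  if k is j.+1 then
    (forall x, D x -> differentiable f x) /\
    (forall v, Cn_on j D (fun x => 'D_v f x))
  else forall x, D x -> {for x, continuous f}.

Definition smooth_on (U W : normedModType R) (D : set U) (f : U -> W) : Prop :=
  forall k, Cn_on k D f.

(* A [vectType] carries no norm: calculus in the finite-dimensional space [W]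
   is done through the coordinates [v2r : W -> 'rV_(dim W)]. *)
Definition vsmooth_on (U : normedModType R) (W : vectType R) (D : set U)
    (f : U -> W) : Prop :=
  smooth_on D (v2r \o f).

Definition vderive (U : normedModType R) (W : vectType R) (v : U) (f : U -> W)
    (x : U) : W :=
  r2v ('D_v (v2r \o f) x).

End smooth_functions.

(* The atlas is indexed by the points, [q] lying in the domain of the chart
   [cmap q].  Every smooth atlas contains such a family, and the family
   generates the same smooth structure. *)
Record manifold (R : realType) (m : nat) := Manifold {
  carrier :> topologicalType;
  cdom : carrier -> set carrier;
  cmap : carrier -> carrier -> 'rV[R]_m;
  cinv : carrier -> 'rV[R]_m -> carrier;
  _ : hausdorff_space carrier;
  _ : @second_countable carrier;
  _ : forall q, open (cdom q);
  _ : forall q, cdom q q;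
  _ : forall q, open (cmap q @` cdom q);
  _ : forall q p, cdom q p -> cinv q (cmap q p) = p;
  _ : forall q p, cdom q p -> {for p, continuous (cmap q)};
  _ : forall q x, (cmap q @` cdom q) x -> {for x, continuous (cinv q)};
  _ : forall q q',
      smooth_on (cmap q @` (cdom q `&` cdom q')) (cmap q' \o cinv q)
}.

Arguments cdom {R m M} : rename.
Arguments cmap {R m M} : rename.
Arguments cinv {R m M} : rename.

Definition diffeo_to_Rm (R : realType) (m : nat) (M : manifold R m)
    (U : set M) : Prop :=
  exists (psi : M -> 'rV[R]_m) (chi : 'rV[R]_m -> M),
    [/\ forall x, U (chi x), forall x, psi (chi x) = x,
        forall p, U p -> chi (psi p) = p &
     [/\ continuous chi,
         forall q, smooth_on (chi @^-1` cdom q) (cmap q \o chi) &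
         forall q, smooth_on (cmap q @` (U `&` cdom q)) (psi \o cinv q)]].

(* The tangent space at [p] is 'rV_m, through the chart [cmap p].
   A [W]-valued form assigns to a point a function of a list of tangent vectors;
   a form of degree [k] vanishes on the lists of length other than [k].  Only
   the values at the points of the open set under consideration matter, so that
   forms on [U] are compared with [eq_on U]. *)
Definition mform (R : realType) (m : nat) (M : manifold R m) (W : Type) :=
  M -> seq 'rV[R]_m -> W.

Section forms.
Context {R : realType} {m : nat} {M : manifold R m}.

Definition eq_on (W : Type) (U : set M) (eta theta : mform M W) : Prop :=
  forall p, U p -> eta p = theta p.

Definition form0 (W : vectType R) (f : M -> W) : mform M W :=
  fun p s => if s is [::] then f p else 0.

Definition alternating_form (W : vectType R) (k : nat)
    (h : seq 'rV[R]_m -> W) : Prop :=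
  [/\ forall s, size s != k -> h s = 0,
      forall s1 s2 (a : R) u v, h (s1 ++ (a *: u + v) :: s2) =
        a *: h (s1 ++ u :: s2) + h (s1 ++ v :: s2) &
      forall s1 s2 s3 u, h (s1 ++ u :: s2 ++ u :: s3) = 0].

(* [eta] in the coordinates [cmap q], at the point of coordinates [x] *)
Definition in_chart (W : Type) (q : M) (eta : mform M W)
    (x : 'rV[R]_m) (s : seq 'rV[R]_m) : W :=
  eta (cinv q x) (map ('d (cmap (cinv q x) \o cinv q) x) s).

Definition smooth_form (W : vectType R) (U : set M) (eta : mform M W) :=
  forall q s, vsmooth_on (cmap q @` (U `&` cdom q))
                         (fun x => in_chart q eta x s).

Definition Omega (W : vectType R) (U : set M) (k : nat) : set (mform M W) :=
  [set eta | (forall p, U p -> alternating_form k (eta p)) /\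
             smooth_form U eta].

Definition rem_at (T : Type) (i : nat) (s : seq T) := take i s ++ drop i.+1 s.

(* d eta (v_0, .., v_k) =
     \sum_i (-1)^i (v_i . eta) (v_0, .., v_(i-1), v_(i+1), .., v_k)
   for constant v_i, computed at [p] in the chart [cmap p] *)
Definition dext (W : vectType R) (eta : mform M W) : mform M W :=
  fun p s => \sum_(i < size s) (-1) ^+ i *:
    vderive s`_i (fun x => in_chart p eta x (rem_at i s)) (cmap p p).

Definition sublist (s : seq 'rV[R]_m) (A : {set 'I_(size s)}) :=
  [seq s`_(i : 'I_(size s)) | i in A].

(* parity of the shuffle moving the elements of [A] to the front *)
Definition shuffle_inv (k : nat) (A : {set 'I_k}) : nat :=
  #|[pred ij : 'I_k * 'I_k |
      [&& (ij.1 < ij.2)%N, ij.1 \notin A & ij.2 \in A]]|.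

(* exterior product along the bilinear map [op], as a sum over shuffles *)
Definition wedgef (W1 W2 : Type) (W : vectType R) (op : W1 -> W2 -> W)
    (alpha : mform M W1) (beta : mform M W2) : mform M W :=
  fun p s => \sum_(A : {set 'I_(size s)}) (-1) ^+ shuffle_inv A *:
    op (alpha p (sublist A)) (beta p (sublist (~: A))).

Definition wedges (W : vectType R) (alpha : mform M R^o) (beta : mform M W) :
    mform M W :=
  wedgef (fun (a : R) w => a *: w) alpha beta.

Definition wedgeE (V : vectType R) (alpha : mform M 'End(V))
    (beta : mform M V) : mform M V :=
  wedgef (fun (f : 'End(V)) v => f v) alpha beta.

Definition wedgeEE (V : vectType R) (alpha beta : mform M 'End(V)) :
    mform M 'End(V) :=
  wedgef (fun f g : 'End(V) => (f \o g)%VF) alpha beta.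

Definition endo_act (V : vectType R) (f : M -> 'End(V)) (eta : mform M V) :
    mform M V :=
  fun p s => f p (eta p s).

Definition symplectic (omega : mform M R^o) : Prop :=
  [/\ Omega setT 2 omega, eq_on setT (dext omega) 0 &
      forall p u, (forall v, omega p [:: u; v] = 0) -> u = 0].

End forms.

(* Each fibre E_p is identified with [V], with no smoothness in [p];
   [triv q p : E_p -> V] is a local trivialization over [tdom q]. *)
Record vbundle (R : realType) (m : nat) (M : manifold R m) (V : vectType R) :=
  VBundle {
  tdom : M -> set M;
  triv : M -> M -> 'End(V);
  _ : forall q, open (tdom q);
  _ : forall q, tdom q q;
  _ : forall q p, tdom q p -> lker (triv q p) = 0%VS;
  _ : forall q q', Omega (tdom q `&` tdom q') 0
        (form0 (fun p => (triv q' p \o (triv q p)^-1)%VF))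
}.

(* A connection is given by its 1-forms in the local trivializations, related
   on overlaps by A_q' g + dg = g A_q where g = triv q' o (triv q)^-1. *)
Record connection (R : realType) (m : nat) (M : manifold R m) (V : vectType R)
    (E : vbundle M V) := Connection {
  conn : M -> mform M 'End(V);
  _ : forall q, Omega (tdom E q) 1 (conn q);
  _ : forall q q',
      let g := form0 (fun p => (triv E q' p \o (triv E q p)^-1)%VF) in
      eq_on (tdom E q `&` tdom E q')
        (wedgeEE (conn q') g + dext g) (wedgeEE g (conn q))
}.

Section bundles.
Context {R : realType} {m : nat} {M : manifold R m} {V : vectType R}.
Variables (E : vbundle M V) (A : connection E).

Definition OmegaE (U : set M) (k : nat) : set (mform M V) :=
  [set eta | forall q, Omega (U `&` tdom E q) k (endo_act (triv E q) eta)].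

(* the covariant exterior derivative, computed at [p] in [triv E p] *)
Definition dA (eta : mform M V) : mform M V := fun p s =>
  let eta_p := endo_act (triv E p) eta in
  ((triv E p p)^-1)%VF ((dext eta_p + wedgeE (conn A p) eta_p) p s).

Definition endo_in_triv (Phi : M -> 'End(V)) (q : M) : mform M 'End(V) :=
  form0 (fun p => (triv E q p \o (Phi p \o (triv E q p)^-1))%VF).

(* Phi is a section of End E with F = Phi omega and d_A Phi = 0 *)
Definition symplectically_flat (omega : mform M R^o) (Phi : M -> 'End(V)) :=
  forall q, let Phi_q := endo_in_triv Phi q in
  [/\ Omega (tdom E q) 0 Phi_q,
      eq_on (tdom E q) (dext (conn A q) + wedgeEE (conn A q) (conn A q))
                       (wedges omega Phi_q) &
      eq_on (tdom E q)
        (dext Phi_q + (wedgeEE (conn A q) Phi_q - wedgeEE Phi_q (conn A q))) 0].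

(* [e p : V -> E_p] is a frame of E over U, i.e. E|_U ~ U x V *)
Definition frame (U : set M) (e : M -> 'End(V)) : Prop :=
  (forall p, U p -> lker (e p) = 0%VS) /\
  (forall q, Omega (U `&` tdom E q) 0
               (form0 (fun p => (triv E q p \o e p)%VF))).

(* in the frame [e], [Phi] is the constant [Phi0] and d_A = d + Phi0 lambda *)
Definition flat_frame (Phi : M -> 'End(V)) (U : set M) (e : M -> 'End(V))
    (Phi0 : 'End(V)) (lambda : mform M R^o) : Prop :=
  [/\ frame U e,
      forall p, U p -> (Phi p \o e p)%VF = (e p \o Phi0)%VF &
      forall k (beta : mform M V), Omega U k beta ->
        eq_on U (dA (endo_act e beta))
          (endo_act e (dext beta +
                  wedgeE (fun p s => (lambda p s : R) *: Phi0) beta))].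

End bundles.

Section primitive.
Context {R : realType} {n : nat} {M : manifold R n.*2} {V : vectType R}.
Variables (omega : mform M R^o) (E : vbundle M V) (A : connection E).
Variables (Phi : M -> 'End(V)) (U : set M).

Definition wedge_omega (r : nat) (eta : mform M V) : mform M V :=
  iter r (wedges omega) eta.

Definition primitive (k : nat) : set (mform M V) :=
  [set beta | [/\ (k <= n)%N, OmegaE E U k beta &
                  eq_on U (wedge_omega (n - k).+1 beta) 0]].

(* [beta r] is the primitive form of degree k - 2r; the truncated subtraction
   [k - n] is max(0, k - n) *)
Definition is_lefschetz (k : nat) (eta : mform M V) (beta : nat -> mform M V) :=
  (forall r, (k - n <= r <= k./2)%N -> primitive (k - r.*2) (beta r)) /\
  eq_on U eta (\sum_(k - n <= r < k./2.+1) wedge_omega r (beta r)).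

Definition lefschetz (k : nat) (eta : mform M V) : nat -> mform M V :=
  xget 0 [set beta | is_lefschetz k eta beta].

Definition Pi (k : nat) (eta : mform M V) : mform M V :=
  if (k <= n)%N then lefschetz k eta 0 else 0.

Definition Linv (k : nat) (eta : mform M V) : mform M V :=
  \sum_(maxn 1 (k - n) <= r < k./2.+1) wedge_omega r.-1 (lefschetz k eta r).

Definition partial_plus (k : nat) (beta : mform M V) : mform M V :=
  Pi k.+1 (dA A beta).

Definition partial_minus (k : nat) (beta : mform M V) : mform M V :=
  Linv k.+1 (dA A beta).

(* the differential leaving P^k_+ *)
Definition diff_plus (k : nat) (beta : mform M V) : mform M V :=
  if (k < n)%N then partial_plus k beta
  else - partial_plus k.-1 (partial_minus k beta) + endo_act Phi beta.

(* the differential leaving P^k_-, k > 0 *)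
Definition diff_minus (k : nat) (beta : mform M V) : mform M V :=
  - partial_minus k beta.

End primitive.

(* the quotient [sq_num / sq_den] of subspaces of [W] *)
Record subquotient (W : Type) := Subquotient {
  sq_num : set W;
  sq_den : set W
}.

Definition sq_trivial (W : Type) (T : subquotient W) : Prop :=
  sq_num T `<=` sq_den T.

(* [f] induces a (well defined) linear isomorphism from [S] to [T] *)
Definition induces_iso (R : realType) (X W : lmodType R) (f : X -> W)
    (S : subquotient X) (T : subquotient W) : Prop :=
  [/\ forall x, sq_num S x -> sq_num T (f x),
      forall x, sq_num S x -> (sq_den T (f x) <-> sq_den S x),
      forall (a : R) x y, sq_num S x -> sq_num S y ->
        sq_den T (f (a *: x + y) - (a *: f x + f y)) &
      forall z, sq_num T z -> exists2 x, sq_num S x & sq_den T (z - f x)].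

Section cohomology.
Context {R : realType} {n : nat} {M : manifold R n.*2} {V : vectType R}.
Variables (omega : mform M R^o) (E : vbundle M V) (A : connection E).
Variables (Phi : M -> 'End(V)) (U : set M).

Local Notation P := (primitive omega E U).
Local Notation Dplus := (diff_plus omega A Phi U).
Local Notation Dminus := (diff_minus omega A U).

Definition PHplus (k : nat) : subquotient (mform M V) := {|
  sq_num := [set beta | P k beta /\ eq_on U (Dplus k beta) 0];
  sq_den := [set beta |
    if k is j.+1 then exists2 gamma, P j gamma & eq_on U beta (Dplus j gamma)
    else eq_on U beta 0] |}.

Definition PHminus (k : nat) : subquotient (mform M V) := {|
  sq_num := [set beta | P k beta /\ ((0 < k)%N -> eq_on U (Dminus k beta) 0)];
  sq_den := [set beta |
    if (k < n)%N
    then exists2 gamma, P k.+1 gamma & eq_on U beta (Dminus k.+1 gamma)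
    else exists2 gamma, P n gamma & eq_on U beta (Dplus n gamma)] |}.

End cohomology.

Definition ker_sq (R : realType) (V : vectType R) (f : 'End(V)) :
    subquotient V :=
  {| sq_num := [set v | v \in lker f]; sq_den := [set 0] |}.

Definition coker_sq (R : realType) (V : vectType R) (f : 'End(V)) :
    subquotient V :=
  {| sq_num := setT; sq_den := [set v | v \in limg f] |}.

(* Main.v *)
Require Import Defs.
From HB Require Import structures.
From mathcomp Require Import all_boot all_order all_algebra.
From mathcomp Require Import all_classical all_reals all_analysis.
From mathcomp Require Import zify ring lra.

Set Implicit Arguments.
Unset Strict Implicit.
Unset Printing Implicit Defensive.
Import Order.TTheory GRing.Theory Num.Theory.
Import numFieldNormedType.Exports VectorInternalTheory.
Local Open Scope classical_set_scope.
Local Open Scope ring_scope.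

(* Read through the diffeomorphism and the frame, the complex lives on R^2n, where
   the covariant derivative is D = d + Phi lambda and D^2 = Phi omega.  With
   L = omega /\ _ and the contraction Lam by the dual bivector, [Lam, L] = n - k in
   degree k, so that L is injective below the middle degree and surjective above
   it, and D x = b + L c with b, c primitive when x is primitive.

   Let x be a cocycle of P^k_+, k > 0.  Then D x = L c and D c = Phi x, so that
   x - lambda c is closed, hence equal to some d m, and c - Phi m is closed.  If
   k = 1, c - Phi m is a constant section v and x = D m + lambda v.  If k > 1,
   c - Phi m = d v and x = D (m - lambda v) + L v, so that x is the image under
   partial_+ of the primitive part of m - lambda v.

   Let x be a cocycle of P^k_- and s = L^(n - k) x.  Then D s = 0 and L s = 0, so
   that lambda s is some d m and s + Phi m is some d v.  With m' = m + lambda v,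
   this means D m' = L v and s = D v - Phi m'.  If k = n, the primitive part of m'
   is the required one.  If k < n, m' = L r and s = D (v - D r), where v - D r is
   killed by L, hence is L^(n - k - 1) of a primitive form. *)

(** * The Lefschetz decomposition *)

(** Since [D] has curvature it is not a differential, and the passage to closed forms needs a
    reason. Adjoin a formal 1-form theta with d theta = omega and theta^2 = 0. The operator D - Phi
    theta = d + Phi (lambda - theta) has square zero and sends x - theta c to (D x - L c) + theta (D
    c - Phi x). So D x = L c and D c = Phi x say that x - theta c is closed; likewise D s = 0 and L
    s = 0 say that theta s is closed. As d theta = d lambda, setting theta = lambda is compatible
    with d and turns the operator into d itself: this is why the ordinary Poincare lemma applies to
    x - lambda c and to lambda s. Its second use treats the remaining coefficient, and it stops at a
    constant when that coefficient has degree 0. Constants are therefore the only source of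
    cohomology. The Lefschetz decomposition serves to return from the arbitrary potentials so
    obtained to primitive ones, a primitive form in the image of L being zero. *)

Section lefschetz_sl2.
Variables (R : numFieldType) (X : lmodType R) (n : nat).
Variables (Om : nat -> X -> Prop) (L Lam : {linear X -> X}).
Hypothesis Om0 : forall k, Om k 0.
Hypothesis OmP : forall k (a : R) x y, Om k x -> Om k y -> Om k (a *: x + y).
Hypothesis OmL : forall k x, Om k x -> Om k.+2 (L x).
Hypothesis OmLam : forall k x, Om k.+2 x -> Om k (Lam x).
Hypothesis Lam0 : forall k x, (k < 2)%N -> Om k x -> Lam x = 0.
Hypothesis Omtop : forall k x, (n.*2 < k)%N -> Om k x -> x = 0.
Hypothesis LamL : forall k x, Om k x ->
  Lam (L x) = L (Lam x) + (n%:R - k%:R) *: x.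

Lemma OmZ k (a : R) x : Om k x -> Om k (a *: x).
Proof. by move=> h; rewrite -[_ *: _]addr0; exact: OmP. Qed.

Lemma OmD k x y : Om k x -> Om k y -> Om k (x + y).
Proof. by move=> h; rewrite -[x]scale1r; exact: OmP. Qed.

Lemma OmN k x : Om k x -> Om k (- x).
Proof. by rewrite -scaleN1r; exact: OmZ. Qed.

Lemma OmB k x y : Om k x -> Om k y -> Om k (x - y).
Proof. by move=> hx hy; apply: OmD => //; exact: OmN. Qed.

Lemma Om_iter k r x : Om k x -> Om (k + r.*2) (iter r L x).
Proof.
move=> hx; elim: r => [|r IHr]; first by rewrite addn0.
by rewrite doubleS !addnS iterS; exact: OmL.
Qed.

(* Solving [(L Lam + c) z = x] above the middle degree: [L Lam = Lam L + (k - n)]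
   there, and an inverse of [Lam L + c'], [c' > 0], is obtained from one of
   [L Lam + c'] in degree [k + 2]. *)
Lemma LLam_surj k (c : R) x : (n < k)%N -> 0 <= c -> Om k x ->
  exists2 z, Om k z & x = L (Lam z) + c *: z.
Proof.
have [j] := ubnP (n.*2.+1 - k)%N; elim: j k c x => // j IHj k c x lej ltnk c0 hx.
have [gtk|lek] := ltnP n.*2 k.
  by exists 0 => //; rewrite (Omtop gtk hx) !raddf0 addr0.
pose c' := c + (k%:R - n%:R).
have c'0 : 0 < c' by rewrite ltr_wpDl// subr_gt0 ltr_nat.
have [||||y hy xy] := IHj k.+2 c' (L x) _ _ _ _; [lia|lia|exact: ltW|exact: OmL|].
have hLy : Om k (Lam y) by exact: OmLam.
pose z := c'^-1 *: (x - Lam y).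
have hz : Om k z by apply: OmZ; exact: OmB.
have c'z : c' *: z = x - Lam y by rewrite scalerA divff ?scale1r// gt_eqF.
clearbody z; exists z => //.
have -> : L (Lam z) = Lam (L z) + (k%:R - n%:R) *: z.
  by rewrite (LamL hz) -addrA -scalerDl addrA subrK subrr scale0r addr0.
rewrite -addrA -scalerDl (addrC _ c) -/c'; apply: (scalerI (lt0r_neq0 c'0)).
have -> : c' *: (Lam (L z) + c' *: z) = Lam (L (c' *: z)) + c' *: (c' *: z).
  by rewrite scalerDr !linearZ_LR.
rewrite c'z.
rewrite [L (x - _)]linearB [Lam (_ - _)]linearB xy [Lam (_ + _)]linearD.
by rewrite [Lam (c' *: _)]linearZ_LR [X in X + _]addrAC subrr add0r scalerBr addrC subrK.
Qed.

Lemma L_surj k x : (n < k.+2)%N -> Om k.+2 x -> exists2 y, Om k y & x = L y.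
Proof.
move=> ltnk /(LLam_surj ltnk (lexx 0))[z hz ->].
by exists (Lam z); [exact: OmLam | rewrite scale0r addr0].
Qed.

(** Mirror image of [LLam_surj], by ascending degree: below the middle, [Lam L = L Lam + (n - k)]
    with [n - k > 0], and a solution for [L Lam + c'] in degree [k] comes from one for [Lam L + c']
    in degree [k - 2]. In degrees 0 and 1, where [Lam] vanishes, dividing by [c'] is enough. *)
Lemma LamL_surj k (c : R) x : (k < n)%N -> 0 <= c -> Om k x ->
  exists2 z, Om k z & x = Lam (L z) + c *: z.
Proof.
have [j] := ubnP k; elim: j k c x => // j IHj k c x lej ltkn c0 hx.
pose c' := c + (n%:R - k%:R).
have c'0 : 0 < c' by rewrite ltr_wpDl// subr_gt0 ltr_nat.
have c'N0 := lt0r_neq0 c'0.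
suff [z hz] : exists2 z, Om k z & x = L (Lam z) + c' *: z.
  by exists z => //; rewrite (LamL hz) -addrA -scalerDl (addrC _ c) .
have [k2|k2] := ltnP k 2.
  exists (c'^-1 *: x); first exact: OmZ.
  by rewrite linearZ/= (Lam0 k2 hx) scaler0 raddf0 add0r scalerA divff// scale1r.
move: k k2 lej ltkn @c' c'0 c'N0 hx => [|[|k]]// _ lej ltkn c' c'0 c'N0 hx.
have [||||y hy xy] := IHj k c' (Lam x) _ _ _ _; [lia|lia|exact: ltW|exact: OmLam|].
pose z := c'^-1 *: (x - L y).
have c'z : c' *: z = x - L y by rewrite scalerA divff ?scale1r// gt_eqF.
have hz : Om k.+2 z by apply: OmZ; apply: OmB => //; exact: OmL.
clearbody z; exists z => //.
apply: (scalerI c'N0).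
have -> : c' *: (L (Lam z) + c' *: z) = L (Lam (c' *: z)) + c' *: (c' *: z).
  by rewrite scalerDr !linearZ_LR.
rewrite c'z [Lam (x - _)]linearB [L (_ - _)]linearB xy [L (_ + _)]linearD.
by rewrite [L (c' *: _)]linearZ_LR [X in X + _]addrAC subrr add0r scalerBr addrC subrK.
Qed.

(** The component [L z] is chosen so that [Lam (L z) = Lam x]. Primitivity first appears as being
    killed by [Lam]; [Lam0_prim] converts it into the vanishing of a power of [L]. *)
Lemma Lam_decomp k x : (k.+2 <= n)%N -> Om k.+2 x ->
  exists b y, [/\ Om k.+2 b, Lam b = 0, Om k y & x = b + L y].
Proof.
move=> lekn hx; have ltkn : (k < n)%N by lia.
have [z hz xz] := LamL_surj ltkn (lexx 0) (OmLam hx).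
exists (x - L z), z; split; rewrite ?subrK//; first by apply: OmB => //; exact: OmL.
by rewrite raddfB/= xz scale0r addr0 subrr.
Qed.

(** The sl2 formula on an extremal vector. The coefficient vanishes for [r = n - k] only, which is
    what the next lemmas exploit. *)
Lemma Lam_iterL k b r : Om k b -> Lam b = 0 ->
  Lam (iter r.+1 L b) = (r.+1%:R * (n%:R - k%:R - r%:R)) *: iter r L b.
Proof.
move=> hb b0; elim: r => [|r IHr].
  by rewrite /= (LamL hb) b0 raddf0 add0r mul1r subr0.
rewrite [iter r.+2 _ _]iterS (LamL (Om_iter r.+1 hb)) {}IHr linearZ/= -scalerDl.
by congr (_ *: _); rewrite natrD -muln2 natrM -!natr1; ring.
Qed.

(** The powers of [L] on [b] vanish once the degree exceeds [2 n]. Applying [Lam] carries this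
    vanishing from [r + 1] down to [r] as long as the coefficient of [Lam_iterL] is nonzero, that is
    for [r > n - k]; [t] measures the distance to the top degree. *)
Lemma Lam0_prim k b : (k <= n)%N -> Om k b -> Lam b = 0 ->
  iter (n - k).+1 L b = 0.
Proof.
move=> lekn hb b0.
suff H t r : (n - k < r)%N -> (n.*2 < k + r.*2 + t)%N -> iter r L b = 0.
  by apply: (H n.*2.+1); lia.
elim: t r => [|t IHt] r ltr ltt.
  by apply: (@Omtop (k + r.*2)); [lia|exact: Om_iter].
have := Lam_iterL r hb b0; rewrite IHt; [|lia|lia].
rewrite raddf0 => /esym/eqP; rewrite scaler_eq0 mulf_eq0 pnatr_eq0/=.
rewrite -natrB// subr_eq0 eqr_nat.
by case/orP=> [/eqP ?|/eqP//]; lia.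
Qed.

Lemma prim_decomp k x : (k.+2 <= n)%N -> Om k.+2 x ->
  exists b y, [/\ Om k.+2 b, iter (n - k.+2).+1 L b = 0, Om k y & x = b + L y].
Proof.
move=> lekn /(Lam_decomp lekn)[b [y [hb b0 hy ->]]].
by exists b, y; split=> //; exact: Lam0_prim.
Qed.

Lemma iterL_linear r : linear (iter r L).
Proof. by elim: r => [//|r IHr] a x y; rewrite !iterS IHr linearP. Qed.

Lemma iterL0 r : iter r L 0 = 0.
Proof. by elim: r => //= r ->; rewrite raddf0. Qed.

Lemma iterLD r x y : iter r L (x + y) = iter r L x + iter r L y.
Proof. by have := iterL_linear r 1 x y; rewrite !scale1r. Qed.

(** It is enough to treat [a = n - k]. Write [x = b + L y] with [b] primitive: one more [L] kills
    [b], so that [y] is killed by the critical power for its own degree [k - 2] and vanishes by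
    induction. Then [Lam x = 0], and the coefficients of [Lam_iterL] are nonzero all the way down to
    [r = 0]. *)
Lemma iterL_inj k a x : (a + k <= n)%N -> Om k x -> iter a L x = 0 -> x = 0.
Proof.
move=> leakn hx x0; have {x0} : iter (n - k) L x = 0.
  have -> : (n - k = (n - k - a) + a)%N by lia.
  by rewrite iterD x0 iterL0.
have lekn : (k <= n)%N by lia.
move: hx lekn {leakn}; have [j] := ubnP k; elim: j k x => // j IHj k x lej hx lekn x0.
have {IHj} Lx0 : Lam x = 0.
  have [k2|k2] := ltnP k 2; first exact: Lam0 hx.
  move: k k2 lej lekn hx x0 => [|[|k]]// _ lej lekn hx x0.
  have [b [y [hb b0 hy xE]]] := Lam_decomp lekn hx.
  suff y0 : y = 0 by rewrite xE y0 raddf0 addr0.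
  apply: (IHj k) => //; [lia|lia|].
  have := congr1 L x0; rewrite -iterS raddf0 xE iterLD Lam0_prim// add0r.
  by rewrite -iterSr (_ : (n - k = (n - k.+2).+2)%N)//; lia.
have H r : (r <= n - k)%N -> iter r L x = 0 -> x = 0.
  elim: r => [//|r IHr] ler xr0; apply: IHr; first lia.
  have := Lam_iterL r hx Lx0; rewrite xr0 raddf0 => /esym/eqP.
  rewrite scaler_eq0 mulf_eq0 pnatr_eq0/= -natrB// subr_eq0 eqr_nat.
  by case/orP=> [/eqP ?|/eqP//]; lia.
exact: H x0.
Qed.

Lemma Om_iterLam k r x : (r.*2 <= k)%N -> Om k x ->
  Om (k - r.*2) (iter r Lam x).
Proof.
move=> + hx; elim: r => [|r IHr] ler; first by rewrite subn0.
apply: OmLam; rewrite (_ : (k - r.+1.*2).+2 = k - r.*2)%N; last lia.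
by apply: IHr; lia.
Qed.

(** Counterpart of [Lam_iterL] at the other end of an sl2 string. *)
Lemma L_iterLam k x r : (r.*2 <= k)%N -> Om k x -> L x = 0 ->
  L (iter r.+1 Lam x) = (r.+1%:R * (k%:R - n%:R - r%:R)) *: iter r Lam x.
Proof.
move=> + hx x0; elim: r => [|r IHr] ler.
  apply/eqP; rewrite mul1r subr0 -subr_eq0 -scaleNr opprB.
  by rewrite -(LamL hx) x0 raddf0.
have hr := Om_iterLam ler hx.
have -> : L (iter r.+2 Lam x) = Lam (L (iter r.+1 Lam x)) -
    (n%:R - (k - r.+1.*2)%:R) *: iter r.+1 Lam x.
  by rewrite (LamL hr) addrK.
rewrite IHr; last lia.
rewrite [Lam (_ *: _)]linearZ_LR -scaleNr -iterS -scalerDl; congr (_ *: _).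
by rewrite natrB// -muln2 natrM -!natr1; ring.
Qed.

(** A form killed by [L] is the upper end of its string: going down by [Lam] and up by [L], [n - j]
    times each, multiplies it by a product of coefficients of [L_iterLam], all nonzero because
    [n - j - t > 0] for [t < n - j]. *)
Lemma L_kernel j x : (j <= n)%N -> Om (n.*2 - j) x -> L x = 0 ->
  exists2 y, Om j y & x = iter (n - j) L y.
Proof.
move=> lejn hx x0.
have [c c0 xE] : exists2 c : R, c != 0 &
    iter (n - j) L (iter (n - j) Lam x) = c *: x.
  elim: {1 3 4}(n - j)%N (leqnn (n - j)) => [|t IHt] let_; first by exists 1; rewrite ?oner_neq0 ?scale1r.
  have [|c c0 cE] := IHt; first lia.
  rewrite iterSr (L_iterLam _ hx x0); last lia.
  exists (t.+1%:R * ((n.*2 - j)%:R - n%:R - t%:R) * c); last first.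
    have := iterL_linear t (t.+1%:R * ((n.*2 - j)%:R - n%:R - t%:R)) (iter t Lam x) 0.
    by rewrite iterL0 !addr0 => ->; rewrite cE scalerA.
  rewrite !mulf_neq0 ?pnatr_eq0// -natrB; last lia.
  by rewrite subr_eq0 eqr_nat; lia.
exists (c^-1 *: iter (n - j) Lam x).
  apply: OmZ; rewrite {1}(_ : j = n.*2 - j - (n - j).*2)%N; last lia.
  by apply: Om_iterLam => //; lia.
have := iterL_linear (n - j) c^-1 (iter (n - j) Lam x) 0.
by rewrite iterL0 !addr0 xE scalerA mulVf// scale1r.
Qed.

End lefschetz_sl2.

(** * The cohomology of a primitive complex *)

(* [ell] is the product with a primitive of the symplectic form, and [d + Phi ell]
   the covariant derivative. *)
Record symplectic_complex (R : numFieldType) (X : lmodType R) (n : nat)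
  (Om : nat -> X -> Prop) (L Lam ell Phi : {linear X -> X}) (d : X -> X) : Prop :=
  SymplecticComplex {
  sc_Om0 : forall k, Om k 0;
  sc_OmP : forall k (a : R) x y, Om k x -> Om k y -> Om k (a *: x + y);
  sc_OmL : forall k x, Om k x -> Om k.+2 (L x);
  sc_OmLam : forall k x, Om k.+2 x -> Om k (Lam x);
  sc_Lam0 : forall k x, (k < 2)%N -> Om k x -> Lam x = 0;
  sc_Omtop : forall k x, (n.*2 < k)%N -> Om k x -> x = 0;
  sc_LamL : forall k x, Om k x -> Lam (L x) = L (Lam x) + (n%:R - k%:R) *: x;
  sc_Omell : forall k x, Om k x -> Om k.+1 (ell x);
  sc_OmPhi : forall k x, Om k x -> Om k (Phi x);
  sc_Omd : forall k x, Om k x -> Om k.+1 (d x);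
  sc_dP : forall k (a : R) x y, Om k x -> Om k y ->
    d (a *: x + y) = a *: d x + d y;
  sc_dd : forall k x, Om k x -> d (d x) = 0;
  sc_dL : forall k x, Om k x -> d (L x) = L (d x);
  sc_dell : forall k x, Om k x -> d (ell x) = L x - ell (d x);
  sc_dPhi : forall k x, Om k x -> d (Phi x) = Phi (d x);
  sc_ellell : forall k x, Om k x -> ell (ell x) = 0;
  sc_ellL : forall k x, Om k x -> ell (L x) = L (ell x);
  sc_ellPhi : forall x, ell (Phi x) = Phi (ell x);
  sc_LPhi : forall x, L (Phi x) = Phi (L x);
  sc_poincare : forall k x, Om k.+1 x -> d x = 0 -> exists2 y, Om k y & x = d y
}.

Section primitive_cohomology.
Variables (R : numFieldType) (X : lmodType R) (n : nat).
Variables (Om : nat -> X -> Prop) (L Lam ell Phi : {linear X -> X}) (d : X -> X).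
Hypothesis C : symplectic_complex n Om L Lam ell Phi d.

Let Om0 := sc_Om0 C.
Let OmP := sc_OmP C.
Let OmL := sc_OmL C.
Let OmLam := sc_OmLam C.
Let Lam0 := sc_Lam0 C.
Let Omtop := sc_Omtop C.
Let LamL := sc_LamL C.
Let Omell := sc_Omell C.
Let OmPhi := sc_OmPhi C.
Let Omd := sc_Omd C.
Let dP := sc_dP C.
Let dd := sc_dd C.
Let dL := sc_dL C.
Let dell := sc_dell C.
Let dPhi := sc_dPhi C.
Let ellell := sc_ellell C.
Let ellL := sc_ellL C.
Let ellPhi := sc_ellPhi C.
Let LPhi := sc_LPhi C.
Let poincare := sc_poincare C.
Let OmD := OmD OmP.
Let OmN := OmN Om0 OmP.
Let OmB := OmB Om0 OmP.
Let Linj := iterL_inj Om0 OmP OmL OmLam Lam0 Omtop LamL.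
Let Lsurj := L_surj Om0 OmP OmL OmLam Omtop LamL.
Let decomp := prim_decomp Om0 OmP OmL OmLam Lam0 Omtop LamL.
Let Lker := L_kernel Om0 OmP OmLam LamL.
Hint Resolve OmD OmN OmB OmL Omell OmPhi Omd : core.

Definition cov x : X := d x + Phi (ell x).
Local Notation D := cov.

Lemma d0 : d 0 = 0.
Proof. by have := dP (-1) (Om0 0) (Om0 0); rewrite scaleN1r addNr scaleN1r addNr. Qed.

Lemma dD k x y : Om k x -> Om k y -> d (x + y) = d x + d y.
Proof. by move=> hx hy; have := dP 1 hx hy; rewrite !scale1r. Qed.

Lemma dN k x : Om k x -> d (- x) = - d x.
Proof. by move=> hx; have := dP (-1) hx (Om0 k); rewrite d0 !addr0 !scaleN1r. Qed.

Lemma dB k x y : Om k x -> Om k y -> d (x - y) = d x - d y.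
Proof. by move=> hx hy; rewrite (dD hx) ?(dN hy)//; exact: OmN. Qed.

Lemma Om_cov k x : Om k x -> Om k.+1 (D x).
Proof. by move=> hx; apply: OmD; auto. Qed.
Hint Resolve Om_cov : core.

Lemma cov0 : D 0 = 0.
Proof. by rewrite /D d0 !raddf0 addr0. Qed.

Lemma covD k x y : Om k x -> Om k y -> D (x + y) = D x + D y.
Proof. by move=> hx hy; rewrite /D (dD hx hy) !raddfD/= addrACA. Qed.

Lemma covN k x : Om k x -> D (- x) = - D x.
Proof. by move=> hx; rewrite /D (dN hx) !raddfN/= opprD. Qed.

Lemma covB k x y : Om k x -> Om k y -> D (x - y) = D x - D y.
Proof. by move=> hx hy; rewrite (covD hx) ?(covN hy)//; exact: OmN. Qed.

Lemma covL k x : Om k x -> D (L x) = L (D x).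
Proof. by move=> hx; rewrite /D (dL hx) (ellL hx) -LPhi raddfD. Qed.

Lemma cov_iterL k r x : Om k x -> D (iter r L x) = iter r L (D x).
Proof.
move=> hx; elim: r => //= r IHr; rewrite -IHr; apply: covL.
exact: (Om_iter OmL r hx).
Qed.

Lemma cov_cov k x : Om k x -> D (D x) = Phi (L x).
Proof.
move=> hx; rewrite {1}/D /D (@dD k.+1); [|auto|auto].
rewrite (dd hx) add0r raddfD/= ellPhi (ellell hx) !raddf0 addr0.
by rewrite (dPhi (Omell hx)) (dell hx) raddfB/= subrK.
Qed.

Lemma covell k x : Om k x -> D (ell x) = L x - ell (d x).
Proof. by move=> hx; rewrite /D (dell hx) (ellell hx) raddf0 addr0. Qed.

Definition prim k x := [/\ (k <= n)%N, Om k x & iter (n - k).+1 L x = 0].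

Lemma primB k x y : prim k x -> prim k y -> prim k (x - y).
Proof.
move=> [lek hx x0] [_ hy y0]; split => //; first exact: OmB.
have := iterL_linear L (n - k).+1 (-1) y x.
by rewrite [_ *: y + x]addrC scaleN1r => ->; rewrite x0 y0 scaler0 addr0.
Qed.

(** Primitivity of [L y] reads [L^(n - k) y = 0], the critical power in degree [k], where
    [iterL_inj] still applies. *)
Lemma prim_imL k x y : prim k.+2 x -> Om k y -> x = L y -> x = 0 /\ y = 0.
Proof.
move=> [lek _ x0] hy xE; suff y0 : y = 0 by rewrite xE y0 raddf0.
apply: (@Linj k (n - k.+2).+2) => //; first lia.
by rewrite iterSr -xE.
Qed.

(* [b] and [c] are the images of the primitive [k]-form [x] under the two
   operators of the primitive complex. *)
Definition cov_split k x b c :=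
  [/\ D x = b + L c,
      if (k < n)%N then prim k.+1 b else b = 0 &
      if k is j.+1 then prim j c else c = 0].

Lemma prim_low k x : (k <= 1)%N -> (k <= n)%N -> Om k x -> prim k x.
Proof.
move=> k1 kn hx; split => //; apply: (Omtop _ (Om_iter OmL _ hx)); lia.
Qed.

Lemma primN k x : prim k x -> prim k (- x).
Proof.
move=> [lek hx x0]; split => //; first exact: OmN.
have := iterL_linear L (n - k).+1 (-1) x 0.
by rewrite addr0 scaleN1r => ->; rewrite x0 iterL0 scaler0 addr0.
Qed.

Lemma cov_splitN k x b c : prim k x -> cov_split k x b c ->
  cov_split k (- x) (- b) (- c).
Proof.
move=> [_ hx _] [DE hb hc]; split.
- by rewrite (covN hx) DE raddfN opprD.
- by case: ifP hb => _; [exact: primN|move=> ->; rewrite oppr0].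
- by case: (k) hc => [->|j]; [rewrite oppr0|exact: primN].
Qed.

Lemma L_inj0 x : (0 < n)%N -> Om 0 x -> L x = 0 -> x = 0.
Proof. by move=> n0 hx Lx; apply: (Linj (k := 0) (a := 1)). Qed.

(** [D] commutes with [L], hence [D x] is killed by the same power of [L] as [x]; this makes the
    second component primitive and leaves no room for a third one. When [x] has degree [n], [D x]
    lies above the middle and is entirely in the image of [L]. *)
Lemma cov_split_ex k x : (0 < n)%N -> prim k x -> exists b c, cov_split k x b c.
Proof.
move=> n0 [lek hx x0].
have DLx0 : iter (n - k).+1 L (D x) = 0 by rewrite -(cov_iterL _ hx) x0 cov0.
case: k lek hx x0 DLx0 => [|k] lek hx x0 DLx0.
  exists (D x), 0; split; rewrite ?raddf0 ?addr0// n0; split => //; first exact: Om_cov.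
  rewrite subn1 prednK//; apply: (Omtop _ (Om_iter OmL n (Om_cov hx))); lia.
have [ltk|gek] := ltnP k.+1 n.
  have [b [y [hb b0 hy DE]]] := decomp ltk (Om_cov hx).
  exists b, y; split; rewrite ?ltk//; split => //; first lia.
  move: DLx0; rewrite DE iterLD (_ : (n - k.+1).+1 = (n - k.+2).+2)%N; last lia.
  rewrite iterS b0 raddf0 add0r -iterSr => y0.
  by rewrite (_ : (n - k = (n - k.+2).+2)%N)//; lia.
have Ek : k.+1 = n by lia.
have [|y hy DE] := @Lsurj k (D x) _ (Om_cov hx); first lia.
exists 0, y; split; rewrite ?add0r ?Ek ?ltnn//; split => //; first lia.
rewrite (_ : n - k = 1)%N; last lia.
by move: DLx0; rewrite Ek subnn DE.
Qed.

(** Of [c'] only the degree is assumed, since this is what is known of a value of [Linv]; its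
    primitivity is a consequence. Below the middle, [b - b'] is primitive and in the image of [L],
    hence zero. *)
Lemma cov_split_uniq k x b c b' c' : prim k x -> cov_split k x b c ->
  D x = b' + L c' -> (if (k < n)%N then prim k.+1 b' else b' = 0) ->
  (if k is j.+1 then Om j c' else c' = 0) -> b' = b /\ c' = c.
Proof.
move=> [lek hx x0] [-> hb hc].
case: k lek hx x0 hb hc => [|k] lek hx x0 hb hc.
  by move=> H _ c'0; move: H; rewrite hc c'0 !raddf0 !addr0 => ->.
move=> H hb' hc'; have hcc : Om k (c' - c) by apply: OmB => //; case: hc.
have : b - b' = L (c' - c).
  have Lc' : L c' = b + L c - b' by rewrite H addrAC subrr add0r.
  by rewrite raddfB/= Lc' addrAC addrK.
case: ltnP hb hb' => [ltk|gek] hb hb' E.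
  have [||E1 E2] := @prim_imL k (b - b') (c' - c) _ hcc; [exact: primB| |].
    by rewrite E.
  by split; apply/eqP; rewrite -subr_eq0 ?E2// -opprB E1 oppr0.
rewrite hb hb' subrr in E; rewrite hb hb'; split => //; apply/eqP.
by rewrite -subr_eq0; apply/eqP/(@Linj k 1) => //; lia.
Qed.

Lemma prim_part k x : (k <= n)%N -> Om k x -> exists b y,
  [/\ prim k b, if k is j.+2 then Om j y else y = 0 & x = b + L y].
Proof.
case: k => [|[|k]] lek hx; last first.
  have [b [y [hb b0 hy xE]]] := decomp lek hx.
  by exists b, y; split.
all: exists x, 0; split; rewrite ?raddf0 ?addr0//; split => //.
all: by apply: (Omtop _ (Om_iter OmL _ hx)); lia.
Qed.

(** Covers uniformly the forms of degree [k - 1], a form of degree -1 being encoded by [y = 0]. *)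
Lemma Om_lower k y : (if k is j.+1 then Om j y else y = 0) ->
  [/\ Om k.+1 (L y), Om k (D y), D (L y) = L (D y) & D (D y) = Phi (L y)].
Proof.
case: k => [->|k hy]; first by rewrite raddf0 !cov0 !raddf0; split.
by split; auto; [exact: covL hy|exact: cov_cov hy].
Qed.

(** From [D x = L c] one gets [L (D c) = D (D x) = L (Phi x)], and [L] is injective below the middle
    degree. For [k = n] it is not injective on [n]-forms, but the second-order cocycle condition
    gives [D c = Phi x + L c'], so that [L (L c') = 0] with [c'] of degree [n - 2], where [L^2] is
    injective. *)
Lemma cocycle_plus k x c : (0 < k)%N -> prim k x -> cov_split k x 0 c ->
  ((k < n)%N \/ k = n /\ exists c', cov_split k.-1 c (Phi x) c') ->
  D c = Phi x.
Proof.
case: k => // k _ [lek hx x0] [Dx _ hc] H.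
rewrite add0r in Dx; have [lek' hc' c0] := hc.
have LDc : L (D c) = L (Phi x) by rewrite -(covL hc') -Dx (cov_cov hx) LPhi.
case: H => [ltk|[Ek [c' [E1 _ h2]]]].
  apply/eqP; rewrite -subr_eq0; apply/eqP/(@Linj k.+1 1) => //; first by auto.
  by rewrite /= raddfB/= LDc subrr.
rewrite E1; move: LDc; rewrite E1 raddfD/= => /(canRL (addKr _)); rewrite addNr.
case: k {lek x0 hc lek' c0 hx} h2 Ek hc' E1 => [->|k [_ hcc _] Ek hc' E1].
  by rewrite raddf0 addr0.
move=> h; rewrite (_ : c' = 0) ?raddf0 ?addr0//.
by apply: (@Linj k 2) => //; lia.
Qed.

Lemma potential_plus k x c : Om k.+1 x -> Om k c -> D x = L c -> D c = Phi x ->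
  exists2 m, Om k m & x - ell c = d m /\ d (c - Phi m) = 0.
Proof.
move=> hx hc Dx Dc.
have dx : d x = L c - Phi (ell x) by rewrite -Dx addrK.
have dc : d c = Phi x - Phi (ell c) by rewrite -Dc addrK.
have h : Om k.+1 (x - ell c) by auto.
have [|m hm mE] := poincare h.
  rewrite (dB hx (Omell hc)) dx (dell hc) (_ : ell (d c) = Phi (ell x)) ?subrr//.
  by rewrite dc linearB/= !ellPhi (ellell hc) linear0 subr0.
exists m => //; split => //.
by rewrite (dB hc (OmPhi hm)) (dPhi hm) -mE dc raddfB/= subrr.
Qed.

Lemma exact_plus k x c : prim k.+2 x -> D x = L c -> Om k.+1 c -> D c = Phi x ->
  exists2 m, prim k.+1 m & exists c', cov_split k.+1 m x c'.
Proof.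
move=> px Dx hc Dc; have [lek hx x0] := px.
have [m hm [xE]] := potential_plus hx hc Dx Dc.
move=> dcm; have [v hv vE] := poincare (OmB hc (OmPhi hm)) dcm.
pose m' := m - ell v.
have hm' : Om k.+1 m' by apply: OmB; auto.
have xE' : x = D m' + L v.
  rewrite (covB hm (Omell hv)) (covell hv) opprB addrA subrK -vE linearB/=.
  by rewrite ellPhi /D addrA [X in X - _]addrAC addrK -xE subrK.
have [b [y [pb hy m'E]]] := prim_part (ltnW lek) hm'.
have {hy} [hLy hDy DLy _] := Om_lower hy.
exists b => //; have [b' [c' bE]] := cov_split_ex (ltn_trans (ltn0Sn k) lek) pb.
exists c'; suff <- : b' = x by [].
have [Db pb' [_ hc' _]] := bE; rewrite lek in pb'; have [_ hb _] := pb.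
apply/eqP; rewrite eq_sym -subr_eq0; apply/eqP.
(* Both [x] and [b'] are primitive, while substituting [m' = b + L y] and [D b = b' + L c'] exhibits
   their difference as a value of [L]. *)
have [|||-> //] := @prim_imL k (x - b') (c' + D y + v); first exact: primB.
  by apply: OmD => //; apply: OmD.
rewrite xE' m'E (covD hb hLy) Db DLy !raddfD/=.
by rewrite addrC !addrA addNr add0r.
Qed.

(** [D s] is the power [n - k] of [L] applied to [b], and this power kills primitive forms of degree
    [k + 1]. For [k = 0], [D s] has degree [2 n + 1]. *)
Lemma cocycle_minus k x : prim k x -> (if k is j.+1 then exists2 b, D x = b &
    if (k < n)%N then prim k.+1 b else b = 0 else True) ->
  let s := iter (n - k) L x in [/\ Om (n.*2 - k) s, D s = 0 & L s = 0].
Proof.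
move=> [lek hx x0] H s.
have hs : Om (k + (n - k).*2) s by exact: (Om_iter OmL).
split; [by rewrite (_ : n.*2 - k = k + (n - k).*2)%N//; lia| |exact: x0].
rewrite (cov_iterL _ hx).
case: k lek hx x0 H @s hs => [|k] lek hx x0 H s hs.
  by apply: (Omtop _ (Om_iter OmL _ (Om_cov hx))); lia.
case: H => b -> {s hs}; case: ltnP => [ltk [_ _ b0]|_ ->]; last exact: iterL0.
by rewrite (_ : n - k.+1 = (n - k.+2).+1)%N//; lia.
Qed.

(** With the formal theta of the introduction, the conclusion says that theta s is the image of m -
    theta v under D - Phi theta. *)
Lemma potential_minus k s : Om k.+1 s -> D s = 0 -> L s = 0 ->
  exists m v, [/\ Om k.+1 m, Om k v, D m = L v & s = D v - Phi m].
Proof.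
move=> hs Ds Ls.
have ds : d s = - Phi (ell s) by apply/eqP; rewrite -addr_eq0 -[_ + _]/(D s) Ds.
have [|m hm mE] := poincare (Omell hs).
  by rewrite (dell hs) Ls sub0r ds raddfN/= ellPhi (ellell hs) raddf0 !oppr0.
have [||v hv vE] := @poincare k (s + Phi m); first by auto.
  by rewrite (dD hs (OmPhi hm)) (dPhi hm) -mE ds addNr.
exists (m + ell v), v; split; auto.
  rewrite (covD hm (Omell hv)) (covell hv) -vE raddfD/= ellPhi.
  by rewrite (_ : ell s + _ = D m) ?/D -?mE// addrC subrK.
by rewrite /D -vE raddfD/= -(addrA s) addrK.
Qed.

Lemma exact_minus k x : (k < n)%N -> prim k x ->
  (if k is j.+1 then exists2 b, D x = b & prim k.+1 b else True) ->
  exists2 g, prim k.+1 g & exists b, cov_split k.+1 g b x.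
Proof.
move=> ltk px H; have [lek hx x0] := px.
have [|hs Ds Ls] := @cocycle_minus k x px; first by rewrite ltk.
set s := iter _ _ _ in hs Ds Ls.
have [i Ei] : exists i, (n.*2 - k = i.+2)%N by exists (n.*2 - k).-2; lia.
rewrite Ei in hs; have [m [v [hm hv Dm sE]]] := potential_minus hs Ds Ls.
have [|r hr mE] := @Lsurj i m _ hm; first lia.
pose v' := v - D r; have hv' : Om i.+1 v' by apply: OmB => //; auto.
have Lv' : L v' = 0 by rewrite raddfB/= -Dm mE (covL hr) subrr.
have sE' : s = D v' by rewrite (covB hv (Om_cov hr)) (cov_cov hr) sE mE.
have [|g hg gE] := Lker ltk _ Lv'.
  by rewrite (_ : n.*2 - k.+1 = i.+1)%N//; lia.
have pg : prim k.+1 g by split => //; rewrite iterS -gE.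
have [|b [c gbc]] := cov_split_ex _ pg; first lia.
exists g => //; exists b; suff -> : x = c by [].
have [Dg hb [_ hc _]] := gbc.
apply/eqP; rewrite -subr_eq0; apply/eqP/(@Linj k (n - k)); [lia|by auto|].
(* [x] and [c] are compared through their images under [L^(n - k)], which is injective in degree
   [k]: in [D v' = L^(n - k - 1) (b + L c)] the primitive term [b] disappears. *)
have : s = iter (n - k) L c.
  rewrite sE' gE (cov_iterL _ hg) Dg iterLD.
  rewrite (_ : n - k = (n - k.+1).+1)%N -?iterSr; last lia.
  suff -> : iter (n - k.+1) L b = 0 by rewrite add0r.
  case: ltnP hb => [ltk' [_ _ b0]|_ ->]; last exact: iterL0.
  by rewrite (_ : n - k.+1 = (n - k.+2).+1)%N//; lia.
have := iterL_linear L (n - k) (-1) c x.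
by rewrite [_ *: c + x]addrC !scaleN1r => -> <-; rewrite addNr.
Qed.

Lemma prim_Phi k x : prim k x -> prim k (Phi x).
Proof.
move=> [lek hx x0]; split; auto.
suff -> r : iter r L (Phi x) = Phi (iter r L x) by rewrite x0 raddf0.
by elim: r => //= r ->; rewrite LPhi.
Qed.

(** Replacing [m] by its primitive part [g = m - L r] replaces [v] by [c = v - D r], and the two
    corrections to [D v - Phi m] cancel because [D (D r) = Phi (L r)]. Then [x] and [b - Phi g] are
    primitive and differ by [L c']. *)
Lemma exact_middle x : (0 < n)%N -> prim n x -> D x = 0 ->
  exists2 g, prim n g & exists c b c',
    [/\ cov_split n g 0 c, cov_split n.-1 c b c' & x = b - Phi g].
Proof.
move=> n0 px Dx; have [lek hx x0] := px.
have Lx : L x = 0 by move: x0; rewrite subnn.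
have [m [v [hm hv Dm xE]]] : exists m v,
    [/\ Om n m, Om n.-1 v, D m = L v & x = D v - Phi m].
  by have := @potential_minus n.-1 x; rewrite prednK//; exact.
have [g [r [pg hr mE]]] := prim_part (leqnn n) hm.
have [b0 [c gc]] := cov_split_ex n0 pg; have [Dg + pc] := gc.
rewrite ltnn => b00; rewrite {}b00 add0r in gc Dg.
have pc' : prim n.-1 c by move: pc; case: (n) n0.
have [b [c' cbc]] := cov_split_ex n0 pc'; have [Dc pb hc'] := cbc.
rewrite ltn_predL n0 prednK// in pb.
have [|hLr hDr DLr DDr] := @Om_lower n.-1 r; first by move: hr; case: (n) n0 => [|[]].
rewrite prednK// in hLr.
exists g => //; exists c, b, c'; split => //.
have [[_ hg _] [_ hc _]] := (pg, pc').
have vE : v = c + D r.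
  apply/eqP; rewrite -subr_eq0; apply/eqP/(@Linj n.-1 1); [lia|by auto|].
  by rewrite /= raddfB raddfD/= -Dm mE (covD hg hLr) Dg DLr subrr.
have xE' : x = D c - Phi g.
  by rewrite xE vE mE (covD hc hDr) raddfD/= DDr opprD addrACA subrr addr0.
have px' := primB px (primB pb (prim_Phi pg)).
have E : x - (b - Phi g) = L c'.
  by rewrite xE' Dc opprB addrA subrK addrAC subrr add0r.
apply/eqP; rewrite -subr_eq0; apply/eqP.
case: (n) n0 hc' px' E => [//|[|j]] _ /=; first by move=> -> _ ->; rewrite raddf0.
by move=> [_ hc' _] px' E; have [] := prim_imL px' hc' E.
Qed.

End primitive_cohomology.

(** * Smooth functions *)

Section differentiability.
Context {R : realType}.
Implicit Types U V W : normedModType R.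

Lemma differentiable_epsP V W (f : V -> W) (df : {linear V -> W}) x :
  continuous df ->
  (forall e, 0 < e -> \forall h \near (0 : V),
     `|f (h + x) - f x - df h| <= e * `|h|) ->
  differentiable f x /\ 'd f x = df :> (V -> W).
Proof.
move=> dfc H; have E : f \o shift x = cst (f x) + df +o_ (0 : V) id.
  apply/eqaddoP => e e0; have := H e e0; apply: filterS => h /=.
  by rewrite !fctE/= opprD addrA.
have dE := diff_unique dfc E; split => //.
by apply/diff_locallyP; rewrite dE.
Qed.

Lemma near_eq_diff V W (f g : V -> W) x : (\forall y \near x, f y = g y) ->
  differentiable f x -> differentiable g x /\ 'd g x = 'd f x :> (V -> W).
Proof.
move=> fg df; apply: differentiable_epsP; first exact: diff_continuous.
move=> e e0; have /diff_locallyP[_ /eqaddoP/(_ e e0)] := df.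
have : \forall h \near (0 : V), f (h + x) = g (h + x).
  by have := fg; rewrite (near_shift 0) subr0.
have fgx := nbhs_singleton fg.
apply: filterS2 => h fgh; rewrite !fctE/= fgh fgx.
by rewrite opprD addrA.
Qed.

Lemma open_near_eq V (T : Type) (D : set V) (f g : V -> T) x : open D -> D x ->
  (forall y, D y -> f y = g y) -> \forall y \near x, f y = g y.
Proof.
move=> oD Dx fg; have := open_nbhs_nbhs (conj oD Dx).
by apply: filterS => y; exact: fg.
Qed.

Lemma rV_linear_continuous m W (f : {linear 'rV[R]_m -> W}) : continuous f.
Proof.
have -> : (f : _ -> _) = \sum_(i < m) (fun x : 'rV[R]_m => x ord0 i *: f (delta_mx 0 i)).
  apply/funext => x; rewrite {1}(row_sum_delta x) linear_sum fct_sumE.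
  by apply: eq_bigr => i _; rewrite linearZ.
move=> x; apply: differentiable_continuous; apply: differentiable_sum => i.
by apply: differentiableZl; exact: differentiable_coord.
Qed.

Lemma derive_row_sum m W (f : 'rV[R]_m -> W) x v : differentiable f x ->
  'D_v f x = \sum_(i < m) v ord0 i *: 'D_(delta_mx ord0 i) f x.
Proof.
move=> df; rewrite deriveE// {1}(row_sum_delta v) linear_sum.
by apply: eq_bigr => i _; rewrite deriveE// linearZ.
Qed.

Lemma differentiable_row V p (f : V -> 'rV[R]_p) x :
  (forall i, differentiable (fun y => f y ord0 i : R) x) -> differentiable f x.
Proof.
move=> df.
rewrite (_ : f = \sum_(i < p) (fun y => (f y ord0 i : R) *: delta_mx ord0 i)).
  by apply: differentiable_sum => i; exact: differentiableZl.
apply/funext => y; rewrite fct_sumE {1}(row_sum_delta (f y)) //.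
Qed.

Lemma differentiable_row_coord V p (f : V -> 'rV[R]_p) x i :
  differentiable f x -> differentiable (fun y => f y ord0 i : R) x.
Proof.
move=> df; have := differentiable_comp df (differentiable_coord (f x) ord0 i).
exact.
Qed.

Lemma derive_row_coord V p (f : V -> 'rV[R]_p) x v i : derivable f x v ->
  ('D_v f x) ord0 i = 'D_v (fun y => f y ord0 i : R) x.
Proof. by move=> df; rewrite derive_mx// mxE. Qed.

End differentiability.

(** * Stability of the classes C^k under algebraic operations *)

Section Cn_closure.
Context {R : realType}.
Implicit Types (U V W : normedModType R) (k : nat).

Lemma Cn_on_eq U W k (D : set U) (f g : U -> W) : open D ->
  (forall x, D x -> f x = g x) -> Cn_on k D f -> Cn_on k D g.
Proof.
move=> oD; elim: k f g => [|k IHk] f g fg /=.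
  move=> cf x Dx; have E := open_near_eq oD Dx fg.
  apply: (cvg_trans (near_eq_cvg E)); rewrite -(fg x Dx); exact: cf.
move=> [df cf]; split=> [x Dx|v].
  exact: (near_eq_diff (open_near_eq oD Dx fg) (df x Dx)).1.
apply: IHk (cf v) => x Dx; apply: near_eq_derive; exact: open_near_eq fg.
Qed.

Lemma Cn_on_sub U W k (D D' : set U) (f : U -> W) : D' `<=` D ->
  Cn_on k D f -> Cn_on k D' f.
Proof.
move=> DD; elim: k f => [|k IHk] f /=; first by move=> cf x /DD; exact: cf.
by move=> [df cf]; split=> [x /DD|v]; [exact: df|exact: IHk].
Qed.

Lemma Cn_onW U W k (D : set U) (f : U -> W) : Cn_on k.+1 D f -> Cn_on k D f.
Proof.
elim: k f => [|k IHk] f; last first.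
  by move=> [df cf]; split => // v; exact: IHk.
by move=> [df _] x Dx; apply: differentiable_continuous; exact: df.
Qed.

(** The conditions in [Cn_on] are imposed point by point, on derivatives taken in the ambient space,
    so that they can be checked at each point with a set of its own. *)
Lemma Cn_on_local U W k (D : set U) (f : U -> W) :
  (forall x, D x -> exists2 D', D' x & Cn_on k D' f) -> Cn_on k D f.
Proof.
elim: k f => [|k IHk] f H /=.
  by move=> x Dx; have [D' D'x cf] := H x Dx; exact: cf.
split=> [x Dx|v]; first by have [D' D'x [df _]] := H x Dx; exact: df.
by apply: IHk => x Dx; have [D' D'x [_ cf]] := H x Dx; exists D' => //; exact: cf.
Qed.

Lemma Cn_on_cst U W k (D : set U) (c : W) : Cn_on k D (fun _ => c).
Proof.
elim: k c => [|k IHk] c /=; first by move=> x _; exact: cst_continuous.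
split=> [x _|v]; first exact: differentiable_cst.
rewrite (_ : 'D_v (fun _ => c) = (fun _ => 0)); first exact: IHk.
by apply/funext => x; exact: derive_cst.
Qed.

Lemma Cn_onD U W k (D : set U) (f g : U -> W) : open D ->
  Cn_on k D f -> Cn_on k D g -> Cn_on k D (fun x => f x + g x).
Proof.
move=> oD; elim: k f g => [|k IHk] f g /=.
  by move=> cf cg x Dx; apply: continuousD; [exact: cf|exact: cg].
move=> [df cf] [dg cg]; split=> [x Dx|v].
  by apply: differentiableD; [exact: df|exact: dg].
apply: Cn_on_eq (IHk _ _ (cf v) (cg v)) => // x Dx.
by rewrite -[RHS]/('D_v (f + g) x) deriveD//; apply: diff_derivable; [exact: df|exact: dg].
Qed.

Lemma Cn_onM U k (D : set U) (f g : U -> R^o) : open D ->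
  Cn_on k D f -> Cn_on k D g -> Cn_on k D (fun x => f x * g x : R^o).
Proof.
move=> oD; elim: k f g => [|k IHk] f g.
  by move=> cf cg x Dx; apply: continuousM; [exact: cf|exact: cg].
move=> sf sg; have [df cf] := sf; have [dg cg] := sg; split=> [x Dx|v].
  by apply: differentiableM; [exact: df|exact: dg].
have := Cn_onD oD (IHk _ _ (Cn_onW sf) (cg v)) (IHk _ _ (Cn_onW sg) (cf v)).
apply: Cn_on_eq => // x Dx.
rewrite -[RHS]/('D_v (f * g) x) deriveM//; apply: diff_derivable; [exact: df|exact: dg].
Qed.

Lemma Cn_onV U k (D : set U) (f : U -> R^o) : open D ->
  (forall x, D x -> f x != 0) ->
  Cn_on k D f -> Cn_on k D (fun x => (f x)^-1 : R^o).
Proof.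
move=> oD f0; elim: k => [|k IHk].
  by move=> cf x Dx; apply: cvgV; [exact: f0|exact: cf].
move=> sf; have [df cf] := sf; split=> [x Dx|v].
  by apply: differentiableV; [exact: df|exact: f0].
have sV := IHk (Cn_onW sf).
have := Cn_onM oD (Cn_on_cst k D (-1 : R^o)) (Cn_onM oD (Cn_onM oD sV sV) (cf v)).
apply: Cn_on_eq => // x Dx.
rewrite deriveV//; [|exact: f0|by apply: diff_derivable; exact: df].
by rewrite /GRing.scale/= mulN1r expr2 invfM mulNr.
Qed.

Lemma Cn_on_row U p k (D : set U) (f : U -> 'rV[R]_p) : open D ->
  Cn_on k D f <-> forall i, Cn_on k D (fun x => f x ord0 i : R^o).
Proof.
move=> oD; elim: k f => [|k IHk] f /=.
  split=> cf.
    by move=> i x Dx; have := cvg_comp _ _ (cf x Dx) (@coord_continuous R 1 p ord0 i (f x)).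
  move=> x Dx.
  have -> : f = \sum_(i < p) (fun y => (f y ord0 i : R^o) *: (delta_mx ord0 i : 'rV[R]_p)).
    by apply/funext => y; rewrite fct_sumE {1}(row_sum_delta (f y)).
  elim/big_ind: _ => [|g h cg ch|i _]; first exact: cst_continuous.
    exact: continuousD.
  by apply: cvgZr_tmp; exact: cf.
split=> [[df cf] i|cf].
  split=> [x Dx|v]; first by apply: differentiable_row_coord; exact: df.
  have /IHk/(_ i) := cf v; apply: Cn_on_eq => // x Dx.
  by apply: derive_row_coord; apply: diff_derivable; exact: df.
have df x : D x -> differentiable f x.
  by move=> Dx; apply: differentiable_row => i; apply: (cf i).1.
split=> // v; apply/IHk => i; have := (cf i).2 v; apply: Cn_on_eq => // x Dx.
by apply/esym/derive_row_coord; apply: diff_derivable; exact: df.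
Qed.

End Cn_closure.

(** * Integration over the unit interval *)

Section integral01.
Context {R : realType}.
Implicit Types f g : R -> R.

Definition int01 f : R := \int[lebesgue_measure]_(t in `[0%R, 1%R]) f t.

Lemma integrable01 f : continuous f ->
  lebesgue_measure.-integrable `[0%R, 1%R] (EFin \o f).
Proof.
move=> cf; apply: continuous_compact_integrable; first exact: segment_compact.
exact: continuous_subspaceT.
Qed.

Lemma continuous_lincomb (a : R) f g : continuous f -> continuous g ->
  continuous (fun t => a * f t + g t).
Proof.
move=> cf cg t; apply: cvgD; last exact: cg.
by apply: cvgM; [exact: cvg_cst|exact: cf].
Qed.

Lemma int01P (a : R) f g : continuous f -> continuous g ->
  int01 (fun t => a * f t + g t) = a * int01 f + int01 g.
Proof.
move=> cf cg; rewrite /int01 RintegralD//=.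
- by rewrite RintegralZl//; exact: integrable01.
- apply: integrable01 => x; apply: (@continuousM _ _ (cst a) f); last exact: cf.
  exact: cst_continuous.
- exact: integrable01.
Qed.

Lemma int01_norm_le f C : continuous f ->
  (forall t, 0 <= t <= 1 -> `|f t| <= C) -> `|int01 f| <= C.
Proof.
move=> cf fC; rewrite /int01; apply: (le_trans (le_normr_Rintegral _ _)) => //.
  exact: integrable01.
have mu1 : fine (lebesgue_measure (`[0%R, 1%R] : set R)) = 1 :> R.
  by rewrite lebesgue_measure_itv/= lte01 oppr0 adde0.
rewrite (_ : C = \int[lebesgue_measure]_(t in `[0%R, 1%R]) C); last first.
  by rewrite Rintegral_cst// mu1 mulr1.
apply: le_Rintegral => //=.
- apply: (@integrable01 (fun x => `|f x|)) => x; apply: (@cvg_norm _ R^o); exact: cf.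
- by apply: (@integrable01 (cst C)); exact: cst_continuous.
Qed.

Lemma int01_FTC f (F : R -> R) : continuous f ->
  (forall t : R, is_derive t 1 F (f t)) -> int01 f = F 1 - F 0.
Proof.
move=> cf dF; have cF : continuous F.
  by move=> t; apply/differentiable_continuous/derivable1_diffP; exact: ex_derive.
rewrite /int01 /Rintegral (@continuous_FTC2 _ f F)//=.
- exact: continuous_subspaceT.
- split; [by move=> t _; exact: ex_derive| |].
    by apply: cvg_at_right_filter; exact: cF.
  by apply: cvg_at_left_filter; exact: cF.
- by move=> t _; rewrite derive1E; exact: derive_val.
Qed.

End integral01.

(** * Mean values along lines and symmetry of second derivatives *)

Section line.
Context {R : realType}.
Implicit Types U V W : normedModType R.

Lemma is_derive_line V W (f : V -> W) (a v : V) (s : R) :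
  differentiable f (s *: v + a) ->
  is_derive s 1 (fun t => f (t *: v + a)) ('D_v f (s *: v + a)).
Proof.
move=> df.
have E : (fun h : R => h^-1 *: (((fun t => f (t *: v + a)) \o shift s) (h *: (1 : R)) -
    f (s *: v + a))) = (fun h => h^-1 *: ((f \o shift (s *: v + a)) (h *: v) -
    f (s *: v + a))).
  apply/funext => h; congr (_ *: (_ - _)) => /=; congr f.
  by rewrite /shift /= addrA -scalerDl; congr (_ *: _ + _); rewrite [_ *: 1]mulr1.
have dv : derivable f (s *: v + a) v by exact: diff_derivable.
apply: DeriveDef; first by rewrite /derivable E.
by rewrite /derive E.
Qed.

Lemma MVT_line V (f : V -> R^o) (a v : V) (h : R) : 0 < h ->
  (forall s, 0 <= s <= h -> differentiable f (s *: v + a)) ->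
  exists2 c, 0 <= c <= h & f (h *: v + a) - f a = 'D_v f (c *: v + a) * h.
Proof.
move=> h0 df; pose F t : R := f (t *: v + a).
have dF t : t \in `[0, h] -> is_derive t 1 F ('D_v f (t *: v + a)).
  by rewrite in_itv/= => th; apply: is_derive_line; exact: df.
have dF' t : t \in `]0, h[ -> is_derive t 1 F ('D_v f (t *: v + a)).
  by move=> th; apply: dF; move: th; rewrite !in_itv/= => /andP[t0 th]; rewrite !ltW.
have cF : {within `[0, h], continuous F}.
  by apply: derivable_within_continuous => t /dF[].
have [c ch E] := MVT h0 dF' cF.
exists c; first by move: ch; rewrite in_itv/= => /andP[c0 ch]; rewrite !ltW.
by move: E; rewrite /F subr0 scale0r add0r.
Qed.

Lemma derive_translate V W (f : V -> W) (c v x : V) :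
  'D_v (fun y => f (c + y)) x = 'D_v f (c + x).
Proof.
have E : (fun h : R => h^-1 *: (((fun y => f (c + y)) \o shift x) (h *: v) -
    f (c + x))) = (fun h => h^-1 *: ((f \o shift (c + x)) (h *: v) - f (c + x))).
  by apply/funext => h /=; rewrite addrCA.
by rewrite /derive E.
Qed.

(** Two mean value theorems: along [v] for the increment [g] of [f] in the direction [w], then along
    [w] for the derivative of [f] in the direction [v]. *)
Lemma second_difference V (D : set V) (f : V -> R^o) (x v w : V) (h : R) :
  0 < h ->
  (forall s t, 0 <= s <= h -> 0 <= t <= h -> D (s *: v + (t *: w + x))) ->
  Cn_on 2 D f -> exists s t, [/\ 0 <= s <= h, 0 <= t <= h &
    f (h *: v + (h *: w + x)) - f (h *: w + x) - (f (h *: v + x) - f x) =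
    'D_w ('D_v f) (s *: v + (t *: w + x)) * h * h].
Proof.
move=> h0 HD [df /(_ v)[dDf _]].
have D0 s : 0 <= s <= h -> D (s *: v + x).
  by move=> sh; have := HD s 0 sh; rewrite scale0r add0r lexx (ltW h0); exact.
pose g y : R^o := f ((h *: w) + y) - f y.
have dfw y : D (h *: w + y) -> differentiable (fun y => f (h *: w + y)) y.
  move=> Dy; apply: (@differentiable_comp _ _ _ _ (fun y => h *: w + y) f); last exact: df.
  exact: differentiableD.
have Dw s : 0 <= s <= h -> D (h *: w + (s *: v + x)).
  by move=> sh; rewrite addrCA; apply: HD => //; rewrite lexx ltW.
have dg s : 0 <= s <= h -> differentiable g (s *: v + x).
  move=> sh; apply: differentiableB; first by apply: dfw; exact: Dw.
  exact/df/D0.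
have [s sh E] := MVT_line h0 dg.
have dDf' t : 0 <= t <= h -> differentiable ('D_v f) (t *: w + (s *: v + x)).
  by move=> th; rewrite addrCA; apply/dDf/HD.
have [t th E'] := MVT_line h0 dDf'.
exists s, t; split => //.
have -> : f (h *: v + (h *: w + x)) - f (h *: w + x) - (f (h *: v + x) - f x) =
    g (h *: v + x) - g x by rewrite /g addrCA !opprB addrACA [RHS]addrACA (addrC (- _)).
rewrite E; congr (_ * h).
have -> : 'D_v g (s *: v + x) = 'D_v f (h *: w + (s *: v + x)) - 'D_v f (s *: v + x).
  rewrite deriveB; [|exact/diff_derivable/dfw/Dw|exact/diff_derivable/df/D0].
  by rewrite derive_translate.
rewrite E' [t *: w + _]addrCA.
reflexivity.
Qed.

(** The second difference is symmetric in [v] and [w], so that either mixed derivative, taken at a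
    suitable point of a small parallelogram, computes it. If the two differed at [x], continuity
    would keep them apart near [x]; [e] is half the gap. *)
Lemma derive_comm V (D : set V) (f : V -> R^o) (x v w : V) : open D -> D x ->
  Cn_on 2 D f -> 'D_w ('D_v f) x = 'D_v ('D_w f) x.
Proof.
move=> oD Dx C2.
pose A := 'D_w ('D_v f); pose B := 'D_v ('D_w f).
have cA : {for x, continuous A} by case: C2 => _ H; case: (H v) => _ H'; exact: (H' w x Dx).
have cB : {for x, continuous B} by case: C2 => _ H; case: (H w) => _ H'; exact: (H' v x Dx).
rewrite -/(A x) -/(B x); apply/eqP; rewrite -subr_eq0 -normr_eq0.
rewrite -[_ == _]negbK; apply/negP => AB.
pose e := `|A x - B x| / 2; have e0 : 0 < e by rewrite divr_gt0// lt_def AB normr_ge0.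
have nA : \forall y \near x, `|A x - A y| < e by move/cvgrPdist_lt : cA; apply.
have nB : \forall y \near x, `|B x - B y| < e by move/cvgrPdist_lt : cB; apply.
have nD : \forall y \near x, D y by exact: open_nbhs_nbhs.
have /nbhs_ballP[r /= r0 Hr] : \forall y \near x,
  [/\ D y, `|A x - A y| < e & `|B x - B y| < e].
  by move: nD nA nB; apply: filterS3.
(* Small enough for the parallelogram with sides [h v] and [h w] at [x] to lie in the ball of radius
   [r]; the summand 1 keeps the denominator positive. *)
pose h := r / (`|v| + `|w| + 1).
have k0 : 0 < `|v| + `|w| + 1 by rewrite ltr_wpDl// addr_ge0.
have h0 : 0 < h by rewrite divr_gt0.
have Hh s t : 0 <= s <= h -> 0 <= t <= h ->
    [/\ D (s *: v + (t *: w + x)), `|A x - A (s *: v + (t *: w + x))| < e &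
      `|B x - B (s *: v + (t *: w + x))| < e].
  move=> /andP[s0 sh] /andP[t0 th]; apply: Hr.
  rewrite -ball_normE/= addrA opprD addrCA subrr addr0 normrN.
  rewrite (le_lt_trans (ler_normD _ _))// !normrZ !ger0_norm//.
  rewrite (@le_lt_trans _ _ (h * `|v| + h * `|w|))//.
    by rewrite lerD// ler_wpM2r.
  by rewrite -mulrDr /h mulrAC ltr_pdivrMr// ltr_pM2l// ltrDl.
have [|s [t [sh th E1]]] := @second_difference V D f x v w h h0 _ C2.
  by move=> s t sh th; have [] := Hh s t sh th.
have [|s' [t' [sh' th' E2]]] := @second_difference V D f x w v h h0 _ C2.
  by move=> s' t' sh' th'; rewrite addrCA; have [] := Hh t' s' th' sh'.
have {}E1 := E1 : _ = A _ * h * h.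
have {}E2 := E2 : _ = B _ * h * h.
clearbody A B.
have AB' : A (s *: v + (t *: w + x)) = B (t' *: v + (s' *: w + x)).
  have hN0 : h != 0 by rewrite gt_eqF.
  apply: (mulIf hN0); apply: (mulIf hN0).
  rewrite [t' *: v + _]addrCA -E1 -E2.
  rewrite [h *: w + (h *: v + x)]addrCA !opprB addrACA [RHS]addrACA.
  by rewrite [- f (h *: v + x) + _]addrC.
have [_ lA _] := Hh s t sh th; have [_ _ lB] := Hh t' s' th' sh'.
rewrite AB' in lA.
set b := B (_ + _) in lA lB.
have : `|A x - B x| < e + e.
  by rewrite -(subrKA b) (le_lt_trans (ler_normD _ _))// ltrD// distrC.
by rewrite /e -splitr ltxx.
Qed.

End line.

Section composition.
Context {R : realType}.
Implicit Types (U V W : normedModType R) (k : nat).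

Lemma Cn_on_sum U W k (D : set U) (I : Type) (r : seq I) (f : I -> U -> W) :
  open D -> (forall i, Cn_on k D (f i)) ->
  Cn_on k D (fun x => \sum_(i <- r) f i x).
Proof.
move=> oD cf; elim: r => [|i r IHr].
  apply: (Cn_on_eq (f := fun=> 0)) => // [x _|]; first by rewrite big_nil.
  exact: Cn_on_cst.
apply: (Cn_on_eq (f := fun x => f i x + \sum_(j <- r) f j x)) => // [x _|].
  by rewrite big_cons.
exact: Cn_onD.
Qed.

Lemma derive_comp U W m (f : 'rV[R]_m -> W) (g : U -> 'rV[R]_m) x v :
  differentiable g x -> differentiable f (g x) ->
  'D_v (f \o g) x =
  \sum_(i < m) ('D_v g x) ord0 i *: 'D_(delta_mx ord0 i) f (g x).
Proof.
move=> dg df; rewrite deriveE; last exact: differentiable_comp.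
by rewrite diff_comp// -derive_row_sum//= !deriveE.
Qed.

Lemma Cn_on_comp U m k (D : set U) (D' : set 'rV[R]_m) (f : 'rV[R]_m -> R^o)
    (g : U -> 'rV[R]_m) :
  open D -> (forall x, D x -> D' (g x)) -> Cn_on k D' f -> Cn_on k D g ->
  Cn_on k D (f \o g).
Proof.
move=> oD gD; elim: k f => [|k IHk] f.
  by move=> cf cg x Dx; apply: continuous_comp; [exact: cg|exact/cf/gD].
move=> [df cf] cg; have [dg cg'] := cg; split=> [x Dx|v].
  by apply: differentiable_comp; [exact: dg|exact/df/gD].
apply: (Cn_on_eq (f := fun x => \sum_(i < m)
   (('D_v g x) ord0 i * ('D_(delta_mx ord0 i) f \o g) x : R^o))) => // [x Dx|].
  by apply/esym/derive_comp; [exact: dg|exact/df/gD].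
apply: Cn_on_sum => // i; apply: Cn_onM => //; last by apply: IHk; [exact: cf|exact: Cn_onW].
by have /(Cn_on_row k _ oD)/(_ i) := cg' v.
Qed.

Lemma derive_lin m W (f : 'rV[R]_m -> W) x (a : R) u v : differentiable f x ->
  'D_(a *: u + v) f x = a *: 'D_u f x + 'D_v f x.
Proof. by move=> df; rewrite !deriveE// linearP. Qed.

End composition.

(** * Radial integrals depending smoothly on a point *)

Section taylor.
Context {R : realType} {m : nat}.
Implicit Types (g : 'rV[R]_m -> R^o).

Lemma continuous_ball_bounded g (r : R) : continuous g ->
  exists C : R, forall y, `|y| <= r -> `|g y| <= C.
Proof.
move=> cg; have [r0|r0] := ltP r 0.
  by exists 0 => y yr; have := le_lt_trans yr r0; rewrite normr_lt0.
pose A := [set y : 'rV[R]_m | `|y| <= r].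
have cA : compact A.
  apply: bounded_closed_compact.
    by exists r; split => [|t rt y /le_trans]; [exact: num_real|apply; exact: ltW].
  have -> : A = (fun y => `|y|) @^-1` [set t | t <= r] by [].
  apply: preimage_closed; last exact: closed_le.
  by move=> y _; exact: norm_continuous.
have A0 : A !=set0 by exists 0; rewrite /A/= normr0.
have [|c _ cP] := @EVT_max_rV R m (fun y => `|g y|) A A0 cA.
  apply: continuous_subspaceT => y.
  by have := continuous_comp (cg y) (@norm_continuous _ R^o (g y)).
by exists `|g c| => y yr; apply: cP; rewrite inE.
Qed.

Lemma second_derivative_bounded g (r : R) : Cn_on 2 setT g ->
  exists C, 0 <= C /\
    forall y k, `|y| <= r -> `|'D_k ('D_k g) y| <= C * (`|k| * `|k|).
Proof.
move=> [dg cg].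
pose H i j : 'rV[R]_m -> R^o := 'D_(delta_mx ord0 j) ('D_(delta_mx ord0 i) g).
have HC i j : exists C : R, forall y, `|y| <= r -> `|H i j y| <= C.
  apply: continuous_ball_bounded => y.
  by case: (cg (delta_mx ord0 i)) => _ /(_ (delta_mx ord0 j) y); exact.
pose C i j := `|sval (cid (HC i j))|.
have CP i j y : `|y| <= r -> `|H i j y| <= C i j.
  by move=> yr; rewrite (le_trans (svalP (cid (HC i j)) y yr))// ler_norm.
exists (\sum_(i < m) \sum_(j < m) C i j); split.
  by apply: sumr_ge0 => i _; apply: sumr_ge0 => j _; exact: normr_ge0.
move=> y k yr.
have E : 'D_k ('D_k g) y = \sum_(i < m) \sum_(j < m) k ord0 i * (k ord0 j * H i j y).
  have -> : 'D_k g = \sum_(i < m) (k ord0 i *: 'D_(delta_mx ord0 i) g : 'rV[R]_m -> R^o).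
    apply/funext => z; rewrite fct_sumE derive_row_sum//; exact: dg.
  have dd i : differentiable (k ord0 i *: 'D_(delta_mx ord0 i) g : 'rV[R]_m -> R^o) y.
    by apply: differentiableZ; exact: (cg _).1.
  rewrite derive_sum => [|i]; last exact: diff_derivable.
  apply: eq_bigr => i _; rewrite deriveZ; last exact/diff_derivable/(cg _).1.
  rewrite derive_row_sum; last exact: (cg _).1.
  by rewrite /GRing.scale/= mulr_sumr.
rewrite E (le_trans (ler_norm_sum _ _ _))// mulr_suml ler_sum// => i _.
rewrite (le_trans (ler_norm_sum _ _ _))// mulr_suml ler_sum// => j _.
rewrite !normrM mulrA mulrC ler_pM ?mulr_ge0//; first exact: CP.
have kk l : `|k ord0 l| <= `|k|.
  by rewrite [leRHS]/Num.Def.normr/= mx_normrE; apply: (le_bigmax _ _ (ord0, l)).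
by rewrite ler_pM.
Qed.

(** The constant is uniform on the ball, which is what allows the estimate to be integrated along a
    segment. The intermediate point of the second mean value theorem stays in the ball by
    convexity. *)
Lemma taylor2 g (r : R) : Cn_on 2 setT g -> exists C, 0 <= C /\
  forall y k, `|y| <= r -> `|k + y| <= r ->
    `|g (k + y) - g y - 'D_k g y| <= C * (`|k| * `|k|).
Proof.
move=> c2; have [C [C0 HC]] := second_derivative_bounded r c2.
have [dg cg] := c2.
exists C; split => // y k yr kyr.
have [|s /andP[s0 s1] E1] := MVT_line (f := g) (a := y) (v := k) ltr01.
  by move=> s _; exact: dg.
rewrite scale1r mulr1 in E1; rewrite E1.
have [s0'|s0'] := eqVneq s 0.
  by rewrite s0' scale0r add0r subrr normr0 !mulr_ge0.
have sp : 0 < s by rewrite lt_def s0' s0.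
have [|t /andP[t0 ts] E2] := MVT_line (f := 'D_k g) (a := y) (v := k) sp.
  by move=> t _; exact: (cg _).1.
rewrite E2 normrM (ger0_norm s0).
have ty : `|t *: k + y| <= r.
  have -> : t *: k + y = t *: (k + y) + (1 - t) *: y.
    by rewrite scalerDr -addrA -scalerDl subrKC scale1r.
  have t1 : 0 <= 1 - t by rewrite subr_ge0 (le_trans ts).
  rewrite (le_trans (ler_normD _ _))// !normrZ !ger0_norm//.
  rewrite (le_trans (lerD (ler_wpM2l t0 kyr) (ler_wpM2l t1 yr)))//.
  by rewrite -mulrDl subrKC mul1r.
rewrite (le_trans (ler_wpM2r s0 (HC _ _ ty)))// ler_piMr//.
by rewrite !mulr_ge0.
Qed.

(* Differentiating under the integral sign multiplies the integrand by [t], so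
   that the family of these functions, indexed by [j], is closed under
   directional derivatives; smoothness follows. *)
Definition radial (j : nat) (g : 'rV[R]_m -> R^o) (x : 'rV[R]_m) : R^o :=
  int01 (fun t => t ^+ j * g (t *: x)).

Lemma continuous_radial j g x : continuous g ->
  continuous (fun t : R => t ^+ j * g (t *: x)).
Proof.
move=> cg t; apply: (@continuousM _ _ (fun t : R => t ^+ j)).
  exact: exprn_continuous.
apply: (@continuous_comp _ _ _ (fun t : R => t *: x) g); last exact: cg.
exact: scalel_continuous.
Qed.

Lemma radial_linear j x (g1 g2 : 'rV[R]_m -> R^o) (a : R) :
  continuous g1 -> continuous g2 ->
  radial j (fun y => a * g1 y + g2 y) x = a * radial j g1 x + radial j g2 x.
Proof.
move=> cg1 cg2; rewrite /radial -int01P; try exact: continuous_radial.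
by congr int01; apply/funext => t; rewrite mulrDr mulrCA.
Qed.

Lemma Cn_on_continuous k g : Cn_on k setT g -> continuous g.
Proof.
elim: k => [|k IHk] cg; first by move=> x; exact: cg.
exact/IHk/Cn_onW.
Qed.

(** Differentiation under the integral sign: the candidate differential is linear in the direction,
    and the remainder is the integral of Taylor remainders of [g] at [t x] with increment [t h],
    hence at most [C] times the square of the norm of [h]. *)
Lemma derive_radial j g x : Cn_on 2 setT g -> differentiable (radial j g) x /\
  forall v, 'D_v (radial j g) x = radial j.+1 ('D_v g) x.
Proof.
move=> c2; have [dg cg] := c2.
have cd v : continuous ('D_v g) by exact: (@Cn_on_continuous 1 ('D_v g) (cg v)).
have cg0 := Cn_on_continuous c2.
pose df v : R^o := radial j.+1 ('D_v g) x.
have dfL : linear df.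
  move=> a u v; rewrite /df -[RHS](radial_linear j.+1 x a (cd u) (cd v)).
  by congr radial; apply/funext => y; apply: derive_lin; exact: dg.
pose dfM := GRing.isLinear.Build _ _ _ _ _ dfL.
pose dfl : {linear 'rV[R]_m -> R^o} := HB.pack df dfM.
have cdf : continuous dfl by exact: rV_linear_continuous.
suff H : forall e, 0 < e -> \forall h \near (0 : 'rV[R]_m),
    `|radial j g (h + x) - radial j g x - dfl h| <= e * `|h|.
  have [dr rE] := differentiable_epsP cdf H.
  by split=> // v; rewrite deriveE// rE.
(* This ball contains [t x] and [t (h + x)] for all [t] in the unit interval, when [h] has norm at
   most 1. *)
have [C [C0 HC]] := taylor2 (`|x| + 1) c2.
have key (h : 'rV[R]_m) : `|h| <= 1 ->
    `|radial j g (h + x) - radial j g x - df h| <= C * (`|h| * `|h|).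
  move=> h1.
  pose a t := t ^+ j * g (t *: (h + x)).
  pose b t := t ^+ j * g (t *: x).
  pose c t := t ^+ j.+1 * 'D_h g (t *: x).
  have ca : continuous a by exact: continuous_radial.
  have cb : continuous b by exact: continuous_radial.
  have cc : continuous c := @continuous_radial j.+1 ('D_h g) x (cd h).
  have cab : continuous (fun t => -1 * b t + a t).
    exact: continuous_lincomb.
  have cabc : continuous (fun t => -1 * c t + (-1 * b t + a t)).
    exact: continuous_lincomb.
  have -> : radial j g (h + x) - radial j g x - df h =
      int01 (fun t => -1 * c t + (-1 * b t + a t)).
    rewrite (int01P _ cc cab) (int01P _ cb ca) !mulN1r.
    by rewrite addrC (addrC (int01 a)).
  apply: int01_norm_le => // t /andP[t0 t1].
  have -> : -1 * c t + (-1 * b t + a t) =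
      t ^+ j * (g (t *: h + t *: x) - g (t *: x) - 'D_(t *: h) g (t *: x)).
    rewrite deriveE; last exact: dg.
    rewrite linearZ -deriveE; last exact: dg.
    rewrite /a /b /c scalerDr exprSr.
    have E (s u A B C' : R) :
      -1 * (s * u * C') + (-1 * (s * B) + s * A) = s * (A - B - u * C') by ring.
    exact: E.
  rewrite normrM ger0_norm ?exprn_ge0//.
  have tx : `|t *: x| <= `|x| + 1.
    by rewrite normrZ ger0_norm// (le_trans (ler_piMl _ t1))// lerDl.
  have thx : `|t *: h + t *: x| <= `|x| + 1.
    rewrite -scalerDr normrZ ger0_norm// (le_trans (ler_piMl _ t1))//.
    by rewrite (le_trans (ler_normD _ _))// addrC lerD.
  rewrite (le_trans (ler_wpM2l (exprn_ge0 _ t0) (HC _ _ tx thx)))//.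
  rewrite (le_trans (ler_piMl _ (exprn_ile1 j t0 t1)))// ?mulr_ge0//.
  by rewrite ler_wpM2l// normrZ ger0_norm// ler_pM ?mulr_ge0// ler_piMl.
move=> e e0; have C10 : 0 < C + 1 by rewrite ltr_wpDl.
near=> h; have h1 : `|h| <= 1.
  near: h; apply/nbhs_ballP; exists 1 => //= h.
  by rewrite -ball_normE/= sub0r normrN => /ltW.
have he : `|h| <= e / (C + 1).
  near: h; apply/nbhs_ballP; exists (e / (C + 1)) => /=; first exact: divr_gt0.
  by move=> h; rewrite -ball_normE/= sub0r normrN => /ltW.
rewrite (le_trans (key h h1))// mulrA ler_wpM2r//.
rewrite (le_trans (ler_wpM2l C0 he))// mulrCA ler_piMr ?(ltW e0)//.
by rewrite ler_pdivrMr// mul1r lerDl.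
Unshelve. all: by end_near. Qed.

Lemma smooth_radial j g : smooth_on setT g -> smooth_on setT (radial j g).
Proof.
move=> sg k; elim: k j g sg => [|k IHk] j g sg.
  by move=> x _; apply: differentiable_continuous; exact: (derive_radial j x (sg 2%N)).1.
split=> [x _|v]; first exact: (derive_radial j x (sg 2%N)).1.
have -> : 'D_v (radial j g) = radial j.+1 ('D_v g).
  by apply/funext => x; exact: (derive_radial j x (sg 2%N)).2.
by apply: IHk => i; exact: (sg i.+1).2.
Qed.

(** Integrate the derivative of [t^(j + 1) g (t x)] from 0 to 1. This identity is the analytic
    content of the Poincare lemma. *)
Lemma radial_FTC j g x : smooth_on setT g ->
  j.+1%:R * radial j g x + radial j.+1 ('D_x g) x = g x.
Proof.
move=> sg; have cg := Cn_on_continuous (sg 0%N).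
have cdg : continuous ('D_x g) by exact: (@Cn_on_continuous 0 ('D_x g) ((sg 1%N).2 x)).
have c1 := @continuous_radial j g x cg.
have c2 := @continuous_radial j.+1 ('D_x g) x cdg.
rewrite /radial -(int01P _ c1 c2).
suff dF : forall t : R, is_derive t 1 (fun t => t ^+ j.+1 * g (t *: x))
    (j.+1%:R * (t ^+ j * g (t *: x)) + t ^+ j.+1 * 'D_x g (t *: x)).
  rewrite (@int01_FTC R _ _ (@continuous_lincomb R _ _ _ c1 c2) dF).
  by rewrite expr1n mul1r scale1r exprS !mul0r subr0.
move=> t.
have d1 : is_derive t 1 (fun t => g (t *: x)) ('D_x g (t *: x)).
  have := @is_derive_line R _ _ g 0 x t; rewrite addr0.
  have -> : (fun t : R => g (t *: x + 0)) = (fun t : R => g (t *: x)).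
    by apply/funext => u; rewrite addr0.
  by apply; exact: (sg 1%N).1.
have d2 : is_derive t 1 (fun t : R => t ^+ j.+1) (j.+1%:R * t ^+ j).
  have := @is_deriveX R R id j.+1 t 1 1 (is_derive_id t 1).
  by rewrite exprfctE /GRing.scale/= mulr1.
have := @is_deriveM R R _ _ t 1 _ _ d2 d1 => H.
have E : t ^+ j.+1 *: 'D_x g (t *: x) + g (t *: x) *: (j.+1%:R * t ^+ j) =
    j.+1%:R * (t ^+ j * g (t *: x)) + t ^+ j.+1 * 'D_x g (t *: x).
  have E' (a b c u v : R) : a * b + c * (u * v) = u * (v * c) + a * b by ring.
  exact: E'.
by rewrite -E; exact: H.
Qed.

End taylor.

(** * Calculus in a finite-dimensional space *)

Section vect_coordinates.
Context {R : realType}.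
Implicit Types W : vectType R.

Definition vc W (i : 'I_(dim W)) (w : W) : R^o := v2r w ord0 i.
Definition vb W (i : 'I_(dim W)) : W := r2v (delta_mx ord0 i).

Lemma vcP W (i : 'I_(dim W)) (a : R) (u w : W) :
  vc i (a *: u + w) = a * vc i u + vc i w.
Proof. by rewrite /vc linearP !mxE. Qed.

Lemma vc_sum W (i : 'I_(dim W)) (I : Type) (r : seq I) (F : I -> W) :
  vc i (\sum_(j <- r) F j) = \sum_(j <- r) vc i (F j).
Proof. by rewrite /vc linear_sum summxE. Qed.

Lemma vcZ W (i : 'I_(dim W)) (a : R) (w : W) : vc i (a *: w) = a * vc i w.
Proof. by rewrite /vc linearZ mxE. Qed.

Lemma vcD W (i : 'I_(dim W)) (u w : W) : vc i (u + w) = vc i u + vc i w.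
Proof. by rewrite /vc linearD mxE. Qed.

Lemma vc_inj W (u w : W) : (forall i, vc i u = vc i w) -> u = w.
Proof. by move=> E; apply: v2r_inj; apply/rowP => i; exact: E. Qed.

Lemma vc_r2v W (i : 'I_(dim W)) (x : 'rV[R]_(dim W)) : vc i (r2v x) = x ord0 i.
Proof. by rewrite /vc r2vK. Qed.

Lemma vb_sum W (w : W) : w = \sum_i vc i w *: vb i.
Proof.
rewrite -{1}(v2rK w) {1}(row_sum_delta (v2r w)) linear_sum.
by apply: eq_bigr => i _; rewrite linearZ.
Qed.

Lemma linear_map_sum (U W : lmodType R) (f : U -> W) (I : Type) (r : seq I)
    (a : I -> R) (u : I -> U) : linear f ->
  f (\sum_(i <- r) a i *: u i) = \sum_(i <- r) a i *: f (u i).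
Proof.
move=> fL; have f0 : f 0 = 0.
  by have := fL (-1) 0 0; rewrite !scaleN1r !addNr.
by elim: r => [|i r IHr]; rewrite ?big_nil// !big_cons fL IHr.
Qed.

(** Reduces every bilinear operation to products of real functions, from which its smoothness and
    its Leibniz rule are then deduced. *)
Lemma vc_bilin (W1 W2 W : vectType R) (op : W1 -> W2 -> W) (i : 'I_(dim W)) u w :
  (forall w, linear (op^~ w)) -> (forall u, linear (op u)) ->
  vc i (op u w) = \sum_j \sum_l vc j u * vc l w * vc i (op (vb j) (vb l)).
Proof.
move=> opl opr.
rewrite {1}(vb_sum u) (linear_map_sum _ _ _ (opl w)) vc_sum.
apply: eq_bigr => j _; rewrite {1}(vb_sum w) (linear_map_sum _ _ _ (opr _)).
rewrite vcZ vc_sum mulr_sumr; apply: eq_bigr => l _.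
by rewrite vcZ mulrA.
Qed.

Lemma vc_lin (W1 W : vectType R) (h : W1 -> W) (i : 'I_(dim W)) u :
  linear h -> vc i (h u) = \sum_j vc j u * vc i (h (vb j)).
Proof.
move=> hL; rewrite {1}(vb_sum u) (linear_map_sum _ _ _ hL) vc_sum.
by apply: eq_bigr => j _; rewrite vcZ.
Qed.

End vect_coordinates.

Section vect_calculus.
Context {R : realType}.
Implicit Types (U : normedModType R) (W : vectType R).

Definition vdiff U W (f : U -> W) (x : U) := differentiable (v2r \o f) x.

Lemma vdiffP U W (f : U -> W) x :
  vdiff f x <-> forall i, differentiable (fun y => vc i (f y)) x.
Proof.
split=> [df i|df]; first exact: (differentiable_row_coord i df).
exact: differentiable_row.
Qed.

Lemma vc_vderive U W (f : U -> W) x v i : vdiff f x ->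
  vc i (vderive v f x) = 'D_v (fun y => vc i (f y)) x.
Proof.
move=> df; rewrite vc_r2v; apply: derive_row_coord; exact: diff_derivable.
Qed.

Lemma vderive_is_derive U W (f : U -> W) x v w : vdiff f x ->
  (forall i, is_derive x v (fun y => vc i (f y)) (vc i w)) -> vderive v f x = w.
Proof.
move=> df H; apply: vc_inj => i; rewrite vc_vderive//; case: (H i) => _ E.
exact: E.
Qed.

Lemma is_derive_vc U W (f : U -> W) x v i : vdiff f x ->
  is_derive x v (fun y => vc i (f y)) (vc i (vderive v f x)).
Proof.
move=> df; rewrite vc_vderive//; apply: derivableP; apply: diff_derivable.
by move/vdiffP : df; exact.
Qed.

Lemma vsmoothP U W (D : set U) (f : U -> W) : open D ->
  vsmooth_on D f <-> forall i, smooth_on D (fun x => vc i (f x)).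
Proof.
move=> oD; split=> [sf i k|sf k]; first by have /Cn_on_row := sf k; apply.
by apply/Cn_on_row => // i; exact: sf.
Qed.

Lemma vsmooth_vdiff U W (D : set U) (f : U -> W) x : vsmooth_on D f -> D x ->
  vdiff f x.
Proof. by move=> /(_ 1%N)[df _] Dx; exact: df. Qed.

Lemma vsmooth_eq U W (D : set U) (f g : U -> W) : open D ->
  (forall x, D x -> f x = g x) -> vsmooth_on D f -> vsmooth_on D g.
Proof.
move=> oD fg sf k; apply: Cn_on_eq (sf k) => // x Dx.
by rewrite /= fg.
Qed.

Lemma vsmooth_sub U W (D D' : set U) (f : U -> W) : D' `<=` D ->
  vsmooth_on D f -> vsmooth_on D' f.
Proof. by move=> DD sf k; apply: Cn_on_sub (sf k). Qed.

Lemma vsmooth_local U W (D : set U) (f : U -> W) :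
  (forall x, D x -> exists2 D', D' x & vsmooth_on D' f) -> vsmooth_on D f.
Proof.
by move=> H k; apply: Cn_on_local => x /H[D' D'x sf]; exists D'.
Qed.

Lemma vsmooth_cst U W (D : set U) (w : W) : vsmooth_on D (fun=> w).
Proof. by move=> k; exact: Cn_on_cst. Qed.

Lemma vsmooth_vderive U W (D : set U) (f : U -> W) v : vsmooth_on D f ->
  vsmooth_on D (vderive v f).
Proof.
move=> sf k; have [_ /(_ v)] := sf k.+1.
rewrite (_ : v2r \o vderive v f = 'D_v (v2r \o f)) => [cf|]; first exact: cf.
by apply/funext => x; rewrite /vderive/= r2vK.
Qed.

Lemma vsmooth_bilin U (W1 W2 W : vectType R) (op : W1 -> W2 -> W) (D : set U)
    f g : open D ->
  (forall w, linear (op^~ w)) -> (forall u, linear (op u)) ->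
  vsmooth_on D f -> vsmooth_on D g -> vsmooth_on D (fun x => op (f x) (g x)).
Proof.
move=> oD opl opr sf sg; apply/vsmoothP => // i k.
apply: (Cn_on_eq (f := fun x => \sum_j \sum_l
  (vc j (f x) * vc l (g x) * vc i (op (vb j) (vb l)) : R^o))) => // [x Dx|].
  by rewrite (vc_bilin _ _ _ opl opr).
apply: Cn_on_sum => // j; apply: Cn_on_sum => // l.
apply: Cn_onM => //; last exact: Cn_on_cst.
apply: Cn_onM => //; first by have /vsmoothP := sf; apply.
by have /vsmoothP := sg; apply.
Qed.

Lemma vsmooth_lin U (W1 W : vectType R) (h : W1 -> W) (D : set U) f : open D ->
  linear h -> vsmooth_on D f -> vsmooth_on D (fun x => h (f x)).
Proof.
move=> oD hL sf; apply/vsmoothP => // i k.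
apply: (Cn_on_eq (f := fun x => \sum_j
  (vc j (f x) * vc i (h (vb j)) : R^o))) => // [x Dx|].
  by rewrite (vc_lin _ _ hL).
apply: Cn_on_sum => // j; apply: Cn_onM => //; last exact: Cn_on_cst.
by have /vsmoothP := sf; apply.
Qed.

Lemma vsmooth_lincomb U W (D : set U) (a : R) (f g : U -> W) : open D ->
  vsmooth_on D f -> vsmooth_on D g -> vsmooth_on D (fun x => a *: f x + g x).
Proof.
move=> oD sf sg; apply/vsmoothP => // i k.
apply: (Cn_on_eq (f := fun x => (a : R^o) * vc i (f x) + vc i (g x) : R^o)) => // [x _|].
  by rewrite vcP.
apply: Cn_onD => //; last by have /vsmoothP := sg; apply.
by apply: Cn_onM => //; [exact: Cn_on_cst|have /vsmoothP := sf; apply].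
Qed.

Lemma vsmooth_sum U W (D : set U) (I : Type) (r : seq I) (f : I -> U -> W) :
  open D -> (forall i, vsmooth_on D (f i)) ->
  vsmooth_on D (fun x => \sum_(i <- r) f i x).
Proof.
move=> oD sf; elim: r => [|i r IHr].
  apply: (vsmooth_eq (f := fun=> 0)) => // [x _|]; first by rewrite big_nil.
  exact: vsmooth_cst.
apply: (vsmooth_eq (f := fun x => 1 *: f i x + \sum_(j <- r) f j x)) => // [x _|].
  by rewrite big_cons scale1r.
exact: vsmooth_lincomb.
Qed.

Lemma vdiff_bilin U (W1 W2 W : vectType R) (op : W1 -> W2 -> W) f g (x : U) :
  (forall w, linear (op^~ w)) -> (forall u, linear (op u)) ->
  vdiff f x -> vdiff g x -> vdiff (fun y => op (f y) (g y)) x.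
Proof.
move=> opl opr /vdiffP df /vdiffP dg; apply/vdiffP => i.
rewrite (_ : (fun _ => _) = \sum_j \sum_l ((fun y => vc j (f y)) * (fun y => vc l (g y)) *
  cst (vc i (op (vb j) (vb l))) : U -> R^o)).
  apply: differentiable_sum => j; apply: differentiable_sum => l.
  by apply: differentiableM => //; apply: differentiableM.
apply/funext => y; rewrite (vc_bilin _ _ _ opl opr) fct_sumE.
by apply: eq_bigr => j _; rewrite fct_sumE.
Qed.

Lemma vderive_bilin U (W1 W2 W : vectType R) (op : W1 -> W2 -> W) f g (x v : U) :
  (forall w, linear (op^~ w)) -> (forall u, linear (op u)) ->
  vdiff f x -> vdiff g x ->
  vderive v (fun y => op (f y) (g y)) x =
  op (vderive v f x) (g x) + op (f x) (vderive v g x).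
Proof.
move=> opl opr df dg; apply: vderive_is_derive; first exact: vdiff_bilin.
move=> i.
rewrite (_ : (fun _ => _) = \sum_j \sum_l ((fun y => vc j (f y)) * (fun y => vc l (g y)) *
  cst (vc i (op (vb j) (vb l))) : U -> R^o)); last first.
  apply/funext => y; rewrite (vc_bilin _ _ _ opl opr) fct_sumE.
  by apply: eq_bigr => j _; rewrite fct_sumE.
have H j l : is_derive x v ((fun y => vc j (f y)) * (fun y => vc l (g y)) *
    cst (vc i (op (vb j) (vb l))) : U -> R^o)
    (vc j (vderive v f x) * vc l (g x) * vc i (op (vb j) (vb l)) +
     vc j (f x) * vc l (vderive v g x) * vc i (op (vb j) (vb l))).
  have H := is_deriveM (is_deriveM (is_derive_vc v j df) (is_derive_vc v l dg))
    (is_derive_cst (vc i (op (vb j) (vb l))) x v).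
  apply: (is_derive_eq H); rewrite scaler0 add0r.
  have E (a b c d e : R) : e * (a * b + c * d) = d * c * e + a * b * e by ring.
  exact: E.
apply: (is_derive_eq (is_derive_sum (fun j => is_derive_sum (H j)))).
rewrite vcD !(vc_bilin _ _ _ opl opr) -big_split/=.
by apply: eq_bigr => j _; rewrite -big_split.
Qed.

(** A linear map is treated as a bilinear one evaluated at the constant scalar 1, which makes its
    calculus an instance of the bilinear rules. *)
Let scaled W1 W (h : W1 -> W) (u : W1) (a : R^o) : W := (a : R) *: h u.

Let scaledl W1 W (h : W1 -> W) a : linear h -> linear ((scaled h)^~ a).
Proof. by move=> hL b u w; rewrite /scaled hL scalerDr !scalerA mulrC. Qed.

Let scaledr W1 W (h : W1 -> W) u : linear (scaled h u).
Proof. by move=> b a c; rewrite /scaled scalerDl scalerA. Qed.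

Lemma vdiff_cst U W (w : W) (x : U) : vdiff (fun=> w) x.
Proof. exact: differentiable_cst. Qed.

Lemma vderive_cst U W (w : W) (x v : U) : vderive v (fun=> w) x = 0.
Proof.
apply: vc_inj => i; rewrite vc_vderive; last exact: vdiff_cst.
by rewrite derive_cst /vc linear0 mxE.
Qed.

Lemma vdiff_lin U (W1 W : vectType R) (h : W1 -> W) f (x : U) :
  linear h -> vdiff f x -> vdiff (fun y => h (f y)) x.
Proof.
move=> hL df.
have := vdiff_bilin (fun a => scaledl a hL) (scaledr h) df (vdiff_cst (1 : R^o) x).
by rewrite /scaled; under eq_fun do rewrite scale1r.
Qed.

Lemma vderive_lin U (W1 W : vectType R) (h : W1 -> W) f (x v : U) :
  linear h -> vdiff f x ->
  vderive v (fun y => h (f y)) x = h (vderive v f x).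
Proof.
move=> hL df.
have := vderive_bilin v (fun a => scaledl a hL) (scaledr h) df (vdiff_cst (1 : R^o) x).
rewrite vderive_cst /scaled scale0r addr0 scale1r.
by under eq_fun do rewrite scale1r.
Qed.

Lemma vdiff_lincomb U W (a : R) (f g : U -> W) x : vdiff f x -> vdiff g x ->
  vdiff (fun y => a *: f y + g y) x.
Proof.
move=> /vdiffP df /vdiffP dg; apply/vdiffP => i.
rewrite (_ : (fun _ => _) = (a *: (fun y => vc i (f y))) + (fun y => vc i (g y))).
  by apply: differentiableD => //; apply: differentiableZ.
by apply/funext => y; rewrite vcP.
Qed.

Lemma vderive_lincomb U W (a : R) (f g : U -> W) x v : vdiff f x -> vdiff g x ->
  vderive v (fun y => a *: f y + g y) x = a *: vderive v f x + vderive v g x.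
Proof.
move=> df dg; apply: vderive_is_derive; first exact: vdiff_lincomb.
move=> i; rewrite (_ : (fun _ => _) =
  (a *: (fun y => vc i (f y))) + (fun y => vc i (g y))); last first.
  by apply/funext => y; rewrite vcP.
by rewrite vcP; exact: (is_deriveD (is_deriveZ a (is_derive_vc v i df)) (is_derive_vc v i dg)).
Qed.

Lemma vderive_sum U W (I : Type) (r : seq I) (f : I -> U -> W) x v :
  (forall i, vdiff (f i) x) ->
  vdiff (fun y => \sum_(i <- r) f i y) x /\
  vderive v (fun y => \sum_(i <- r) f i y) x = \sum_(i <- r) vderive v (f i) x.
Proof.
move=> df; elim: r => [|i r [IH1 IH2]].
  rewrite big_nil (_ : (fun _ => _) = fun=> 0).
    by split; [exact: vdiff_cst|exact: vderive_cst].
  by apply/funext => y; rewrite big_nil.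
rewrite big_cons (_ : (fun _ => _) = fun y => 1 *: f i y + \sum_(j <- r) f j y).
  split; first exact: vdiff_lincomb.
  by rewrite vderive_lincomb// scale1r IH2.
by apply/funext => y; rewrite big_cons scale1r.
Qed.

Lemma vderive_eq U W (f g : U -> W) x v : (\forall y \near x, f y = g y) ->
  vderive v f x = vderive v g x.
Proof.
move=> fg; rewrite /vderive; congr r2v; apply: near_eq_derive.
by apply: filterS fg => y /= ->.
Qed.

Lemma vderive_comm U W (D : set U) (f : U -> W) x v w : open D -> D x ->
  vsmooth_on D f -> vderive w (vderive v f) x = vderive v (vderive w f) x.
Proof.
move=> oD Dx sf.
have E u : forall i, (\forall y \near x, vc i (vderive u f y) = 'D_u (fun y => vc i (f y)) y).
  move=> i; have := open_nbhs_nbhs (conj oD Dx); apply: filterS => y Dy.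
  exact/vc_vderive/(vsmooth_vdiff sf Dy).
have sd u : vsmooth_on D (vderive u f) by exact: vsmooth_vderive.
have dv u : vdiff (vderive u f) x := vsmooth_vdiff (sd u) Dx.
apply: vc_inj => i.
have E1 := vc_vderive w i (dv v).
have E2 := vc_vderive v i (dv w).
apply: (etrans E1); apply: (etrans _ (esym E2)).
have E3 := near_eq_derive w (E v i).
have E4 := near_eq_derive v (E w i).
apply: (etrans E3); apply: (etrans _ (esym E4)).
have /vsmoothP := sf => /(_ oD i 2%N); exact: derive_comm.
Qed.

Lemma vderive_dirP m W (f : 'rV[R]_m -> W) x (a : R) u v : vdiff f x ->
  vderive (a *: u + v) f x = a *: vderive u f x + vderive v f x.
Proof. by move=> df; rewrite /vderive derive_lin// linearP. Qed.

Lemma vderive_dir_sum m W (f : 'rV[R]_m -> W) x v : vdiff f x ->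
  vderive v f x = \sum_(i < m) v ord0 i *: vderive (delta_mx ord0 i) f x.
Proof.
move=> df; rewrite /vderive derive_row_sum// linear_sum.
by apply: eq_bigr => i _; rewrite linearZ.
Qed.

Lemma vsmooth_comp U m W (D : set U) (D' : set 'rV[R]_m) (f : 'rV[R]_m -> W)
    (g : U -> 'rV[R]_m) : open D -> open D' -> (forall x, D x -> D' (g x)) ->
  vsmooth_on D' f -> smooth_on D g -> vsmooth_on D (f \o g).
Proof.
move=> oD oD' gD sf sg; apply/vsmoothP => // i k.
have /vsmoothP := sf => /(_ oD' i k) sfi.
exact: Cn_on_comp gD sfi (sg k).
Qed.

Lemma vderive_comp U m W (f : 'rV[R]_m -> W) (g : U -> 'rV[R]_m) x v :
  differentiable g x -> vdiff f (g x) ->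
  vderive v (f \o g) x = vderive ('D_v g x) f (g x).
Proof.
move=> dg df; rewrite vderive_dir_sum// {1}/vderive.
have := derive_comp v dg df; rewrite -[_ \o g]/(v2r \o (f \o g)) => ->.
by rewrite linear_sum; apply: eq_bigr => i _; rewrite linearZ.
Qed.

(** For real functions there are two notions, direct and through the coordinate of [R^o] as a
    [vectType]. By linearity that coordinate is multiplication by its value at 1. *)
Lemma vsmooth_scalar U (D : set U) (f : U -> R^o) : open D ->
  smooth_on D f -> vsmooth_on D f.
Proof.
move=> oD sf; apply/vsmoothP => // i k.
have E a : vc i (a : R^o) = a * vc i (1 : R^o) by rewrite -vcZ [_ *: _]mulr1.
apply: (Cn_on_eq (f := fun x => f x * vc i (1 : R^o) : R^o)) => //.
by apply: Cn_onM => //; exact: Cn_on_cst.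
Qed.

Lemma scalar_vsmooth U (D : set U) (f : U -> R^o) : open D ->
  vsmooth_on D f -> smooth_on D f.
Proof.
move=> oD sf k.
apply: (Cn_on_eq (f := fun x => \sum_i (vc i (f x) * (vb i : R^o) : R^o))) => // [x _|].
  by rewrite [RHS](vb_sum (f x : R^o)).
apply: Cn_on_sum => // i; apply: Cn_onM => //; last exact: Cn_on_cst.
by have /vsmoothP := sf; apply.
Qed.

Lemma vdiff_scalar U (f : U -> R^o) x : vdiff f x -> differentiable f x.
Proof.
move=> /vdiffP df.
rewrite (_ : f = \sum_i ((fun y => vc i (f y)) * cst (vb i : R^o))).
  by apply: differentiable_sum => i; exact: differentiableM.
by apply/funext => y; rewrite fct_sumE {1}(vb_sum (f y : R^o)).
Qed.

Lemma vderive_scalar U (f : U -> R^o) x v : vdiff f x ->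
  vderive v f x = 'D_v f x.
Proof.
move=> df; apply: vderive_is_derive => // i.
have E a : vc i (a : R^o) = a * vc i (1 : R^o) by rewrite -vcZ [_ *: _]mulr1.
rewrite (_ : (fun _ => _) = f * cst (vc i (1 : R^o))); last first.
  by apply/funext => y; rewrite E.
have H := is_deriveM (derivableP (diff_derivable (v := v) (vdiff_scalar df)))
  (is_derive_cst (vc i (1 : R^o)) x v).
apply: (is_derive_eq H); rewrite scaler0 add0r [RHS]E mulrC.
reflexivity.
Qed.

End vect_calculus.

(** * Exterior algebra *)

Section alternating.
Context {R : realType} {m : nat}.
Notation E := 'rV[R]_m.
Implicit Types (W : vectType R) (s : seq E).

Definition iota_ W (v : E) (h : seq E -> W) : seq E -> W := fun s => h (v :: s).

(** A recursive form of [alternating_form], through interior products: it only speaks of the first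
    two arguments, so that proofs go by induction on the degree. The equivalence is
    [alt_alternating]. *)
Fixpoint alt W (k : nat) (h : seq E -> W) : Prop :=
  if k is j.+1 then
    [/\ h [::] = 0,
        forall (a : R) u v, iota_ (a *: u + v) h = a *: iota_ u h + iota_ v h,
        forall v, iota_ v (iota_ v h) = 0 & forall v, alt j (iota_ v h)]
  else forall v, iota_ v h = 0.

Lemma alt0 W k : alt k (0 : seq E -> W).
Proof.
by elim: k => [|k IHk] /=; last (split => // a u v); rewrite /iota_ ?scaler0 ?addr0.
Qed.

Lemma altP W k (a : R) (h1 h2 : seq E -> W) : alt k h1 -> alt k h2 ->
  alt k (a *: h1 + h2).
Proof.
elim: k h1 h2 => [|k IHk] h1 h2 /=.
  move=> H1 H2 v; rewrite -[LHS]/(a *: iota_ v h1 + iota_ v h2) H1 H2.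
  by rewrite scaler0 addr0.
move=> [z1 l1 v1 a1] [z2 l2 v2 a2]; split.
- by rewrite -[LHS]/(a *: h1 [::] + h2 [::]) z1 z2 scaler0 addr0.
- move=> b u v; rewrite -[LHS]/(a *: iota_ _ h1 + iota_ _ h2) l1 l2.
  rewrite -[iota_ u (_ + _)]/(a *: iota_ u h1 + iota_ u h2).
  rewrite -[iota_ v (_ + _)]/(a *: iota_ v h1 + iota_ v h2).
  by rewrite !scalerDr !scalerA mulrC addrACA.
- move=> v; rewrite -[LHS]/(a *: iota_ v (iota_ v h1) + iota_ v (iota_ v h2)).
  by rewrite v1 v2 scaler0 addr0.
- by move=> v; apply: IHk; [exact: a1|exact: a2].
Qed.

Lemma altZ W k (a : R) (h : seq E -> W) : alt k h -> alt k (a *: h).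
Proof. by move=> H; rewrite -[_ *: _]addr0; apply: altP => //; exact: alt0. Qed.

Lemma altD W k (h1 h2 : seq E -> W) : alt k h1 -> alt k h2 -> alt k (h1 + h2).
Proof. by rewrite -[h1]scale1r => H1 H2; apply: altP; rewrite // -[h1]scale1r. Qed.

Lemma alt_sum W k (I : Type) (r : seq I) (h : I -> seq E -> W) :
  (forall i, alt k (h i)) -> alt k (\sum_(i <- r) h i).
Proof.
move=> H; elim/big_ind: _ => [|h1 h2|i _]; [exact: alt0|exact: altD|exact: H].
Qed.

Lemma alt_iota_lin W k (h : seq E -> W) (a : R) u v : alt k h ->
  iota_ (a *: u + v) h = a *: iota_ u h + iota_ v h.
Proof.
by case: k => [H|k [_ H _ _]]; [rewrite !H scaler0 addr0|exact: H].
Qed.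

Lemma alt_iota2 W k (h : seq E -> W) v : alt k h -> iota_ v (iota_ v h) = 0.
Proof. by case: k => [H|k [_ _ H _]]; [rewrite !H|exact: H]. Qed.

Lemma alt_iota W k (h : seq E -> W) v : alt k h -> alt k.-1 (iota_ v h).
Proof.
case: k => [H|k [_ _ _ H]]; last exact: H.
by rewrite (H v); exact: (alt0 W 0).
Qed.

Lemma alt_swap W k (h : seq E -> W) u v : alt k h ->
  iota_ u (iota_ v h) = - iota_ v (iota_ u h).
Proof.
move=> H; have := alt_iota2 (1 *: u + v) H.
have lu := alt_iota_lin 1 u v (alt_iota u H).
have lv := alt_iota_lin 1 u v (alt_iota v H).
rewrite (alt_iota_lin 1 u v H) -[LHS]/(1 *: iota_ _ (iota_ u h) + iota_ _ (iota_ v h)).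
rewrite lu lv !scale1r !(alt_iota2 _ H) add0r addr0 => /eqP.
by rewrite addrC addr_eq0 => /eqP.
Qed.

Lemma alt_alternating W k (h : seq E -> W) : alt k h <-> alternating_form k h.
Proof.
split; last first.
  elim: k h => [|k IHk] h [sz lin al].
    by move=> v; apply/funext => s; exact: sz.
  split; first exact: sz.
  - by move=> a u v; apply/funext => s; exact: (lin [::]).
  - by move=> v; apply/funext => s; exact: (al [::] [::]).
  move=> v; apply: IHk; split.
  - by move=> s ss; apply: sz.
  - by move=> s1 s2 a u w; exact: (lin (v :: s1)).
  - by move=> s1 s2 s3 u; exact: (al (v :: s1)).
elim: k h => [|k IHk] h H.
  have h0 v s : h (v :: s) = 0 by rewrite -[LHS]/(iota_ v h s) H.
  split; first by case=> //.
  - by case=> [|w s1] s2 a u v; rewrite !h0 scaler0 addr0.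
  - by case=> [|w s1] s2 s3 u; rewrite !h0.
have Hi v := IHk _ (alt_iota v H); split.
- case=> [_|v s ss]; first by case: H.
  by have [sz _ _] := Hi v; exact: sz.
- case=> [|w s1] s2 a u v; last by have [_ lin _] := Hi w; exact: lin.
  by have := congr1 (fun g => g s2) (alt_iota_lin a u v H).
- case=> [|w s1] s2 s3 u; last by have [_ _ al] := Hi w; exact: al.
  case: s2 => [|w s2]; first exact: (congr1 (fun g => g s3) (alt_iota2 u H)).
  (* Exchanging the first two arguments puts [w] in front, and the repetition of [u] then takes
     place within [iota_ w h]. *)
  have /(congr1 (fun g => g (s2 ++ u :: s3))) := alt_swap w u H.
  rewrite -[LHS]/(h (u :: w :: s2 ++ u :: s3)) => ->.
  have [_ _ al] := Hi w; have /= E := al [::] s2 s3 u.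
  by rewrite -[LHS]/(- iota_ w h (u :: s2 ++ u :: s3)) E oppr0.
Qed.

End alternating.

(** * The exterior product by recursion on the first vector *)

Section wedge.
Context {R : realType} {m : nat}.
Notation E := 'rV[R]_m.
Implicit Types (W : vectType R) (s : seq E).

(** The parity involution, read off the number of arguments so that no degree has to be carried
    along; on [k]-forms it is the sign [(-1)^k]. *)
Definition gr W (h : seq E -> W) : seq E -> W := fun s => (-1) ^+ size s *: h s.

Lemma grK W : involutive (@gr W).
Proof.
move=> h; apply/funext => s; rewrite /gr scalerA -exprD addnn -mul2n exprM.
by rewrite sqrrN expr1n expr1n scale1r.
Qed.

Lemma iota_gr W v (h : seq E -> W) : iota_ v (gr h) = - gr (iota_ v h).
Proof. by apply/funext => s; rewrite /iota_ /gr/= exprS mulN1r scaleNr. Qed.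

Lemma gr_lin W (a : R) (h1 h2 : seq E -> W) : gr (a *: h1 + h2) = a *: gr h1 + gr h2.
Proof.
by apply/funext => s; rewrite /gr !fctE scalerDr !scalerA mulrC.
Qed.

Lemma gr_alt W k (h : seq E -> W) : alt k h -> gr h = (-1) ^+ k *: h.
Proof.
move=> /alt_alternating[sz _ _]; apply/funext => s; rewrite /gr !fctE.
by have [->//|sk] := eqVneq (size s) k; rewrite sz// !scaler0.
Qed.

Lemma sign2K (k l : nat) : (-1) ^+ (k + (k + l)) = (-1) ^+ l :> R.
Proof. by rewrite addnA addnn exprD -mul2n exprM sqrrN !expr1n mul1r. Qed.

Section bilinear_wedge.
Variables (W1 W2 W : vectType R) (op : W1 -> W2 -> W).
Hypothesis opl : forall w, linear (op^~ w).
Hypothesis opr : forall u, linear (op u).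
Implicit Types (a : seq E -> W1) (b : seq E -> W2).

Lemma op0l w : op 0 w = 0.
Proof. by have := opl w (-1) 0 0; rewrite !scaleN1r !addNr. Qed.

Lemma op0r u : op u 0 = 0.
Proof. by have := opr u (-1) 0 0; rewrite !scaleN1r !addNr. Qed.

Lemma opZl (c : R) u w : op (c *: u) w = c *: op u w.
Proof. by have := opl w c u 0; rewrite op0l !addr0. Qed.

(* The value of [wedgef] on a list of vectors, from the recursion
   [i_v (a /\ b) = i_v a /\ b + (-1)^|a| a /\ i_v b]. *)
Fixpoint wp_rec (a : seq E -> W1) (b : seq E -> W2) s : W :=
  if s is v :: s' then wp_rec (iota_ v a) b s' + wp_rec (gr a) (iota_ v b) s'
  else op (a [::]) (b [::]).

Lemma wp_linl (c : R) a1 a2 b s :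
  wp_rec (c *: a1 + a2) b s = c *: wp_rec a1 b s + wp_rec a2 b s.
Proof.
elim: s a1 a2 b => [|v s IHs] a1 a2 b /=; first exact: opl.
by rewrite gr_lin !IHs scalerDr addrACA.
Qed.

Lemma wp_linr (c : R) a b1 b2 s :
  wp_rec a (c *: b1 + b2) s = c *: wp_rec a b1 s + wp_rec a b2 s.
Proof.
elim: s a b1 b2 => [|v s IHs] a b1 b2 /=; first exact: opr.
by rewrite !IHs scalerDr addrACA.
Qed.

Lemma wp0l b s : wp_rec 0 b s = 0.
Proof.
have E0 : 1 *: (0 : seq E -> W1) + 0 = 0 by rewrite scaler0 addr0.
have := wp_linl 1 0 0 b s; rewrite E0 scale1r; move: (wp_rec _ _ _) => x.
by rewrite -[X in X = _]addr0 => /addrI <-.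
Qed.

Lemma wp0r a s : wp_rec a 0 s = 0.
Proof.
have E0 : 1 *: (0 : seq E -> W2) + 0 = 0 by rewrite scaler0 addr0.
have := wp_linr 1 a 0 0 s; rewrite E0 scale1r; move: (wp_rec _ _ _) => x.
by rewrite -[X in X = _]addr0 => /addrI <-.
Qed.

Lemma wpZl (c : R) a b s : wp_rec (c *: a) b s = c *: wp_rec a b s.
Proof. by have := wp_linl c a 0 b s; rewrite wp0l !addr0. Qed.

Lemma wpZr (c : R) a b s : wp_rec a (c *: b) s = c *: wp_rec a b s.
Proof. by have := wp_linr c a b 0 s; rewrite wp0r !addr0. Qed.

Lemma wpNl a b s : wp_rec (- a) b s = - wp_rec a b s.
Proof. by rewrite -scaleN1r wpZl scaleN1r. Qed.

Lemma wpNr a b s : wp_rec a (- b) s = - wp_rec a b s.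
Proof. by rewrite -scaleN1r wpZr scaleN1r. Qed.

Lemma wpDl a1 a2 b s : wp_rec (a1 + a2) b s = wp_rec a1 b s + wp_rec a2 b s.
Proof. by have := wp_linl 1 a1 a2 b s; rewrite !scale1r. Qed.

Lemma wpDr a b1 b2 s : wp_rec a (b1 + b2) s = wp_rec a b1 s + wp_rec a b2 s.
Proof. by have := wp_linr 1 a b1 b2 s; rewrite !scale1r. Qed.

Lemma wpBr a b1 b2 s : wp_rec a (b1 - b2) s = wp_rec a b1 s - wp_rec a b2 s.
Proof. by rewrite wpDr wpNr. Qed.

Lemma wpBl a1 a2 b s : wp_rec (a1 - a2) b s = wp_rec a1 b s - wp_rec a2 b s.
Proof. by rewrite wpDl wpNl. Qed.

Lemma iota_wp k v a b : alt k a ->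
  iota_ v (wp_rec a b) = wp_rec (iota_ v a) b + (-1) ^+ k *: wp_rec a (iota_ v b).
Proof.
move=> ka; apply/funext => s; rewrite /iota_ /= -/(iota_ _ _) (gr_alt ka).
by rewrite wpZl.
Qed.

Lemma alt_wp p q a b : alt p a -> alt q b -> alt (p + q) (wp_rec a b).
Proof.
move En : (p + q)%N => N; elim: N p q En a b => [|N IHN] p q En a b pa qb.
  have [p0 q0] : p = 0%N /\ q = 0%N by lia.
  subst p q => v; rewrite (iota_wp v b pa) (pa v) (qb v) expr0 scale1r.
  by apply/funext => s; rewrite !fctE wp0l wp0r addr0.
have ia v : alt N (wp_rec (iota_ v a) b).
  case: p En pa => [|p] En pa; last by apply: (IHN p q) => //; [lia|exact: alt_iota pa].
  rewrite (_ : wp_rec _ _ = 0); first exact: alt0.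
  by apply/funext => s; rewrite (pa v) wp0l.
have ib v : alt N (wp_rec a (iota_ v b)).
  case: q En qb => [|q] En qb; last by apply: (IHN p q) => //; [lia|exact: alt_iota qb].
  rewrite (_ : wp_rec _ _ = 0); first exact: alt0.
  by apply/funext => s; rewrite (qb v) wp0r.
split.
- rewrite /=; case: p En pa => [|p] En; last by move=> [-> _ _ _]; exact: op0l.
  by case: q En qb => [//|q] En [-> _ _ _] _; exact: op0r.
- move=> c u v; rewrite !(iota_wp _ _ pa) (alt_iota_lin c u v pa) (alt_iota_lin c u v qb).
  apply/funext => s; rewrite !fctE wp_linl wp_linr !scalerDr addrACA !scalerA.
  by rewrite [c * _]mulrC.
(* Applying [iota_ v] twice to the product, the terms with both contractions on one factor vanish
   and the two mixed terms cancel, because [iota_ v] anticommutes with [gr]. *)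
- move=> v; apply/funext => s; rewrite /iota_ /= -/(iota_ _ _) -/(iota_ v (iota_ v a)).
  rewrite -/(iota_ v (iota_ v b)) (alt_iota2 v pa) (alt_iota2 v qb).
  rewrite wp0l wp0r addr0 add0r -/(iota_ v b) -/(iota_ v (gr a)) iota_gr wpNl.
  by rewrite addrN.
by move=> v; rewrite (iota_wp v b pa) addrC; apply: altP.
Qed.

End bilinear_wedge.

Definition scale_op W (a : R^o) (w : W) : W := (a : R) *: w.

Lemma scale_opl W (w : W) : linear ((@scale_op W)^~ w).
Proof. by move=> c u v; rewrite /scale_op scalerDl scalerA. Qed.

Lemma scale_opr W (a : R^o) : linear (scale_op (W := W) a).
Proof. by move=> c u v; rewrite /scale_op scalerDr !scalerA mulrC. Qed.

Definition wsc W (a : seq E -> R^o) (b : seq E -> W) := wp_rec (@scale_op W) a b.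

(** Graded commutativity, stated for the operators of multiplication by [a] and by [b]: this is the
    form in which it yields both [lambda /\ lambda /\ _ = 0] and the commutation of [lambda] with
    [omega]. *)
Lemma wsc_comm W p q (a b : seq E -> R^o) (h : seq E -> W) : alt p a -> alt q b ->
  wsc a (wsc b h) = (-1) ^+ (p * q) *: wsc b (wsc a h).
Proof.
move=> + + ; have L := @scale_opl W; have Rr := @scale_opr W.
suff H s : alt p a -> alt q b ->
    wsc a (wsc b h) s = (-1) ^+ (p * q) *: wsc b (wsc a h) s.
  by move=> pa qb; apply/funext => s; exact: H.
elim: s p q a b h => [|v s IHs] p q a b h pa qb.
  rewrite /wsc/= /scale_op; case: p pa => [|p] pa.
    by rewrite mul0n expr0 scale1r !scalerA mulrC.
  by case: pa => -> _ _ _; rewrite !scale0r !scaler0.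
rewrite /wsc -![wp_rec _ _ _ (v :: s)]/(iota_ v (wp_rec _ _ _) s).
rewrite !(iota_wp L v _ pa) !(iota_wp L v _ qb) !(iota_wp L v _ pa) !fctE.
rewrite !(wpDr Rr) !(wpZr Rr) -!/(wsc _ _).
(* The case [p = 0] is apart: [iota_ v a] vanishes, and there is no degree [p - 1] to which the
   induction hypothesis could apply. *)
have -> : wsc (iota_ v a) (wsc b h) s = (-1) ^+ q *: ((-1) ^+ (p * q) *: wsc b (wsc (iota_ v a) h) s).
  case: p pa => [|p] pa.
    rewrite (pa v) (_ : wsc 0 h = 0) /wsc ?(wp0l L) ?(wp0r Rr) ?scaler0//.
    by apply/funext => t; rewrite (wp0l L).
  rewrite (IHs p q)//; last exact: alt_iota pa.
  by rewrite scalerA -exprD mulSn sign2K.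
have -> : wsc a (wsc (iota_ v b) h) s = (-1) ^+ p *: ((-1) ^+ (p * q) *: wsc (iota_ v b) (wsc a h) s).
  case: q qb => [|q] qb.
    rewrite (qb v) (_ : wsc 0 h = 0) /wsc ?(wp0l L) ?(wp0r Rr) ?scaler0//.
    by apply/funext => t; rewrite (wp0l L).
  rewrite (IHs p q)//; last exact: alt_iota qb.
  by rewrite scalerA -exprD mulnS sign2K.
rewrite (IHs p q a b (iota_ v h))//.
set S := (-1) ^+ (p * q); set P := (-1) ^+ p; set Q := (-1) ^+ q.
have P2 : P * P = 1 by rewrite /P -exprD -{2}[p]addn0 sign2K.
rewrite !scalerDr !scalerA; set X := wsc b (wsc (iota_ v a) h) s.
set Y := wsc (iota_ v b) _ s; set Z := wsc b _ s.
rewrite (mulrA P P) P2 mul1r [Q * S]mulrC (_ : P * Q * S = S * Q * P); last by ring.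
exact: addrCA.
Qed.

End wedge.

(** * Comparison of the sum over shuffles with the recursive product *)

Section shuffles.
Variable n : nat.
Implicit Types (A : {set 'I_n.+1}) (B : {set 'I_n}).

Definition set_tail A : {set 'I_n} := [set i | lift ord0 i \in A].
Definition set_cons (b : bool) B : {set 'I_n.+1} :=
  [set i | if unlift ord0 i is Some j then j \in B else b].

Lemma set_consK b B : (ord0 \in set_cons b B) = b /\ set_tail (set_cons b B) = B.
Proof.
split; first by rewrite inE unlift_none.
by apply/setP => i; rewrite !inE liftK.
Qed.

Lemma set_tailK A : set_cons (ord0 \in A) (set_tail A) = A.
Proof.
apply/setP => i; rewrite inE; case: unliftP => [j ->|->]; last by [].
by rewrite inE.
Qed.

Lemma sum_set_cons (T : nmodType) (G : bool -> {set 'I_n} -> T) :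
  \sum_(A : {set 'I_n.+1}) G (ord0 \in A) (set_tail A) = \sum_B G true B + \sum_B G false B.
Proof.
rewrite (reindex (fun p : bool * {set 'I_n} => set_cons p.1 p.2)) /=; last first.
  exists (fun A => (ord0 \in A, set_tail A)) => [[b B] _|A _] /=.
    by case: (set_consK b B) => -> ->.
  exact: set_tailK.
have E b B : G (ord0 \in set_cons b B) (set_tail (set_cons b B)) = G b B.
  by case: (set_consK b B) => -> ->.
rewrite (eq_bigr (fun p => G p.1 p.2)) => [|[b B] _]; last exact: E.
by rewrite -(pair_bigA _ (fun b B => G b B))/= big_bool.
Qed.

Lemma set_tailC A : set_tail (~: A) = ~: set_tail A.
Proof. by apply/setP => i; rewrite !inE. Qed.

Lemma shuffle_inv_sum k (C : {set 'I_k}) : shuffle_inv C =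
  (\sum_(i < k) \sum_(j < k) [&& (i < j)%N, i \notin C & j \in C])%N.
Proof.
rewrite /shuffle_inv -sum1_card pair_bigA/= big_mkcond/=.
by apply: eq_bigr => -[i j] _ /=; rewrite inE /=; case: [&& _, _ & _].
Qed.

(** The inversions starting at index 0 occur only if 0 is outside [A], and there is then one for
    each element of [A]. *)
Lemma shuffle_inv_cons A : shuffle_inv A =
  ((if ord0 \in A then 0 else #|set_tail A|) + shuffle_inv (set_tail A))%N.
Proof.
rewrite !shuffle_inv_sum big_ord_recl; congr addn; last first.
  apply: eq_bigr => i _; rewrite big_ord_recl ltn0 add0n.
  by apply: eq_bigr => j _; rewrite !inE.
rewrite big_ord_recl ltnn add0n; case: (ord0 \in A).
  by rewrite big1// => j _.
rewrite -sum1_card [RHS]big_mkcond/=.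
by apply: eq_bigr => j _; rewrite inE; case: (_ \in A).
Qed.

Lemma enum_set_tail A : enum A = (if ord0 \in A then [:: ord0] else [::]) ++
  map (lift ord0) (enum (set_tail A)).
Proof.
rewrite /enum_mem -!enumT /= enum_ordSl /= filter_map.
have -> : seq.filter (preim (lift ord0) (mem A)) (enum 'I_n) =
    seq.filter (mem (set_tail A)) (enum 'I_n).
  by apply: eq_filter => i; rewrite /= inE.
by case: ifP.
Qed.

End shuffles.

Section wedgef_rec.
Context {R : realType} {m : nat} {M : manifold R m}.
Notation E := 'rV[R]_m.

Lemma sublist_cons (v : E) s (A : {set 'I_(size (v :: s))}) :
  @sublist R m (v :: s) A =
  (if ord0 \in A then [:: v] else [::]) ++ @sublist R m s (set_tail A).
Proof.
rewrite /sublist /image_mem.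
rewrite enum_set_tail map_cat -map_comp; congr (_ ++ _); first by case: ifP.
Qed.

Lemma size_sublist s (A : {set 'I_(size s)}) : size (@sublist R m s A) = #|A|.
Proof. by rewrite size_map cardE. Qed.

Variables (W1 W2 W : vectType R) (op : W1 -> W2 -> W).
Hypothesis opl : forall w, linear (op^~ w).
Hypothesis opr : forall u, linear (op u).

(** Split the shuffles according to the factor receiving the first vector. If it is [beta], that
    vector passes all the arguments of [alpha]; the resulting sign is the one that [gr] puts on
    [alpha]. *)
Lemma wedgef_wp (alpha : mform M W1) (beta : mform M W2) p :
  wedgef op alpha beta p = wp_rec op (alpha p) (beta p).
Proof.
apply/funext => s; elim: s alpha beta => [|v s IHs] alpha beta.
  rewrite /wedgef (big_pred1 (finset.set0 : {set 'I_0})) => [|A]; last first.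
    by apply/esym/eqP/setP => -[].
  have e0 (C : {set 'I_0}) : @sublist R m [::] C = [::].
    by apply: size0nil; rewrite size_sublist; apply: eq_card0 => -[].
  rewrite !e0 (_ : shuffle_inv _ = 0)%N ?scale1r//.
  by rewrite shuffle_inv_sum big_ord0.
rewrite /=; have := IHs (fun p => iota_ v (alpha p)) beta.
have := IHs (fun p => gr (alpha p)) (fun p => iota_ v (beta p)).
move=> <- <-; rewrite /wedgef.
pose G b (B : {set 'I_(size s)}) := (-1) ^+ ((if b then 0 else #|B|) + shuffle_inv B) *:
  op (alpha p ((if b then [:: v] else [::]) ++ sublist B))
     (beta p ((if ~~ b then [:: v] else [::]) ++ sublist (~: B))).
rewrite -[RHS](_ : \sum_B G true B + \sum_B G false B = _).
  rewrite -sum_set_cons; apply: eq_bigr => A _; rewrite /G.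
  by rewrite shuffle_inv_cons !sublist_cons inE set_tailC.
congr (_ + _); apply: eq_bigr => B _; rewrite /G/= ?add0n//.
by rewrite /gr size_sublist (opZl opl) exprD scalerA mulrC.
Qed.

End wedgef_rec.

(** * Expansion in a basis, top degree and the degree operator *)

Section dimension.
Context {R : realType} {m : nat}.
Notation E := 'rV[R]_m.
Implicit Types (W : vectType R) (s : seq E).

Definition ebasis (i : 'I_m) : E := delta_mx ord0 i.

Lemma alternating_sum W k (h : seq E -> W) s1 s2 (v : E) : alternating_form k h ->
  h (s1 ++ v :: s2) = \sum_i v ord0 i *: h (s1 ++ ebasis i :: s2).
Proof.
move=> [_ lin _].
have hL : linear (fun v : E => h (s1 ++ v :: s2)) by move=> a u w; exact: lin.
by rewrite {1}(row_sum_delta v) (linear_map_sum _ _ _ hL).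
Qed.

Lemma alternating_basis0 W k (h : seq E -> W) : alternating_form k h ->
  (forall r : seq 'I_m, h (map ebasis r) = 0) -> h = 0.
Proof.
move=> ah H; suff G s2 r : h (map ebasis r ++ s2) = 0.
  by apply/funext => s; exact: (G s [::]).
elim: s2 r => [|v s2 IHs] r; first by rewrite cats0.
rewrite (alternating_sum _ _ _ ah) big1// => i _.
by rewrite -cat_rcons -map_rcons IHs scaler0.
Qed.

(** A list of more than [m] basis vectors contains a repetition. *)
Lemma alt_top W k (h : seq E -> W) : (m < k)%N -> alt k h -> h = 0.
Proof.
move=> mk /alt_alternating ah; apply: (alternating_basis0 ah) => r.
have [sz _ al] := ah.
have [kr|kr] := eqVneq (size r) k; last by apply: sz; rewrite size_map.
have : ~~ uniq r.
  apply/negP => /card_uniqP ur; have := max_card (mem r).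
  by rewrite ur card_ord kr leqNgt mk.
case: r {kr} => [//|i0 r]; set t := i0 :: r.
move=> /(uniqPn i0)[i [j [ij jr E]]].
have jE : drop j t = nth i0 t j :: drop j.+1 t by rewrite -drop_nth.
have iE : take j t = take i t ++ nth i0 t i :: drop i.+1 (take j t).
  rewrite -{1}(cat_take_drop i (take j t)) take_takel; last exact: ltnW.
  by rewrite (drop_nth i0) ?nth_take// size_take jr.
by rewrite -(cat_take_drop j t) iE jE E -catA/= !map_cat/= map_cat/= al.
Qed.

(** The coordinate 1-form [dx_i]. *)
Definition coform (i : 'I_m) : seq E -> R^o :=
  fun s => if s is [:: u] then u ord0 i else 0.

Lemma iota_coform i v : iota_ v (coform i) = fun s => if s is [::] then v ord0 i else 0.
Proof. by apply/funext => -[]. Qed.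

Lemma alt_coform i : alt 1 (coform i).
Proof.
split=> //.
by move=> a u v; apply/funext => -[|w s]; rewrite /iota_/= !fctE ?mxE//= scaler0 addr0.
Qed.

Lemma wsc_scalar W (c : R^o) (b : seq E -> W) s :
  wsc (fun s => if s is [::] then c else 0) b s = (c : R) *: b s.
Proof.
elim: s b => [//|v s IHs] b; rewrite /wsc /=.
have -> : iota_ v (fun s : seq E => if s is [::] then c else 0) = 0 by [].
rewrite (wp0l (@scale_opl R W)) add0r.
rewrite [gr _](_ : _ = fun s => if s is [::] then c else 0); first exact: IHs.
by apply/funext => -[|w t]; rewrite /gr/= ?scale1r ?scaler0.
Qed.

(** The operator [\sum_i dx_i /\ iota_(e_i)] counts the degree, since [iota_ v] of it produces
    [iota_ v h] once plus the same operator on [iota_ v h]. It accounts for the [k] in [[Lam, L] = n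
    - k]. *)
Lemma euler W k (h : seq E -> W) s : alt k h ->
  \sum_i wsc (coform i) (iota_ (ebasis i) h) s = k%:R *: h s.
Proof.
elim: k h s => [|k IHk] h s ah.
  rewrite scale0r big1// => i _; rewrite (ah (ebasis i)).
  exact: (wp0r (@scale_opr R W)).
case: s => [|v s].
  rewrite /wsc/= big1 => [|i _]; last exact: scale0r.
  by case: ah => -> _ _ _; rewrite scaler0.
have E i : wsc (coform i) (iota_ (ebasis i) h) (v :: s) =
    v ord0 i *: iota_ (ebasis i) h s + wsc (coform i) (iota_ (ebasis i) (iota_ v h)) s.
  rewrite -[LHS]/(iota_ v (wp_rec _ _ _) s) (iota_wp (@scale_opl R W) v _ (alt_coform i)).
  rewrite !fctE expr1 scaleN1r iota_coform -!/(wsc _ _ _) wsc_scalar; congr (_ + _).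
  by rewrite (alt_swap v (ebasis i) ah) /wsc (wpNr (@scale_opr R W)) opprK.
rewrite (eq_bigr _ (fun i _ => E i)) big_split/= (IHk (iota_ v h)); last exact: alt_iota ah.
have -> : \sum_i v ord0 i *: iota_ (ebasis i) h s = h (v :: s).
  by move/alt_alternating : ah => ah; rewrite -[v :: s]cat0s (alternating_sum [::] s v ah).
by rewrite -[iota_ v h s]/(h (v :: s)) -{1}[h _]scale1r -scalerDl mulrS.
Qed.

End dimension.

(** * Differential forms on Euclidean space *)

Section euclidean_forms.
Context {R : realType} {m : nat}.
Notation E := 'rV[R]_m.
Implicit Types (W : vectType R) (s : seq E).

Definition eform W := E -> seq E -> W.

Definition esmooth W (eta : eform W) := forall s, vsmooth_on setT (fun x => eta x s).
Definition eOm W k (eta : eform W) := (forall x, alt k (eta x)) /\ esmooth eta.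
Definition einc W (v : E) (eta : eform W) : eform W := fun x => iota_ v (eta x).
Definition eder W (v : E) (eta : eform W) : eform W :=
  fun x s => vderive v (fun y => eta y s) x.
Definition ed W (eta : eform W) : eform W := fun x s =>
  \sum_(i < size s) (-1) ^+ i *: vderive s`_i (fun y => eta y (rem_at i s)) x.

(** Cartan's formula for a constant vector field. It is the recursion from which the properties of
    [ed] are derived, by induction on the list of arguments or on the degree. *)
Lemma ed_cons W (eta : eform W) x v s :
  ed eta x (v :: s) = eder v eta x s - ed (einc v eta) x s.
Proof.
rewrite /ed big_ord_recl expr0 scale1r /rem_at take0 cat0s drop1; congr (_ + _).
rewrite -sumrN; apply: eq_bigr => i _ /=.
by rewrite /bump/= add1n exprS mulN1r scaleNr.
Qed.

Lemma ed_cons_fun W (eta : eform W) v :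
  einc v (ed eta) = eder v eta - ed (einc v eta).
Proof. by apply/funext => x; apply/funext => s; exact: ed_cons. Qed.

Lemma esmooth_vdiff W (eta : eform W) s x : esmooth eta -> vdiff (fun y => eta y s) x.
Proof. by move=> H; exact: vsmooth_vdiff (H s) I. Qed.

Lemma esmooth_inc W (eta : eform W) v : esmooth eta -> esmooth (einc v eta).
Proof. by move=> H s; exact: H. Qed.

Lemma esmooth_der W (eta : eform W) v : esmooth eta -> esmooth (eder v eta).
Proof. by move=> H s; apply: vsmooth_vderive; exact: H. Qed.

Lemma esmoothP W (a : R) (eta theta : eform W) : esmooth eta -> esmooth theta ->
  esmooth (a *: eta + theta).
Proof. by move=> H1 H2 s; exact: vsmooth_lincomb openT (H1 s) (H2 s). Qed.

Lemma esmooth0 W : esmooth (0 : eform W).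
Proof. by move=> s; exact: vsmooth_cst. Qed.

Lemma esmooth_ed W (eta : eform W) : esmooth eta -> esmooth (ed eta).
Proof.
move=> H s; apply: vsmooth_sum => [|i]; first exact: openT.
have sd : vsmooth_on setT (vderive s`_i (fun y => eta y (rem_at i s))).
  by apply: vsmooth_vderive; exact: H.
have := vsmooth_lincomb ((-1) ^+ i) openT sd (vsmooth_cst setT (0 : W)).
by apply: vsmooth_eq => [|x _]; [exact: openT|rewrite addr0].
Qed.

Lemma ed_lin W (a : R) (eta theta : eform W) : esmooth eta -> esmooth theta ->
  ed (a *: eta + theta) = a *: ed eta + ed theta.
Proof.
move=> H1 H2; apply/funext => x; apply/funext => s.
rewrite !fctE /ed scaler_sumr -big_split/=; apply: eq_bigr => i _.
have E1 := esmooth_vdiff (rem_at i s) x H1.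
have E2 := esmooth_vdiff (rem_at i s) x H2.
have -> : vderive s`_i (fun y => (a *: eta + theta) y (rem_at i s)) x =
    a *: vderive s`_i (fun y => eta y (rem_at i s)) x +
    vderive s`_i (fun y => theta y (rem_at i s)) x by exact: vderive_lincomb.
by rewrite scalerDr !scalerA mulrC.
Qed.

Lemma ed0 W : ed (0 : eform W) = 0.
Proof.
apply/funext => x; apply/funext => s; rewrite /ed big1// => i _.
have -> : vderive s`_i (fun y => (0 : eform W) y (rem_at i s)) x = 0 by exact: vderive_cst.
by rewrite scaler0.
Qed.

Lemma edB W (eta theta : eform W) : esmooth eta -> esmooth theta ->
  ed (eta - theta) = ed eta - ed theta.
Proof.
move=> H1 H2; rewrite -[eta - theta]addrC -scaleN1r ed_lin//.
by rewrite scaleN1r addrC.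
Qed.

Lemma eder_comm W (eta : eform W) u v : esmooth eta ->
  eder u (eder v eta) = eder v (eder u eta).
Proof.
move=> H; apply/funext => x; apply/funext => s.
exact: (vderive_comm v u openT I (H s)).
Qed.

Lemma eder_ed W (eta : eform W) v : esmooth eta -> eder v (ed eta) = ed (eder v eta).
Proof.
move=> H; apply/funext => x; apply/funext => s.
elim: s eta H => [|u s IHs] eta H.
  rewrite /ed big_ord0 /eder.
  have -> : (fun y => ed eta y [::]) = fun=> 0.
    by apply/funext => y; rewrite /ed big_ord0.
  exact: vderive_cst.
have su := esmooth_inc u H.
have d1 := esmooth_vdiff s x (esmooth_ed su).
have d2 := esmooth_vdiff s x (esmooth_der u H).
have L : vderive v (fun y => (-1) *: ed (einc u eta) y s + eder u eta y s) x =
    (-1) *: eder v (ed (einc u eta)) x s + eder v (eder u eta) x s.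
  exact: vderive_lincomb d1 d2.
have E' : (fun y => ed eta y (u :: s)) = (fun y => (-1) *: ed (einc u eta) y s + eder u eta y s).
  by apply/funext => y; rewrite ed_cons scaleN1r addrC.
rewrite [LHS]/eder E' L (IHs _ su) (eder_comm v u H) scaleN1r addrC ed_cons.
reflexivity.
Qed.

(** By Cartan's formula twice and the commutation of [eder u] with [ed], contracting [ed (ed eta)]
    with [u] gives [ed (ed (einc u eta))]. *)
Lemma ed_ed W (eta : eform W) : esmooth eta -> ed (ed eta) = 0.
Proof.
move=> H; apply/funext => x; apply/funext => s.
elim: s eta H => [|u s IHs] eta H; first by rewrite /ed big_ord0.
rewrite ed_cons (eder_ed _ H) ed_cons_fun.
have H1 := esmooth_der u H; have H2 := esmooth_ed (esmooth_inc u H).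
rewrite (edB H1 H2) !fctE (IHs _ (esmooth_inc u H)) oppr0 addr0.
exact: subrr.
Qed.

Lemma alt_eder W k (eta : eform W) v x : eOm k eta -> alt k (eder v eta x).
Proof.
move=> [ae se]; apply/alt_alternating.
have aa y : alternating_form k (eta y) by exact/alt_alternating.
split.
- move=> s ss; rewrite /eder -[RHS](vderive_cst (0 : W) x v).
  by congr (vderive v _ x); apply/funext => y; have [sz _ _] := aa y; exact: sz.
- move=> s1 s2 a u w.
  have := vderive_lincomb a v (esmooth_vdiff (s1 ++ u :: s2) x se)
    (esmooth_vdiff (s1 ++ w :: s2) x se).
  move=> <-; congr (vderive v _ x); apply/funext => y.
  by have [_ lin _] := aa y; exact: lin.
- move=> s1 s2 s3 u; rewrite /eder -[RHS](vderive_cst (0 : W) x v).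
  by congr (vderive v _ x); apply/funext => y; have [_ _ al] := aa y; exact: al.
Qed.

Lemma eOm_inc W k (eta : eform W) v : eOm k eta -> eOm k.-1 (einc v eta).
Proof.
by move=> [ae se]; split; [move=> x; exact: alt_iota (ae x)|exact: esmooth_inc].
Qed.

Lemma eOm_ed W k (eta : eform W) : eOm k eta -> eOm k.+1 (ed eta).
Proof.
move=> H; split; last by apply: esmooth_ed; case: H.
elim: k eta H => [|k IHk] eta H x.
  have i0 v : einc v eta = 0 by apply/funext => y; case: H => /(_ y) + _; exact.
  have ie v : iota_ v (ed eta x) = eder v eta x.
    rewrite -[LHS]/(einc v (ed eta) x) ed_cons_fun i0 ed0.
    by rewrite -[LHS]/(eder v eta x - 0) subr0.
  split.
  - by rewrite /ed big_ord0.
  - move=> a u v; rewrite !ie; apply/funext => s.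
    by apply: vderive_dirP; apply: esmooth_vdiff; case: H.
  - by move=> v; rewrite ie; exact: (alt_eder v x H).
  - by move=> v; rewrite ie; exact: alt_eder.
have ie v : iota_ v (ed eta x) = eder v eta x - ed (einc v eta) x.
  by rewrite -[LHS]/(einc v (ed eta) x) ed_cons_fun.
have se := H.2.
have il (a : R) u v : einc (a *: u + v) eta = a *: einc u eta + einc v eta.
  by apply/funext => y; exact: alt_iota_lin (H.1 y).
split.
- by rewrite /ed big_ord0.
- move=> a u v; rewrite !ie il (ed_lin _ (esmooth_inc _ se) (esmooth_inc _ se)).
  have -> : eder (a *: u + v) eta x = a *: eder u eta x + eder v eta x.
    by apply/funext => s; apply: vderive_dirP; apply: esmooth_vdiff.
  by rewrite scalerBr opprD addrACA.
(* Contracting with [v] once more, the Lie derivative terms cancel and there remains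
   [ed (einc v (einc v eta))], which is zero. *)
- move=> v; rewrite ie; apply/funext => s.
  rewrite -[LHS]/(einc v (eder v eta) x s - einc v (ed (einc v eta)) x s).
  rewrite ed_cons_fun (_ : einc v (einc v eta) = 0); last first.
    by apply/funext => y; exact: alt_iota2 (H.1 y).
  by rewrite ed0 subr0; exact: subrr.
move=> v; rewrite ie addrC -scaleN1r; apply: altP; last exact: alt_eder.
by apply: IHk; exact: (eOm_inc v H).
Qed.

Lemma eOmP W k (a : R) (eta theta : eform W) : eOm k eta -> eOm k theta ->
  eOm k (a *: eta + theta).
Proof.
move=> [a1 s1] [a2 s2]; split; last exact: esmoothP.
by move=> x; apply: altP.
Qed.

Lemma eOm0 W k : eOm k (0 : eform W).
Proof. by split => [x|]; [exact: alt0|exact: esmooth0]. Qed.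

Section wedge_forms.
Variables (W1 W2 W : vectType R) (op : W1 -> W2 -> W).
Hypothesis opl : forall w, linear (op^~ w).
Hypothesis opr : forall u, linear (op u).

Definition ewp (a : eform W1) (b : eform W2) : eform W := fun x => wp_rec op (a x) (b x).
Definition egr W' (a : eform W') : eform W' := fun x => gr (a x).

Lemma esmooth_gr W' (a : eform W') : esmooth a -> esmooth (egr a).
Proof.
move=> H s; have := vsmooth_lincomb ((-1) ^+ size s) openT (H s) (vsmooth_cst setT (0 : W')).
by apply: vsmooth_eq => [|x _]; [exact: openT|rewrite addr0].
Qed.

Lemma esmooth_wp a b : esmooth a -> esmooth b -> esmooth (ewp a b).
Proof.
move=> + + s; elim: s a b => [|v s IHs] a b sa sb.
  exact: (vsmooth_bilin openT opl opr (sa [::]) (sb [::])).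
have H1 := IHs (einc v a) b (esmooth_inc v sa) sb.
have H2 := IHs (egr a) (einc v b) (esmooth_gr sa) (esmooth_inc v sb).
have := vsmooth_lincomb 1 openT H1 H2.
by apply: vsmooth_eq => [|x _]; [exact: openT|rewrite scale1r].
Qed.

Lemma eOm_wp p q a b : eOm p a -> eOm q b -> eOm (p + q) (ewp a b).
Proof.
move=> [aa sa] [ab sb]; split; last exact: esmooth_wp.
by move=> x; exact: alt_wp.
Qed.

Lemma egr_der W' v (a : eform W') : esmooth a -> eder v (egr a) = egr (eder v a).
Proof.
move=> H; apply/funext => x; apply/funext => s; rewrite /eder /egr /gr.
have := vderive_lincomb ((-1) ^+ size s) v (esmooth_vdiff s x H) (vdiff_cst (0 : W') x).
rewrite vderive_cst addr0 => <-; congr (vderive v _ x).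
by apply/funext => y; rewrite addr0.
Qed.

Lemma egr_ed W' (a : eform W') : esmooth a -> ed (egr a) = - egr (ed a).
Proof.
move=> H; apply/funext => x; apply/funext => s.
elim: s a H => [|v s IHs] a H; first by rewrite !fctE /egr /gr /ed !big_ord0 scaler0 oppr0.
rewrite ed_cons (egr_der _ H).
have -> : einc v (egr a) = (-1) *: egr (einc v a) + 0.
  by rewrite addr0 scaleN1r; apply/funext => y; exact: iota_gr.
rewrite ed_lin; [|exact/esmooth_gr/esmooth_inc|exact: esmooth0].
rewrite ed0 addr0 scaleN1r !fctE opprK (IHs _ (esmooth_inc v H)) !fctE.
rewrite /egr /gr ed_cons /= exprS mulN1r scaleNr opprK scalerBr.
by [].
Qed.

Lemma eder_wp v a b : esmooth a -> esmooth b ->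
  eder v (ewp a b) = ewp (eder v a) b + ewp a (eder v b).
Proof.
move=> sa sb; apply/funext => x; apply/funext => s.
elim: s a b sa sb => [|u s IHs] a b sa sb.
  exact: (vderive_bilin v opl opr (esmooth_vdiff [::] x sa) (esmooth_vdiff [::] x sb)).
have sa' := esmooth_inc u sa; have sb' := esmooth_inc u sb.
have sga := esmooth_gr sa.
have E1 := IHs _ _ sa' sb; have E2 := IHs _ _ sga sb'.
have := vderive_lincomb 1 v (esmooth_vdiff s x (esmooth_wp sa' sb))
  (esmooth_vdiff s x (esmooth_wp sga sb')).
rewrite scale1r -/(eder v (ewp (einc u a) b) x s) -/(eder v (ewp (egr a) (einc u b)) x s).
rewrite E1 E2 (egr_der _ sa) !fctE addrACA => <-.
by congr (vderive v _ x); apply/funext => y; rewrite scale1r.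
Qed.

(** Contraction with a vector reduces the rule to the product rule for [eder] and to the same rule
    with one factor contracted; the signs come from [gr], which anticommutes with both [ed] and the
    contraction. *)
Lemma ed_wp a b : esmooth a -> esmooth b ->
  ed (ewp a b) = ewp (ed a) b + ewp (egr a) (ed b).
Proof.
move=> sa sb; apply/funext => x; apply/funext => s.
elim: s a b sa sb => [|u s IHs] a b sa sb.
  by rewrite !fctE /ewp /= /ed !big_ord0 (op0l opl) (op0r opr) addr0.
have sa' := esmooth_inc u sa; have sb' := esmooth_inc u sb.
have sga := esmooth_gr sa.
rewrite ed_cons (eder_wp _ sa sb).
have -> : einc u (ewp a b) = 1 *: ewp (einc u a) b + ewp (egr a) (einc u b).
  by rewrite scale1r.
rewrite ed_lin; [|exact: esmooth_wp|exact: esmooth_wp].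
rewrite scale1r !fctE (IHs _ _ sa' sb) (IHs _ _ sga sb') (egr_ed sa) !fctE.
have -> : egr (egr a) = a by apply/funext => y; exact: grK.
rewrite /ewp /= -/(einc u (ed a) x) -/(einc u (ed b) x) !ed_cons_fun.
rewrite -[iota_ u (egr a x)]/(einc u (egr a) x).
have -> : einc u (egr a) x = - egr (einc u a) x by exact: iota_gr.
rewrite -[gr (egr a x)]/(egr (egr a) x).
have -> : egr (egr a) = a by apply/funext => y; exact: grK.
rewrite -[(eder u a - _) x]/(eder u a x - ed (einc u a) x).
rewrite -[(eder u b - _) x]/(eder u b x - ed (einc u b) x).
rewrite (wpBl opl) (wpBr opr) !(wpNl opl) -/(egr (ed a) x).
move: (wp_rec op (eder u a x) (b x) s) (wp_rec op (a x) (eder u b x) s)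
  (wp_rec op (ed (einc u a) x) (b x) s) (wp_rec op (egr (einc u a) x) (ed b x) s)
  (wp_rec op (egr (ed a) x) (iota_ u (b x)) s) (wp_rec op (a x) (ed (einc u b) x) s).
move=> p1 p2 p3 p4 p5 p6; rewrite !opprD opprK.
by rewrite [LHS](AC (2*(2*2)) ((1*3*5)*(4*(2*6)))).
Qed.

End wedge_forms.
End euclidean_forms.

(** * The symplectic contraction *)

Section smooth_matrix.
Context {R : realType} {U : normedModType R}.

Lemma smooth_prod (D : set U) (I : Type) (r : seq I) (f : I -> U -> R^o) :
  open D -> (forall i, smooth_on D (f i)) ->
  smooth_on D (fun x => \prod_(i <- r) f i x : R^o).
Proof.
move=> oD sf k; elim: r => [|i r IHr].
  apply: (Cn_on_eq (f := fun=> 1 : R^o)) => // [x _|]; first by rewrite big_nil.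
  exact: Cn_on_cst.
apply: (Cn_on_eq (f := fun x => f i x * \prod_(j <- r) f j x : R^o)) => // [x _|].
  by rewrite big_cons.
by apply: Cn_onM => //; exact: sf.
Qed.

Lemma smooth_det (D : set U) k (A : U -> 'M[R]_k) : open D ->
  (forall i j, smooth_on D (fun x => A x i j : R^o)) ->
  smooth_on D (fun x => \det (A x) : R^o).
Proof.
move=> oD sA k'; rewrite /determinant; apply: Cn_on_sum => // s.
apply: Cn_onM => //; first exact: Cn_on_cst.
by apply: smooth_prod => // i; exact: sA.
Qed.

Lemma smooth_invmx (D : set U) k (A : U -> 'M[R]_k) : open D ->
  (forall i j, smooth_on D (fun x => A x i j : R^o)) ->
  (forall x, D x -> A x \in unitmx) ->
  forall i j, smooth_on D (fun x => invmx (A x) i j : R^o).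
Proof.
move=> oD sA uA i j l.
apply: (Cn_on_eq (f := fun x => (\det (A x))^-1 *
    ((-1) ^+ (j + i) * \det (row' j (col' i (A x)))) : R^o)) => // [x Dx|].
  by rewrite /invmx uA// !mxE.
apply: Cn_onM => //.
  apply: Cn_onV => // [x /uA|]; first by rewrite unitmxE unitfE.
  exact: smooth_det.
apply: Cn_onM => //; first exact: Cn_on_cst.
apply: smooth_det => // i' j' l'.
apply: (Cn_on_eq (f := fun x => A x (lift j i') (lift i j') : R^o)) => // [x _|].
  by rewrite !mxE.
exact: sA.
Qed.

End smooth_matrix.

Section contraction.
Context {R : realType} {n : nat}.
Notation m := n.*2.
Notation E := 'rV[R]_m.
Implicit Types (W : vectType R) (s : seq E).
Local Notation e_ := (@ebasis R m).

(** Contraction with the bivector of matrix [B]. For [B] minus the inverse of the Gram matrix of a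
    symplectic form this is the dual Lefschetz operator, the sign being such that the form itself is
    sent to [n]. *)
Definition contract W (B : 'M[R]_m) (h : seq E -> W) : seq E -> W :=
  2^-1 *: \sum_i \sum_j B i j *: iota_ (e_ j) (iota_ (e_ i) h).

Definition gram (a : seq E -> R^o) : 'M[R]_m := \matrix_(i, j) a [:: e_ i; e_ j].

Lemma wsc_sumr W (a : seq E -> R^o) (I : Type) (r : seq I) (c : I -> R)
    (h : I -> seq E -> W) s :
  wsc a (\sum_(i <- r) c i *: h i) s = \sum_(i <- r) c i *: wsc a (h i) s.
Proof.
elim: r => [|i r IHr]; first by rewrite !big_nil; exact: (wp0r (@scale_opr R W)).
by rewrite !big_cons -IHr; exact: (wp_linr (@scale_opr R W)).
Qed.

Lemma wsc_suml W (b : seq E -> W) (I : Type) (r : seq I) (c : I -> R)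
    (a : I -> seq E -> R^o) s :
  wsc (\sum_(i <- r) c i *: a i) b s = \sum_(i <- r) c i *: wsc (a i) b s.
Proof.
elim: r => [|i r IHr]; first by rewrite !big_nil; exact: (wp0l (@scale_opl R W)).
by rewrite !big_cons -IHr; exact: (wp_linl (@scale_opl R W)).
Qed.

Lemma alt_contract W k (B : 'M[R]_m) (h : seq E -> W) : alt k h ->
  alt k.-2 (contract B h).
Proof.
move=> ah; apply: altZ; apply: alt_sum => i; apply: alt_sum => j; apply: altZ.
by apply: (@alt_iota _ _ _ k.-1); exact: alt_iota.
Qed.

Lemma contract_low W k (B : 'M[R]_m) (h : seq E -> W) : (k < 2)%N -> alt k h ->
  contract B h = 0.
Proof.
move=> k2 ah; rewrite /contract big1 ?scaler0// => i _; rewrite big1// => j _.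
suff -> : iota_ (e_ j) (iota_ (e_ i) h) = 0 by rewrite scaler0.
case: k k2 ah => [|[|//]] _ ah; first by rewrite (ah (e_ i)).
by case: ah => _ _ _ /(_ (e_ i)); exact.
Qed.

Lemma gram_antisym (a : seq E -> R^o) : alt 2 a -> (gram a)^T = - gram a.
Proof.
move=> aa; apply/matrixP => i j; rewrite !mxE.
exact: (congr1 (fun g => g [::]) (alt_swap (e_ i) (e_ j) aa)).
Qed.

Lemma iota2_wsc W (a : seq E -> R^o) (h : seq E -> W) u v s : alt 2 a ->
  iota_ v (iota_ u (wsc a h)) s = (a [:: u; v] : R) *: h s -
   wsc (iota_ u a) (iota_ v h) s + wsc (iota_ v a) (iota_ u h) s +
   wsc a (iota_ v (iota_ u h)) s.
Proof.
move=> aa; have L := @scale_opl R W; rewrite /wsc.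
rewrite (iota_wp L u h aa) sqrrN expr1n scale1r.
rewrite -[iota_ v (_ + _)]/(iota_ v (wp_rec _ _ _) + iota_ v (wp_rec _ _ _)).
rewrite (iota_wp L v _ aa) (iota_wp L v _ (alt_iota u aa)).
rewrite sqrrN expr1n scale1r expr1 scaleN1r !fctE !addrA; congr (_ - _ + _ + _).
rewrite -(wsc_scalar (a [:: u; v]) h s) -/(wsc _ _ _); congr (wsc _ h s).
apply/funext => -[//|w t].
have /alt_alternating[sz _ _] := aa; exact: sz.
Qed.

(** The double contraction of [a /\ h] has three kinds of terms. Both vectors on [h] give
    [a /\ Lam h]; both on [a] give half the trace of the identity of size [2 n], that is [n]; one on
    each gives, by antisymmetry of [B], twice the same sum, which [euler] evaluates to [- k]. *)
Lemma contract_wsc W k (a : seq E -> R^o) (h : seq E -> W) s :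
  alt 2 a -> alt k h -> gram a \in unitmx ->
  contract (- invmx (gram a)) (wsc a h) s =
  wsc a (contract (- invmx (gram a)) h) s + (n%:R - k%:R) *: h s.
Proof.
move=> aa ah ua; set A := gram a; set B := - invmx A.
have BA : B *m A = - 1%:M by rewrite mulNmx mulVmx.
have AB : A *m B = - 1%:M by rewrite mulmxN mulmxV.
have AT : A^T = - A := gram_antisym aa.
have BT : B^T = - B.
  have : A *m B^T = A *m (- B).
    rewrite mulmxN AB opprK -[A]trmxK AT -trmx_mul.
    by rewrite mulmxN BA opprK trmx1.
  by move/(congr1 (mulmx (invmx A))); rewrite !mulKmx.
have Bij i j : B j i = - B i j by have /matrixP/(_ i j) := BT; rewrite !mxE.
pose X i j : W := wsc (iota_ (e_ i) a) (iota_ (e_ j) h) s.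
have -> : contract B (wsc a h) s = 2^-1 *: (
    \sum_i \sum_j (B i j * A i j) *: h s +
    \sum_i \sum_j (B i j *: X j i - B i j *: X i j) +
    \sum_i \sum_j B i j *: wsc a (iota_ (e_ j) (iota_ (e_ i) h)) s).
  rewrite /contract !fctE fct_sumE -!big_split/=; congr (_ *: _).
  apply: eq_bigr => i _; rewrite fct_sumE -!big_split/=.
  apply: eq_bigr => j _; rewrite !fctE (iota2_wsc _ _ _ _ aa).
  rewrite !scalerDr scalerN scalerA [A i j]mxE -!addrA; congr (_ + _).
  by rewrite addrCA.
rewrite !scalerDr addrC; congr (_ + _).
  rewrite /wsc/contract (wpZr (@scale_opr R W)) -/(wsc _ _ _); congr (_ *: _).
  have := wsc_sumr a (index_enum 'I_m) (fun=> 1)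
     (fun i => \sum_j B i j *: iota_ (e_ j) (iota_ (e_ i) h)) s.
  under [in X in wsc a X s = _]eq_bigr do rewrite scale1r.
  move=> ->; apply: eq_bigr => i _; rewrite scale1r.
  by rewrite wsc_sumr.
rewrite scalerBl; congr (_ + _).
  under eq_bigr do rewrite -scaler_suml.
  rewrite -scaler_suml scalerA; congr (_ *: _).
  have -> : \sum_i \sum_j B i j * A i j = - \tr (B *m A).
    rewrite /mxtrace -sumrN; apply: eq_bigr => i _; rewrite mxE -sumrN.
    by apply: eq_bigr => j _; have /matrixP/(_ i j) := AT; rewrite !mxE => ->; rewrite mulrN opprK.
  by rewrite BA raddfN/= opprK mxtrace1 -muln2 natrM mulrC mulfK// pnatr_eq0.
have -> : \sum_i \sum_j (B i j *: X j i - B i j *: X i j) = 2 *: \sum_i \sum_j B i j *: X j i.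
  rewrite scaler_nat mulr2n.
  have ex : \sum_i \sum_j B i j *: X j i = \sum_i \sum_j - (B i j *: X i j).
    rewrite exchange_big/=; apply: eq_bigr => i _; apply: eq_bigr => j _.
    by rewrite Bij scaleNr.
  rewrite {2}ex -big_split/=; apply: eq_bigr => i _.
  by rewrite -big_split.
rewrite scalerA mulVf ?pnatr_eq0// scale1r -(euler s ah) -sumrN.
apply: eq_bigr => i _; rewrite -wsc_suml.
(* This is the relation [B *m A = - 1%:M], evaluated on a vector. *)
have -> : \sum_j B i j *: iota_ (e_ j) a = - coform i.
  have /alt_alternating aa' := aa; have [sz _ _] := aa'.
  apply/funext => t; rewrite fct_sumE.
  have [[u ->]|t1] : (exists u, t = [:: u]) \/ size t != 1%N.
  - by case: t => [|u [|w t]]; [right|left; exists u|right].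
  - rewrite !fctE /= (eq_bigr (fun j => \sum_l u ord0 l * (B i j * A j l))) => [|j _].
      rewrite exchange_big/=.
      have -> : u ord0 i = \sum_l u ord0 l * (i == l)%:R.
        rewrite (bigD1 i)//= eqxx mulr1 big1 ?addr0// => l /negPf.
        by rewrite eq_sym => ->; rewrite mulr0.
      rewrite -sumrN; apply: eq_bigr => l _; rewrite -mulr_sumr.
      have /matrixP/(_ i l) := BA; rewrite !mxE => ->.
      by rewrite mulrN.
    rewrite !fctE /iota_ (alternating_sum [:: e_ j] [::] u aa') scaler_sumr.
    by apply: eq_bigr => l _; rewrite /GRing.scale/= mulrCA [A j l]mxE.
  rewrite big1 => [|j _]; last by rewrite !fctE /iota_ sz ?scaler0//=; lia.
  by rewrite !fctE; case: t t1 => [|u [|w t]]//; rewrite /coform oppr0.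
by rewrite /wsc (wpNl (@scale_opl R W)).
Qed.

End contraction.

(** * The Poincare lemma *)

Section vect_radial.
Context {R : realType} {m : nat} {W : vectType R}.
Notation E := 'rV[R]_m.
Implicit Types f g : E -> W.

Definition vradial (j : nat) f (x : E) : W :=
  r2v (\row_i radial j (fun y => vc i (f y)) x).

Lemma vc_vradial j f x i : vc i (vradial j f x) = radial j (fun y => vc i (f y)) x.
Proof. by rewrite vc_r2v mxE. Qed.

Lemma vc_smooth f i : vsmooth_on setT f -> smooth_on setT (fun y => vc i (f y)).
Proof. by move=> sf; have /vsmoothP := sf => /(_ openT i). Qed.

Lemma vsmooth_radial j f : vsmooth_on setT f -> vsmooth_on setT (vradial j f).
Proof.
move=> sf; apply/vsmoothP; first exact: openT.
move=> i; have := smooth_radial j (@vc_smooth f i sf).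
rewrite (_ : radial j _ = fun x => vc i (vradial j f x)); first exact.
by apply/funext => x; rewrite vc_vradial.
Qed.

Lemma vc_continuous f i : vsmooth_on setT f -> continuous (fun y => vc i (f y)).
Proof. by move=> sf; exact: (Cn_on_continuous (@vc_smooth f i sf 0%N)). Qed.

Lemma vradial_eq j x f g : f =1 g -> vradial j f x = vradial j g x.
Proof. by move=> /funext ->. Qed.

Lemma vradial_lin j x (a : R) f g : vsmooth_on setT f -> vsmooth_on setT g ->
  vradial j (fun y => a *: f y + g y) x = a *: vradial j f x + vradial j g x.
Proof.
move=> sf sg; apply: vc_inj => i; rewrite vcP !vc_vradial.
rewrite -(radial_linear j x a (@vc_continuous f i sf) (@vc_continuous g i sg)).
by congr (radial j _ x); apply/funext => y; rewrite vcP.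
Qed.

Lemma vradial0 j x : vradial j (fun=> 0 : W) x = 0.
Proof.
have s0 := vsmooth_cst [set: E] (0 : W).
have E0 : (fun=> 1 *: (0 : W) + 0) = (fun=> 0) :> (E -> W).
  by apply/funext => y; rewrite scaler0 addr0.
have := vradial_lin j x 1 s0 s0; rewrite E0 scale1r; move: (vradial _ _ _) => w.
by rewrite -[X in X = _]addr0 => /addrI <-.
Qed.

Lemma vradialZ j x (a : R) f : vsmooth_on setT f ->
  vradial j (fun y => a *: f y) x = a *: vradial j f x.
Proof.
move=> sf; have := vradial_lin j x a sf (vsmooth_cst [set: E] (0 : W)).
by rewrite vradial0 addr0 => <-; apply: vradial_eq => y; rewrite addr0.
Qed.

Lemma vradial_sum j x (I : Type) (r : seq I) (a : I -> R) (f : I -> E -> W) :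
  (forall i, vsmooth_on setT (f i)) ->
  vradial j (fun y => \sum_(i <- r) a i *: f i y) x =
  \sum_(i <- r) a i *: vradial j (f i) x.
Proof.
move=> sf; have sZ i : vsmooth_on setT (fun y => a i *: f i y).
  have := vsmooth_lincomb (a i) openT (sf i) (vsmooth_cst [set: E] (0 : W)).
  by apply: vsmooth_eq => [|y _]; [exact: openT|rewrite addr0].
elim: r => [|i r IHr].
  rewrite big_nil -[RHS](vradial0 j x); congr vradial.
  by apply/funext => y; rewrite big_nil.
rewrite big_cons -IHr -vradial_lin//; last exact: vsmooth_sum openT sZ.
by apply: vradial_eq => y; rewrite big_cons.
Qed.

Lemma vderive_vradial j f x v : vsmooth_on setT f ->
  vderive v (vradial j f) x = vradial j.+1 (vderive v f) x.
Proof.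
move=> sf; apply: vc_inj => i.
rewrite (vc_vderive v i (vsmooth_vdiff (vsmooth_radial j sf) I)) vc_vradial.
have [_ /(_ v) E1] := derive_radial j x (@vc_smooth f i sf 2%N).
have E2 : (fun y => vc i (vradial j f y)) = radial j (fun y => vc i (f y)).
  by apply/funext => y; rewrite vc_vradial.
have E3 : (fun y => vc i (vderive v f y)) = 'D_v (fun y => vc i (f y)).
  by apply/funext => y; exact: vc_vderive (vsmooth_vdiff sf I).
by rewrite E2 E1 E3.
Qed.

Lemma vradial_FTC j f x : vsmooth_on setT f ->
  j.+1%:R *: vradial j f x + vradial j.+1 (vderive x f) x = f x.
Proof.
move=> sf; apply: vc_inj => i; rewrite vcP !vc_vradial.
have E3 : (fun y => vc i (vderive x f y)) = 'D_x (fun y => vc i (f y)).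
  by apply/funext => y; exact: vc_vderive (vsmooth_vdiff sf I).
by rewrite E3; exact: (radial_FTC j x (@vc_smooth f i sf)).
Qed.

End vect_radial.

Section poincare.
Context {R : realType} {m : nat} {W : vectType R}.
Notation E := 'rV[R]_m.
Implicit Types (s : seq E) (eta : @eform R m W).

(** The homotopy operator of the contraction to the origin: the integral over the unit interval of
    [t^j eta(t x)(x, s)], for [eta] of degree [j + 1]. *)
Definition cone j eta : @eform R m W := fun x s => vradial j (fun y => eta y (x :: s)) x.

(** In [cone], [x] is both the base point and an argument. Expanding the argument in the basis
    separates the two roles, so that the Leibniz rule applies. *)
Lemma cone_sum k j eta s : eOm k eta ->
  (fun x => cone j eta x s) =
  (fun x => \sum_l (x ord0 l : R) *: vradial j (fun y => eta y (ebasis l :: s)) x).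
Proof.
move=> [ae se]; apply/funext => x; rewrite -vradial_sum => [|l]; last exact: se.
apply: vradial_eq => y.
have /alt_alternating ay := ae y.
by rewrite -[x :: s]cat0s (alternating_sum [::] s x ay).
Qed.

Lemma smooth_coord (l : 'I_m) : smooth_on setT (fun x : E => x ord0 l : R^o).
Proof.
case=> [|k]; first by move=> x _; exact: coord_continuous.
split=> [x _|v]; first exact: differentiable_coord.
apply: (Cn_on_eq (f := fun=> v ord0 l)) => [|x _|]; [exact: openT| |exact: Cn_on_cst].
have := derive_row_coord (f := id) (v := v) (x := x) l.
by rewrite derive_id; apply; exact: derivable_id.
Qed.

Lemma vderive_coord (l : 'I_m) (x v : E) :
  vderive v (fun x : E => x ord0 l : R^o) x = v ord0 l.
Proof.
have sl := smooth_coord l.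
have dl : vdiff (fun x : E => x ord0 l : R^o) x.
  exact: vsmooth_vdiff (vsmooth_scalar openT sl) I.
rewrite vderive_scalar//.
have := derive_row_coord (f := id) (v := v) (x := x) l.
by rewrite derive_id => -> //; exact: derivable_id.
Qed.

Lemma esmooth_cone k j eta : eOm k eta -> esmooth (cone j eta).
Proof.
move=> H s; rewrite (cone_sum j s H); apply: vsmooth_sum => [|l]; first exact: openT.
apply: (vsmooth_bilin openT (@scale_opl R W) (@scale_opr R W)).
  exact: vsmooth_scalar openT (smooth_coord l).
by apply: vsmooth_radial; exact: H.2.
Qed.

Lemma eder_cone k j eta v x s : eOm k eta ->
  eder v (cone j eta) x s = vradial j (fun y => eta y (v :: s)) x +
    vradial j.+1 (fun y => eder v eta y (x :: s)) x.
Proof.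
move=> H; rewrite /eder (cone_sum j s H).
have sl l : vsmooth_on setT (fun x : E => x ord0 l : R^o).
  exact: vsmooth_scalar openT (smooth_coord l).
have sr l : vsmooth_on setT (vradial j (fun y => eta y (ebasis l :: s))).
  by apply: vsmooth_radial; exact: H.2.
have -> : vderive v (fun x : E => \sum_l (x ord0 l : R) *:
      vradial j (fun y => eta y (ebasis l :: s)) x) x =
    \sum_l ((v ord0 l : R) *: vradial j (fun y => eta y (ebasis l :: s)) x +
      (x ord0 l : R) *: vradial j.+1 (fun y => eder v eta y (ebasis l :: s)) x).
  have dl l : vdiff (fun z : E => scale_op (z ord0 l : R^o)
      (vradial j (fun y => eta y (ebasis l :: s)) z)) x.
    apply: (vdiff_bilin (@scale_opl R W) (@scale_opr R W)).
      exact: vsmooth_vdiff (sl l) I.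
    exact: vsmooth_vdiff (sr l) I.
  rewrite (_ : \sum_l _ = \sum_l vderive v (fun z : E => scale_op (z ord0 l : R^o)
      (vradial j (fun y => eta y (ebasis l :: s)) z)) x).
    exact: (vderive_sum (index_enum 'I_m) v dl).2.
  apply: eq_bigr => l _; rewrite (vderive_bilin v (@scale_opl R W) (@scale_opr R W)).
  - rewrite vderive_coord vderive_vradial; last exact: H.2.
    reflexivity.
  - exact: vsmooth_vdiff (sl l) I.
  - exact: vsmooth_vdiff (sr l) I.
rewrite big_split/= -!vradial_sum; first last.
- by move=> l; exact: H.2.
- by move=> l; exact: (esmooth_der v H.2).
apply: congr2; apply: vradial_eq => y.
  have /alt_alternating ay := H.1 y.
  by rewrite -[v :: s]cat0s (alternating_sum [::] s v ay).
have /alt_alternating ay := alt_eder v y H.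
exact: (esym (alternating_sum [::] s x ay)).
Qed.

Lemma eOm_cone j eta : eOm j.+1 eta -> eOm j (cone j eta).
Proof.
move=> H; split; last exact: esmooth_cone H.
move=> x; apply/alt_alternating.
have aa y : alternating_form j (iota_ x (eta y)).
  by apply/alt_alternating; exact: (alt_iota x (H.1 y)).
split.
- move=> s ss; rewrite -[RHS](vradial0 j x); apply: vradial_eq => y.
  by have [sz _ _] := aa y; exact: sz.
- move=> s1 s2 a u v; rewrite /cone -vradial_lin; [|exact: H.2|exact: H.2].
  apply: vradial_eq => y.
  by have [_ lin _] := aa y; exact: lin.
- move=> s1 s2 s3 u; rewrite -[RHS](vradial0 j x); apply: vradial_eq => y.
  by have [_ _ al] := aa y; exact: al.
Qed.

Lemma alternating_front k (h : seq E -> W) s1 u s2 : alt k h ->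
  h (s1 ++ u :: s2) = (-1) ^+ size s1 *: h (u :: s1 ++ s2).
Proof.
elim: s1 k h => [|v s1 IHs] k h ah; first by rewrite scale1r.
rewrite cat_cons -[LHS]/(iota_ v h (s1 ++ u :: s2)) (IHs _ _ (alt_iota v ah)).
rewrite exprS mulN1r scaleNr -scalerN; congr (_ *: _).
exact: (congr1 (fun g => g (s1 ++ s2)) (alt_swap u v ah)).
Qed.

(** By [eder_cone], [ed (cone j eta)] consists of [j + 1] terms where the new vector replaces the
    argument [x], each equal to the radial integral of [eta], and of terms differentiating [eta].
    Closedness turns the latter into the derivative along [x], and [vradial_FTC] adds up both
    parts. *)
Lemma poincare_cone j eta : eOm j.+1 eta -> ed eta = 0 -> eta = ed (cone j eta).
Proof.
move=> H d0; apply/funext => x; apply/funext => s.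
have [sj|sj] := eqVneq (size s) j.+1; last first.
  have /alt_alternating[sz _ _] := H.1 x.
  have /alt_alternating[sz' _ _] := (eOm_ed (eOm_cone H)).1 x.
  by rewrite sz ?sz'.
rewrite /ed -[LHS](vradial_FTC j x (H.2 s)).
under eq_bigr do rewrite -/(eder _ (cone j eta) x _) (eder_cone _ _ _ _ H) scalerDr.
rewrite big_split/=; congr (_ + _).
  rewrite scaler_nat -sj -[X in _ *+ X]card_ord -sumr_const; apply: eq_bigr => i _.
  rewrite -vradialZ; last exact: H.2.
  apply: vradial_eq => y; rewrite -[in LHS](cat_take_drop i s).
  rewrite (drop_nth 0 (ltn_ord i)) (alternating_front _ _ _ (H.1 y)).
  by rewrite size_take ltn_ord.
(* Closedness of [eta] on the list [x :: s], where [x] is frozen as a constant vector while the base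
   point [y] varies. *)
have -> : vderive x (fun y => eta y s) = fun y => \sum_(i < size s)
    (-1) ^+ i *: eder s`_i eta y (x :: rem_at i s).
  apply/funext => y; have := congr1 (fun f => f y (x :: s)) d0.
  rewrite ed_cons => /eqP; rewrite subr_eq0 => /eqP E1.
  exact: E1.
by rewrite vradial_sum// => i; exact: (esmooth_der _ H.2).
Qed.

End poincare.

(** * Operators on forms on Euclidean space *)

Section linear_operators.
Context {R : realType} {m : nat} {V : vectType R}.
Notation E := 'rV[R]_m.
Notation X := (E -> seq E -> V).

Definition ewedge (a : @eform R m R^o) (h : X) : X := fun x => wsc (a x) (h x).

Lemma ewedge_is_linear a : linear (ewedge a).
Proof.
move=> c h g; apply/funext => x; apply/funext => s.
exact: (wp_linr (@scale_opr R V)).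
Qed.
HB.instance Definition _ a := GRing.isLinear.Build R X X *:%R (ewedge a)
  (ewedge_is_linear a).

Definition emap (f : 'End(V)) (h : X) : X := fun x s => f (h x s).

Lemma emap_is_linear f : linear (emap f).
Proof.
by move=> c h g; apply/funext => x; apply/funext => s; rewrite /emap !fctE linearP.
Qed.
HB.instance Definition _ f := GRing.isLinear.Build R X X *:%R (emap f)
  (emap_is_linear f).

Lemma wsc_map (W : vectType R) (f : V -> W) (a : seq E -> R^o) (h : seq E -> V) s :
  linear f -> wsc a (fun t => f (h t)) s = f (wsc a h s).
Proof.
move=> fL; have fZ (c : R) w : f (c *: w) = c *: f w.
  by have := linear_map_sum [:: tt] (fun=> c) (fun=> w) fL; rewrite !big_seq1.
elim: s a h => [|v s IHs] a h; first exact: (esym (fZ _ _)).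
rewrite /wsc/= -!/(wsc _ _ _) (IHs _ (iota_ v h)) IHs.
by have := fL 1 (wsc (iota_ v a) h s) (wsc (gr a) (iota_ v h) s); rewrite !scale1r.
Qed.

Lemma ewedge_emap a f h : ewedge a (emap f h) = emap f (ewedge a h).
Proof.
apply/funext => x; apply/funext => s; apply: (wsc_map (f := f)).
by move=> c u v; rewrite linearP.
Qed.

End linear_operators.

Section contraction_operator.
Context {R : realType} {n : nat} {V : vectType R}.
Notation m := n.*2.
Notation E := 'rV[R]_m.
Notation X := (E -> seq E -> V).

Definition econtract (omega : @eform R m R^o) (h : X) : X :=
  fun x => contract (- invmx (gram (omega x))) (h x).

Lemma econtract_is_linear omega : linear (econtract omega).
Proof.
move=> c h g; apply/funext => x.
rewrite -[RHS]/(c *: econtract omega h x + econtract omega g x) /econtract /contract.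
rewrite scalerA mulrC -scalerA -scalerDr; congr (_ *: _).
rewrite scaler_sumr -big_split/=; apply: eq_bigr => i _.
rewrite scaler_sumr -big_split/=; apply: eq_bigr => j _.
by rewrite scalerA mulrC -scalerA -scalerDr.
Qed.
HB.instance Definition _ omega := GRing.isLinear.Build R X X *:%R (econtract omega)
  (econtract_is_linear omega).

Variables (omega lambda : @eform R m R^o) (Phi : 'End(V)).
Hypothesis lambda1 : eOm 1 lambda.
Hypothesis dlambda : ed lambda = omega.
Hypothesis nondeg : forall x u, (forall v, omega x [:: u; v] = 0) -> u = 0.

Lemma eOm_omega : eOm 2 omega.
Proof. by rewrite -dlambda; exact: eOm_ed. Qed.

Lemma gram_unit x : gram (omega x) \in unitmx.
Proof.
rewrite -row_free_unit; apply: inj_row_free => u u0; apply: (nondeg (x := x)) => v.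
have /alt_alternating aa := eOm_omega.1 x.
rewrite (alternating_sum [:: u] [::] v aa) big1// => j _.
suff -> : omega x ([:: u] ++ [:: ebasis j]) = (u *m gram (omega x)) ord0 j.
  by rewrite u0 mxE scaler0.
rewrite mxE (alternating_sum [::] [:: ebasis j] u aa).
by apply: eq_bigr => i _; rewrite mxE.
Qed.

Lemma esmooth_contract (h : X) : esmooth h -> esmooth (econtract omega h).
Proof.
move=> sh s; have sw := eOm_omega.2.
have sinv := smooth_invmx openT (A := fun x => gram (omega x)) _ (fun x _ => gram_unit x).
have {}sinv i j : vsmooth_on setT (fun x => - invmx (gram (omega x)) i j : R^o).
  apply: vsmooth_scalar; first exact: openT.
  move=> k; have H : Cn_on k setT (fun x => invmx (gram (omega x)) i j : R^o).
    apply: sinv => i' j' k'.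
    have := scalar_vsmooth openT (sw [:: ebasis i'; ebasis j']) k'.
    by apply: Cn_on_eq => [|x _]; [exact: openT|rewrite mxE].
  apply: (Cn_on_eq (f := fun x => -1 * invmx (gram (omega x)) i j : R^o)).
  - exact: openT.
  - by move=> x _; rewrite mulN1r.
  - by apply: Cn_onM => //; [exact: openT|exact: Cn_on_cst].
have H : vsmooth_on setT (fun x => \sum_i \sum_j
    scale_op (- invmx (gram (omega x)) i j : R^o) (h x [:: ebasis i, ebasis j & s])).
  apply: vsmooth_sum => [|i]; first exact: openT.
  apply: vsmooth_sum => [|j]; first exact: openT.
  exact: (vsmooth_bilin openT (@scale_opl R V) (@scale_opr R V) (sinv i j)
    (sh [:: ebasis i, ebasis j & s])).
have := vsmooth_lincomb 2^-1 openT H (vsmooth_cst [set: E] (0 : V)).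
apply: vsmooth_eq => [|x _]; first exact: openT.
rewrite addr0 /econtract /contract !fctE fct_sumE; congr (_ *: _).
apply: eq_bigr => i _; rewrite fct_sumE; apply: eq_bigr => j _.
by rewrite [(- invmx _) i j]mxE.
Qed.

Lemma model_complex : symplectic_complex n (@eOm R m V)
  (ewedge omega : {linear X -> X}) (econtract omega : {linear X -> X})
  (ewedge lambda : {linear X -> X}) (emap Phi : {linear X -> X}) (@ed R m V).
Proof.
have L := @scale_opl R V; have Rr := @scale_opr R V.
have w2 := eOm_omega.
split.
- exact: eOm0.
- exact: eOmP.
- by move=> k x hx; exact: (eOm_wp L Rr w2 hx).
- move=> k x [ax sx]; split; last exact: esmooth_contract.
  by move=> y; exact: (alt_contract _ (ax y)).
- move=> k x k2 [ax _]; apply/funext => y; exact: (contract_low _ k2 (ax y)).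
- move=> k x nk [ax _]; apply/funext => y; exact: (alt_top nk (ax y)).
- move=> k x [ax _]; apply/funext => y; apply/funext => s.
  exact: (contract_wsc s (w2.1 y) (ax y) (gram_unit y)).
- by move=> k x hx; exact: (eOm_wp L Rr lambda1 hx).
- move=> k x [ax sx].
  have PL : linear Phi by move=> c u v; rewrite linearP.
  split; last by move=> s; exact: (vsmooth_lin openT PL (sx s)).
  move=> y; apply/alt_alternating; have /alt_alternating[sz lin al] := ax y.
  change (alternating_form k (fun s => Phi (x y s))); split.
  + by move=> s ss; rewrite sz// linear0.
  + by move=> s1 s2 a u v; rewrite lin linearP.
  + by move=> s1 s2 s3 u; rewrite al linear0.
- by move=> k x hx; exact: eOm_ed.
- by move=> k a x y hx hy; exact: (ed_lin a hx.2 hy.2).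
- by move=> k x hx; exact: (ed_ed hx.2).
- move=> k x hx; apply: (etrans (ed_wp L Rr w2.2 hx.2)).
  have -> : egr omega = omega.
    by apply/funext => y; rewrite /egr (gr_alt (w2.1 y)) sqrrN expr1n scale1r.
  have -> : ed omega = 0 by rewrite -dlambda; exact: ed_ed lambda1.2.
  apply/funext => y; apply/funext => s; rewrite !fctE /ewp (wp0l L) add0r.
  reflexivity.
- move=> k x hx; apply: (etrans (ed_wp L Rr lambda1.2 hx.2)).
  rewrite dlambda; congr (_ + _); apply/funext => y; apply/funext => s.
  by rewrite /ewp /egr (gr_alt (lambda1.1 y)) expr1 scaleN1r (wpNl L).
- move=> k x hx; apply/funext => y; apply/funext => s.
  have PL : linear Phi by move=> c u v; rewrite linearP.
  rewrite -[RHS]/(Phi (ed x y s)) /ed linear_sum; apply: eq_bigr => i _.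
  rewrite [RHS]linearZ; congr (_ *: _).
  exact: (vderive_lin _ PL (esmooth_vdiff _ _ hx.2)).
- move=> k x _; apply/funext => y.
  have E1 := wsc_comm (x y) (lambda1.1 y) (lambda1.1 y).
  have : wsc (lambda y) (wsc (lambda y) (x y)) *+ 2 = 0.
    by rewrite mulr2n {1}E1 muln1 expr1 scaleN1r addNr.
  move=> E2; apply/funext => s; have /(congr1 (fun f => f s)) := E2.
  rewrite mulr2n !fctE -mulr2n -scaler_nat => /eqP; rewrite scaler_eq0 pnatr_eq0.
  by move=> /eqP.
- move=> k x _; apply/funext => y.
  have := wsc_comm (x y) (lambda1.1 y) (w2.1 y).
  by rewrite mul1n sqrrN expr1n scale1r.
- by move=> x; exact: ewedge_emap.
- by move=> x; exact: ewedge_emap.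
- move=> k x hx dx; exists (cone k x); first exact: eOm_cone.
  exact: poincare_cone.
Qed.

End contraction_operator.

(** * Constant sections and closed forms of degree zero *)

Section constant_sections.
Context {R : realType} {m : nat} {V : vectType R}.
Notation E := 'rV[R]_m.
Notation X := (E -> seq E -> V).

Definition ecst (v : V) : X := fun _ s => if s is [::] then v else 0.

Lemma ecst_is_linear : linear ecst.
Proof.
move=> a u v; apply/funext => x; apply/funext => -[|w s].
  reflexivity.
exact: (esym (etrans (congr1 (+%R^~ 0) (scaler0 _ a)) (addr0 0))).
Qed.
HB.instance Definition _ := GRing.isLinear.Build R V X *:%R ecst ecst_is_linear.

Lemma ecst_inj : injective ecst.
Proof. by move=> u v /(congr1 (fun h => h 0 [::])). Qed.

Lemma eOm_ecst v : eOm 0 (ecst v).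
Proof. by split=> [//|[|w s]]; exact: vsmooth_cst. Qed.

Lemma ed_ecst v : ed (ecst v) = 0.
Proof.
apply/funext => x; apply/funext => s; rewrite /ed big1// => i _.
by rewrite [vderive _ _ _]vderive_cst scaler0.
Qed.

Lemma emap_ecst (f : 'End(V)) v : emap f (ecst v) = ecst (f v).
Proof.
by apply/funext => x; apply/funext => -[|w s]; rewrite /emap /ecst ?linear0.
Qed.

Lemma ewedge_ecst (a : @eform R m R^o) v : (fun x s => (a x s : R) *: v) = ewedge a (ecst v).
Proof.
apply/funext => x; apply/funext => s; rewrite /ewedge /ecst.
suff H (h : seq E -> R^o) (w : V) : wsc h (fun t => if t is [::] then w else 0) s =
  (h s : R) *: w by rewrite H.
elim: s h => [//|u s IHs] h; rewrite /wsc/= -!/(wsc _ _ _) (IHs (iota_ u h)).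
by rewrite [X in _ + X](wp0r (@scale_opr R V)) addr0.
Qed.

Lemma closed_form0 (h : X) : eOm 0 h -> ed h = 0 -> exists v, h = ecst v.
Proof.
move=> [h0 sh] dh; exists (h 0 [::]); apply/funext => x; apply/funext => -[|w s]; last first.
  by have := congr1 (fun g => g s) (h0 x w).
apply: vc_inj => i.
pose f (y : E) : R^o := vc i (h y [::]).
have sf : smooth_on setT f by have /vsmoothP/(_ i) := sh [::]; apply; exact: openT.
have df y : differentiable f y by exact: (sf 1%N).1.
have Df v y : 'D_v f y = 0.
  rewrite -vc_vderive; last exact: esmooth_vdiff.
  have := congr1 (fun g => g y [:: v]) dh.
  rewrite /ed big_ord1/= expr0 scale1r => ->.
  by rewrite /vc linear0 mxE.
have [c _] := MVT_line (f := f) (a := 0) (v := x) ltr01 (fun s _ => df _).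
rewrite Df mul0r scale1r addr0 => /eqP; rewrite subr_eq0 => /eqP.
exact.
Qed.

End constant_sections.

(** * Pullback *)

Section twist.
Context {R : realType} {m : nat} {W : vectType R}.
Notation E := 'rV[R]_m.
Implicit Types (h : seq E -> W) (s : seq E) (f b : E -> E).

(* The derivative of [h (map f s)] when the values of [f] vary with velocity [b]. *)
Fixpoint twist f b h s : W :=
  if s is u :: s' then h (b u :: map f s') + twist f b (iota_ (f u) h) s' else 0.

Lemma twist_lin f b (a : R) h1 h2 s :
  twist f b (a *: h1 + h2) s = a *: twist f b h1 s + twist f b h2 s.
Proof.
elim: s h1 h2 => [|u s IHs] h1 h2 /=; first by rewrite scaler0 addr0.
rewrite -[iota_ _ (_ + _)]/(a *: iota_ (f u) h1 + iota_ (f u) h2) IHs.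
by rewrite scalerDr addrACA.
Qed.

Lemma twist0 f b s : twist f b 0 s = 0.
Proof.
have E0 : 1 *: (0 : seq E -> W) + 0 = 0 by rewrite scaler0 addr0.
have := twist_lin f b 1 0 0 s; rewrite E0 scale1r; move: (twist _ _ _ _) => w.
by rewrite -[X in X = _]addr0 => /addrI <-.
Qed.

Lemma twist_sum f b (I : Type) (r : seq I) (a : I -> R) (h : I -> seq E -> W) s :
  twist f b (\sum_(i <- r) a i *: h i) s = \sum_(i <- r) a i *: twist f b (h i) s.
Proof.
elim: r => [|i r IHr]; first by rewrite !big_nil twist0.
by rewrite !big_cons twist_lin IHr.
Qed.

Lemma rem_atS (u : E) s i : rem_at i.+1 (u :: s) = u :: rem_at i s.
Proof. by []. Qed.

Lemma rem_at0 (u : E) s : rem_at 0 (u :: s) = s.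
Proof. by rewrite /rem_at take0 drop1. Qed.

Lemma twist_front f b k h s : alt k h ->
  twist f b h s = \sum_(i < size s) (-1) ^+ i *: h (b s`_i :: map f (rem_at i s)).
Proof.
elim: s k h => [|u s IHs] k h ah /=; first by rewrite big_ord0.
rewrite big_ord_recl expr0 scale1r rem_at0; congr (_ + _).
rewrite (IHs _ _ (alt_iota (f u) ah)); apply: eq_bigr => i _.
rewrite ?lift0 exprS mulN1r scaleNr -scalerN; congr (_ *: _).
exact: (congr1 (fun g => g (map f (rem_at i s))) (alt_swap _ _ ah)).
Qed.

(* With [B] the second derivative of [phi]: these are the terms by which
   [d (phi^* eta)] could differ from [phi^* (d eta)]. *)
Lemma twist_cancel f (B : E -> E -> E) k h s : alt k h ->
  (forall u v, B u v = B v u) ->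
  \sum_(i < size s) (-1) ^+ i *: twist f (B s`_i) h (rem_at i s) = 0.
Proof.
move=> + Bs; elim: s k h => [|u s IHs] k h ah; first by rewrite big_ord0.
rewrite big_ord_recl expr0 scale1r rem_at0.
have Eu i : twist f (B s`_i) h (u :: rem_at i s) =
  h (B u s`_i :: map f (rem_at i s)) + twist f (B s`_i) (iota_ (f u) h) (rem_at i s).
  by rewrite /= Bs.
rewrite (eq_bigr (fun i : 'I_(size s) => - ((-1) ^+ i *: h (B u s`_i :: map f (rem_at i s)))
   - (-1) ^+ i *: twist f (B s`_i) (iota_ (f u) h) (rem_at i s))) => [|i _]; last first.
  by rewrite lift0 rem_atS [nth _ _ _]/= Eu exprS mulN1r scaleNr scalerDr opprD.
rewrite big_split/= !sumrN (IHs _ _ (alt_iota (f u) ah)) subr0.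
by rewrite (twist_front f (B u) s ah) subrr.
Qed.

End twist.

Section pullback.
Context {R : realType} {m : nat} {W : vectType R}.
Notation E := 'rV[R]_m.
Variables (D D' : set E) (phi : E -> E) (theta : @eform R m W) (k : nat).
Hypothesis oD : open D.
Hypothesis oD' : open D'.
Hypothesis sphi : smooth_on D phi.
Hypothesis phiD : forall x, D x -> D' (phi x).
Hypothesis atheta : forall y, D' y -> alternating_form k (theta y).
Hypothesis stheta : forall s, vsmooth_on D' (fun y => theta y s).

Definition pull (x : E) (s : seq E) : W := theta (phi x) (map ('d phi x) s).

Let dphi x : D x -> differentiable phi x.
Proof. by have [H _] := sphi 1; exact: H. Qed.

Lemma smooth_dir v : smooth_on D ('D_v phi).
Proof. by move=> j; have [_ H] := sphi j.+1; exact: H. Qed.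

Lemma vsmooth_diff_coord v i : vsmooth_on D (fun x => ('d phi x v) ord0 i : R^o).
Proof.
apply: vsmooth_scalar => // j.
have /(Cn_on_row j _ oD)/(_ i) := smooth_dir v j.
by apply: Cn_on_eq => // x Dx; rewrite deriveE//; exact: dphi.
Qed.

(** A partial pullback: the arguments in [s1] are fixed vectors. By linearity each argument
    ['d phi x u] is traded for basis vectors moved into [s1], with smooth coefficients; this is what
    the inductions on [s] need. *)
Let pull_from s1 s x := theta (phi x) (s1 ++ map ('d phi x) s).

Let pull_from_cons s1 u s x : D x -> pull_from s1 (u :: s) x =
  \sum_i scale_op (('d phi x u) ord0 i : R^o) (pull_from (rcons s1 (ebasis i)) s x).
Proof.
move=> Dx; rewrite /pull_from /= (alternating_sum _ _ _ (atheta (phiD Dx))).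
by apply: eq_bigr => i _; rewrite cat_rcons.
Qed.

Let smooth_pull_from s1 s : vsmooth_on D (pull_from s1 s).
Proof.
elim: s s1 => [|u s IHs] s1.
  have := vsmooth_comp oD oD' phiD (stheta s1) sphi.
  by apply: vsmooth_eq => // x Dx; rewrite /pull_from cats0.
apply: (vsmooth_eq (f := fun x => \sum_i scale_op (('d phi x u) ord0 i : R^o)
    (pull_from (rcons s1 (ebasis i)) s x))) => // [x Dx|].
  by rewrite pull_from_cons.
apply: vsmooth_sum => // i.
exact: (vsmooth_bilin oD (@scale_opl R W) (@scale_opr R W)
  (vsmooth_diff_coord u i) (IHs _)).
Qed.

Lemma vsmooth_pull s : vsmooth_on D (fun x => pull x s).
Proof. exact: (smooth_pull_from [::] s). Qed.

Lemma vderive_near (f g : E -> W) x v : D x -> (forall y, D y -> f y = g y) ->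
  vderive v f x = vderive v g x.
Proof. by move=> Dx fg; apply: vderive_eq; exact: open_near_eq fg. Qed.

Let B x v u : E := 'D_v ('D_u phi) x.

Let Bsym x u v : D x -> B x u v = B x v u.
Proof.
move=> Dx; apply/rowP => i; rewrite /B.
have dw w : differentiable ('D_w phi) x by have [H _] := smooth_dir w 1; exact: H.
have E1 w z : ('D_w ('D_z phi) x) ord0 i = 'D_w ('D_z (fun y => phi y ord0 i : R^o)) x.
  rewrite derive_row_coord; last exact: diff_derivable.
  apply: near_eq_derive; apply: (open_near_eq oD Dx) => y Dy.
  by apply: derive_row_coord; apply: diff_derivable; exact: dphi.
apply: (etrans (E1 _ _)); apply: (etrans _ (esym (E1 _ _))).
have /(Cn_on_row 2 _ oD)/(_ i) H := sphi 2.
exact: (@derive_comm _ _ D (fun y => phi y ord0 i : R^o) x v u oD Dx H).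
Qed.

(** The base point [phi x] and the arguments ['d phi x u] both move with [x]: the chain rule gives
    the first term, and the second derivative of [phi] gives the [twist]. *)
Let vderive_pull_from s1 s x v : D x ->
  vderive v (pull_from s1 s) x =
  vderive ('d phi x v) (fun y => theta y (s1 ++ map ('d phi x) s)) (phi x) +
  twist ('d phi x) (B x v) (fun t => theta (phi x) (s1 ++ t)) s.
Proof.
move=> Dx; elim: s s1 => [|u s IHs] s1.
  rewrite /= addr0 (vderive_near (g := (fun y => theta y s1) \o phi) _ Dx); last first.
    by move=> y Dy; rewrite /pull_from cats0.
  rewrite vderive_comp; [|exact: dphi|exact: vsmooth_vdiff (stheta s1) (phiD Dx)].
  by rewrite deriveE ?cats0//; exact: dphi.
rewrite (vderive_near (g := fun x => \sum_i scale_op (('d phi x u) ord0 i : R^o)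
    (pull_from (rcons s1 (ebasis i)) s x)) _ Dx); last first.
  by move=> y Dy; exact: pull_from_cons.
have dc i : vdiff (fun x => ('d phi x u) ord0 i : R^o) x.
  exact: vsmooth_vdiff (vsmooth_diff_coord u i) Dx.
have dp i : vdiff (pull_from (rcons s1 (ebasis i)) s) x.
  exact: vsmooth_vdiff (smooth_pull_from _ s) Dx.
have db i := vdiff_bilin (@scale_opl R W) (@scale_opr R W) (dc i) (dp i).
rewrite (vderive_sum _ v db).2.
have EB i : vderive v (fun x => ('d phi x u) ord0 i : R^o) x = (B x v u) ord0 i.
  rewrite vderive_scalar//.
  have Dd : differentiable ('D_u phi) x by have [H _] := smooth_dir u 1; exact: H.
  rewrite /B derive_row_coord; last exact: diff_derivable.
  apply: near_eq_derive; apply: (open_near_eq oD Dx) => y Dy.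
  by rewrite deriveE//; exact: dphi.
rewrite (eq_bigr (fun i =>
    (B x v u) ord0 i *: theta (phi x) (rcons s1 (ebasis i) ++ map ('d phi x) s) +
    (('d phi x u) ord0 i *: vderive ('d phi x v) (fun y =>
        theta y (rcons s1 (ebasis i) ++ map ('d phi x) s)) (phi x) +
     ('d phi x u) ord0 i *: twist ('d phi x) (B x v)
       (fun t => theta (phi x) (rcons s1 (ebasis i) ++ t)) s))) => [|i _]; last first.
  rewrite (vderive_bilin v (@scale_opl R W) (@scale_opr R W) (dc i) (dp i)) EB IHs.
  by rewrite -scalerDr.
have at_ := atheta (phiD Dx).
rewrite !big_split/= addrCA; congr (_ + _).
  have sL (c : R) : linear (fun w : W => c *: w).
    by move=> a w z; rewrite scalerDr !scalerA mulrC.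
  have dt i : vdiff (fun y => theta y (rcons s1 (ebasis i) ++ map ('d phi x) s)) (phi x).
    exact: vsmooth_vdiff (stheta _) (phiD Dx).
  have dZ i := vdiff_lin (sL (('d phi x u) ord0 i)) (dt i).
  have nE : \forall y \near phi x,
      theta y (s1 ++ 'd phi x u :: map ('d phi x) s) =
      \sum_i (('d phi x u) ord0 i *: theta y (rcons s1 (ebasis i) ++ map ('d phi x) s)).
    apply: (open_near_eq oD' (phiD Dx)) => y Dy.
    rewrite (alternating_sum _ _ _ (atheta Dy)); apply: eq_bigr => i _.
    by rewrite cat_rcons.
  rewrite [RHS](vderive_eq _ nE) (vderive_sum _ _ dZ).2; apply: eq_bigr => i _.
  exact: (esym (vderive_lin _ (sL _) (dt i))).
congr (_ + _).
  by rewrite (alternating_sum _ _ _ at_); apply: eq_bigr => i _; rewrite cat_rcons.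
rewrite -twist_sum; congr twist; apply/funext => t.
rewrite fct_sumE /iota_ (alternating_sum _ _ _ at_).
by apply: eq_bigr => i _; rewrite !fctE cat_rcons.
Qed.

Lemma ed_pull x s : D x -> ed pull x s = ed theta (phi x) (map ('d phi x) s).
Proof.
move=> Dx; have at_ := atheta (phiD Dx).
rewrite /ed size_map.
rewrite (eq_bigr (fun i : 'I_(size s) =>
  (-1) ^+ i *: vderive ('d phi x s`_i) (fun y => theta y (map ('d phi x) (rem_at i s))) (phi x) +
  (-1) ^+ i *: twist ('d phi x) (B x s`_i) (theta (phi x)) (rem_at i s))) => [|i _]; last first.
  by rewrite -scalerDr; congr (_ *: _); exact: (vderive_pull_from [::] _ _ Dx).
rewrite big_split/= (@twist_cancel _ _ _ ('d phi x) (B x) k); first last.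
- by move=> u v; exact: Bsym.
- exact/alt_alternating.
rewrite addr0; apply: eq_bigr => i _; rewrite (nth_map 0 _ _ (ltn_ord i)).
by rewrite /rem_at map_cat map_take map_drop.
Qed.

End pullback.

(** * Forms on an open set diffeomorphic to Euclidean space *)

Section manifold_facts.
Context {R : realType} {m : nat} (M : manifold R m).
Implicit Types (p q : M).

Lemma open_cdom q : open (cdom q).
Proof. by case: M q. Qed.

Lemma cdom_self q : cdom q q.
Proof. by case: M q. Qed.

Lemma open_chart q : open (cmap q @` cdom q).
Proof. by case: M q. Qed.

Lemma cmapK q p : cdom q p -> cinv q (cmap q p) = p.
Proof. by case: M q p. Qed.

Lemma cinv_continuous q x : (cmap q @` cdom q) x -> {for x, continuous (cinv q)}.
Proof. by case: M q x. Qed.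

Lemma transition_smooth q q' :
  smooth_on (cmap q @` (cdom q `&` cdom q')) (cmap q' \o cinv q).
Proof. by case: M q q'. Qed.

Lemma open_chart_image q (A : set M) : open A -> open (cmap q @` (A `&` cdom q)).
Proof.
move=> oA; rewrite openE => _ [p [Ap qp] <-].
have qy : (cmap q @` cdom q) (cmap q p) by exists p.
have n1 := open_nbhs_nbhs (conj (@open_chart q) qy).
have n2 : nbhs (cmap q p) (cinv q @^-1` A).
  by apply: (cinv_continuous qy); apply: open_nbhs_nbhs; split; rewrite ?cmapK.
apply: filterS2 n1 n2 => _ [p' qp' <-] /=.
by rewrite cmapK// => Ap'; exists p'.
Qed.

End manifold_facts.

Section chain.
Context {R : realType}.

Lemma diff_chain (U V W : normedModType R) (f : V -> W) (g : U -> V) (h : U -> W) x v :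
  (\forall y \near x, f (g y) = h y) -> differentiable g x ->
  differentiable f (g x) -> 'd h x v = 'd f (g x) ('d g x v).
Proof.
move=> fgh dg df.
have [_ ->] := near_eq_diff (f := f \o g) fgh (differentiable_comp dg df).
by rewrite diff_comp.
Qed.

Lemma diff_idE (U : normedModType R) (x v : U) : 'd (@id U) x v = v.
Proof. by have -> : 'd (@id U) x = id :> (U -> U) by exact: diff_val. Qed.

Lemma smooth_differentiable (U W : normedModType R) (D : set U) (f : U -> W) x :
  smooth_on D f -> D x -> differentiable f x.
Proof. by move=> /(_ 1%N)[H _] Dx; exact: H. Qed.

Lemma map_comp_eq (A B C : Type) (f : A -> C) (g : B -> C) (h : A -> B) s :
  (forall v, f v = g (h v)) -> map f s = map g (map h s).
Proof. by move=> E1; rewrite -map_comp; exact: eq_map. Qed.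

Lemma open_preimage (S T : topologicalType) (f : S -> T) (A : set T) :
  continuous f -> open A -> open (f @^-1` A).
Proof. by move=> /continuousP; exact. Qed.

End chain.

Section transfer.
Context {R : realType} {m : nat} {M : manifold R m}.
Notation E := 'rV[R]_m.
Variables (U : set M) (psi : M -> E) (chi : E -> M).
Hypothesis openU : open U.
Hypothesis Uchi : forall x, U (chi x).
Hypothesis chiK : forall x, psi (chi x) = x.
Hypothesis psiK : forall p, U p -> chi (psi p) = p.
Hypothesis cchi : continuous chi.
Hypothesis schi : forall q, smooth_on (chi @^-1` cdom q) (cmap q \o chi).
Hypothesis spsi : forall q, smooth_on (cmap q @` (U `&` cdom q)) (psi \o cinv q).

Let D q := chi @^-1` cdom q.
Let I_ q := cmap q @` (U `&` cdom q).
Let oD q : open (D q).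
Proof. by apply: open_preimage => //; exact: open_cdom. Qed.
Let oI q : open (I_ q).
Proof. exact: open_chart_image. Qed.
Let phi q := cmap q \o chi.
Let psq q := psi \o cinv q.

(** The differential of [chi] at [x], its values being read in the chart [cmap (chi x)] through
    which the tangent space at [chi x] is identified with ['rV_m]. Thus [transfer] is the pullback
    by [chi]. *)
Definition tan x : {linear E -> E} := 'd (cmap (chi x) \o chi) x.
Definition cotan x : {linear E -> E} :=
  'd (psi \o cinv (chi x)) (cmap (chi x) (chi x)).
Definition transfer W (eta : mform M W) : E -> seq E -> W :=
  fun x s => eta (chi x) (map (tan x) s).

Let Dself x : D (chi x) x. Proof. exact: cdom_self. Qed.

Let phiI q x : D q x -> I_ q (phi q x).
Proof. by move=> Dx; exists (chi x). Qed.

Let dphi q x : D q x -> differentiable (phi q) x.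
Proof. by move=> Dx; exact: smooth_differentiable (schi q) Dx. Qed.

Let dpsi q y : I_ q y -> differentiable (psq q) y.
Proof. by move=> Iy; exact: smooth_differentiable (spsi q) Iy. Qed.

Lemma tanK x v : cotan x (tan x v) = v.
Proof.
rewrite /cotan /tan.
have nE : \forall y \near x, psq (chi x) (phi (chi x) y) = id y.
  apply: (@open_near_eq R _ _ (D (chi x)) (psq (chi x) \o phi (chi x)) id x) => [||y Dy]; [exact: oD|exact: Dself|].
  by rewrite /psq /phi/= cmapK.
have H := diff_chain (h := id) v nE (dphi (Dself x)) (dpsi (phiI (Dself x))).
exact: (etrans (esym H) (diff_idE x v)).
Qed.

Lemma cotanK x v : tan x (cotan x v) = v.
Proof.
rewrite /cotan /tan; set p := chi x.
have Iy : I_ p (phi p x) := phiI (Dself x).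
have nE : \forall y \near phi p x, phi p (psq p y) = id y.
  apply: (@open_near_eq R _ _ (I_ p) (phi p \o psq p) id) => [||_ [p' [Up' qp'] <-]]; [exact: oI|exact: Iy|].
  by rewrite /psq /phi/= cmapK// psiK.
have xE : psq p (phi p x) = x by rewrite /psq /phi /= cmapK ?chiK//; exact: cdom_self.
have H := diff_chain (h := id) (f := phi p) v nE (dpsi Iy).
rewrite xE in H; have {}H := H (dphi (Dself x)).
exact: (etrans (esym H) (diff_idE _ v)).
Qed.

Lemma transfer_eq W (eta theta : mform M W) :
  transfer eta = transfer theta <-> eq_on U eta theta.
Proof.
split=> [E1 p Up|E1]; last first.
  by apply/funext => x; apply/funext => s; rewrite /transfer E1.
apply/funext => s; have := congr1 (fun f => f (psi p) (map (cotan (psi p)) s)) E1.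
rewrite /transfer psiK// -map_comp map_id_in => // v _.
exact: cotanK.
Qed.

Definition untransfer W (theta : E -> seq E -> W) : mform M W :=
  fun p s => theta (psi p) (map (cotan (psi p)) s).

Lemma untransferK W (theta : E -> seq E -> W) : transfer (untransfer theta) = theta.
Proof.
apply/funext => x; apply/funext => s; rewrite /transfer /untransfer chiK -map_comp.
by rewrite map_id_in => // v _; exact: tanK.
Qed.

(** The chart used by [transfer] changes with [x]. Expressing it through one fixed chart [q], by the
    chain rule with the transition map, makes the results on [pull] applicable near a point. *)
Lemma transfer_chart (W : vectType R) (eta : mform M W) q x s : D q x ->
  transfer eta x s = pull (phi q) (in_chart q eta) x s.
Proof.
move=> Dx; have pE : cinv q (phi q x) = chi x := cmapK Dx.
have Jq v : tan x v = 'd (cmap (chi x) \o cinv q) (phi q x) ('d (phi q) x v).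
  apply: (diff_chain (f := cmap (chi x) \o cinv q)); last 2 first.
  - exact: dphi.
  - apply: (smooth_differentiable (@transition_smooth _ _ M q (chi x))).
    by exists (chi x) => //; split => //; exact: cdom_self.
  apply: (@open_near_eq R _ _ (D q) ((cmap (chi x) \o cinv q) \o phi q)
    (cmap (chi x) \o chi)) => [||y Dy]; [exact: oD|exact: Dx|].
  by rewrite /phi/= cmapK.
rewrite /pull /in_chart pE -map_comp /transfer; congr (eta (chi x) _).
apply: eq_map => v; exact: Jq.
Qed.

Lemma chart_transfer (W : vectType R) (eta : mform M W) q y s : I_ q y ->
  in_chart q eta y s = pull (psq q) (transfer eta) y s.
Proof.
move=> Iy; have [p [Up qp] yE] := Iy.
have pE : cinv q y = p by rewrite -yE cmapK.
have xE : psq q y = psi p by rewrite /psq/= pE.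
have cE : chi (psq q y) = p by rewrite xE psiK.
have Jq v : 'd (cmap p \o cinv q) y v = 'd (cmap p \o chi) (psq q y) ('d (psq q) y v).
  apply: (diff_chain (f := cmap p \o chi)).
  - apply: (@open_near_eq R _ _ (I_ q) ((cmap p \o chi) \o psq q)
      (cmap p \o cinv q)) => [||_ [p' [Up' qp'] <-]]; [exact: oI|exact: Iy|].
    by rewrite /psq/= cmapK// psiK.
  - exact: dpsi.
  - apply: (smooth_differentiable (schi p)).
    by rewrite /preimage/= cE; exact: cdom_self.
have tE t : transfer eta (psq q y) t = eta p (map ('d (cmap p \o chi) (psq q y)) t).
  by rewrite /transfer /tan cE.
have iE : in_chart q eta y s = eta p (map ('d (cmap p \o cinv q) y) s).
  by rewrite /in_chart pE.
have mE : map ('d (cmap p \o cinv q) y) s =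
    map ('d (cmap p \o chi) (psq q y)) (map ('d (psq q) y) s).
  exact: (map_comp_eq s Jq).
rewrite iE mE -tE.
reflexivity.
Qed.

Lemma alternating_map (W : vectType R) k (h : seq E -> W) (f : {linear E -> E}) :
  alternating_form k h -> alternating_form k (fun s => h (map f s)).
Proof.
move=> [sz lin al]; split.
- by move=> s ss; rewrite sz ?size_map.
- by move=> s1 s2 a u v; rewrite !map_cat/= linearP lin.
- by move=> s1 s2 s3 u; rewrite !map_cat/= !map_cat/= al.
Qed.

Lemma in_chart_alternating (W : vectType R) k (beta : mform M W) q y :
  (forall p, U p -> alternating_form k (beta p)) -> I_ q y ->
  alternating_form k (in_chart q beta y).
Proof.
move=> ab [p [Up qp] <-]; apply: (@alternating_map W k (beta _)).
by rewrite cmapK//; exact: ab.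
Qed.

Lemma Omega_transfer (W : vectType R) k (beta : mform M W) :
  Omega U k beta <-> eOm k (transfer beta).
Proof.
split=> [[ab sb]|[ab sb]].
  split=> [x|s].
    by apply/alt_alternating; apply: alternating_map; exact: ab.
  apply: vsmooth_local => x _; exists (D (chi x)); first exact: Dself.
  have := vsmooth_pull (@oD (chi x)) (@oI (chi x)) (schi (chi x)) (@phiI (chi x))
    (fun y => @in_chart_alternating W k beta (chi x) y ab) (sb (chi x)) s.
  by apply: vsmooth_eq => // x' Dx'; rewrite (transfer_chart _ _ Dx').
split=> [p Up|q s].
  have -> : beta p = fun s => transfer beta (psi p) (map (cotan (psi p)) s).
    by apply/funext => s; rewrite -[beta p s]/(beta p s) -[transfer _ _ _]/(beta _ _)
      psiK// -map_comp map_id_in// => v _; exact: cotanK.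
  by apply: alternating_map; apply/alt_alternating; exact: ab.
have := vsmooth_pull (@oI q) openT (spsi q) (fun _ _ => Logic.I)
  (fun y _ => (alt_alternating _ _).1 (ab y)) sb s.
by apply: vsmooth_eq => // y Iy; rewrite (chart_transfer _ _ Iy).
Qed.

Lemma transfer_dext (W : vectType R) k (beta : mform M W) : Omega U k beta ->
  transfer (dext beta) = ed (transfer beta).
Proof.
move=> [ab sb]; apply/funext => x; apply/funext => s; set p := chi x.
have Dx : D p x by exact: Dself.
have := ed_pull (@oD p) (@oI p) (schi p) (@phiI p)
  (fun y => @in_chart_alternating W k beta p y ab) (sb p) s Dx.
move=> E1; apply: (etrans (esym E1)); rewrite /ed; apply: eq_bigr => i _.
congr (_ *: _); apply: vderive_eq; apply: (@open_near_eq R _ _ (D p)) => [||y Dy]; [exact: oD|exact: Dx|].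
by rewrite (transfer_chart _ _ Dy).
Qed.

End transfer.

(** * Linear algebra in the fibre *)

Section endomorphisms.
Context {R : realType} {V : vectType R}.

Lemma lker0_lfunK_eq (f : 'End(V)) v : lker f = 0%VS -> (f^-1)%VF (f v) = v.
Proof. by move=> /eqP/lker0_lfunK; exact. Qed.

Lemma lker0_lfunVK_eq (f : 'End(V)) v : lker f = 0%VS -> f ((f^-1)%VF v) = v.
Proof. by move=> /eqP/lker0_lfunVK; exact. Qed.

Lemma eval_linl (v : V) : linear (fun f : 'End(V) => f v).
Proof. by move=> a f g; rewrite add_lfunE scale_lfunE. Qed.

Lemma eval_linr (f : 'End(V)) : linear (fun v : V => f v).
Proof. by move=> a u v; rewrite linearP. Qed.

Lemma smooth_inverse (U : normedModType R) (D : set U) (F : U -> 'End(V))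
    (g : U -> V) : open D -> vsmooth_on D F -> (forall y, D y -> lker (F y) = 0%VS) ->
  vsmooth_on D g -> vsmooth_on D (fun y => ((F y)^-1)%VF (g y)).
Proof.
move=> oD sF F0 sg.
pose A y : 'M[R]_(dim V) := \matrix_(i, j) vc j (F y (vb i)).
have FA y w : v2r (F y w) = v2r w *m A y.
  apply/rowP => j; rewrite mxE -[LHS]/(vc j (F y w)) (vc_lin j w (eval_linr _)).
  by apply: eq_bigr => i _; rewrite mxE.
have uA y : D y -> A y \in unitmx.
  move=> Dy; rewrite -row_free_unit; apply: inj_row_free => u u0.
  have Fu : F y (r2v u) = 0 by apply: v2r_inj; rewrite FA r2vK u0 linear0.
  have := lker0_lfunK_eq (r2v u) (F0 y Dy); rewrite Fu linear0 => /(congr1 v2r).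
  by rewrite r2vK linear0.
have sA i j : smooth_on D (fun y => A y i j : R^o).
  have sFi := vsmooth_lin oD (eval_linl (vb i)) sF.
  have /vsmoothP/(_ j) := sFi => /(_ oD) H k.
  by apply: Cn_on_eq (H k) => // y Dy; rewrite mxE.
have sI := smooth_invmx oD sA uA.
apply/vsmoothP => // j k.
apply: (Cn_on_eq (f := fun y => \sum_i (vc i (g y) * invmx (A y) i j : R^o))) => // [y Dy|].
  have -> : vc j ((F y)^-1%VF (g y)) = (v2r (g y) *m invmx (A y)) ord0 j.
    by rewrite -[in RHS](lker0_lfunVK_eq (g y) (F0 y Dy)) FA mulmxK// uA.
  by rewrite mxE.
apply: Cn_on_sum => // i; apply: Cn_onM => //; last exact: sI.
by have /vsmoothP/(_ i) := sg => /(_ oD).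
Qed.

Lemma alternating_lin (m k : nat) (W : vectType R) (h : seq 'rV[R]_m -> V)
    (f : V -> W) : linear f -> alternating_form k h ->
  alternating_form k (fun s => f (h s)).
Proof.
move=> fL [sz lin al]; have f0 : f 0 = 0.
  have E0 : 1 *: (0 : V) + 0 = 0 by rewrite scaler0 addr0.
  have := fL 1 0 0; rewrite E0 scale1r; move: (f 0) => w.
  by rewrite -[X in X = _]addr0 => /addrI <-.
split.
- by move=> s ss; rewrite sz.
- by move=> s1 s2 a u v; rewrite lin fL.
- by move=> s1 s2 s3 u; rewrite al.
Qed.

End endomorphisms.

Section wedge_pullback.
Context {R : realType} {m : nat}.
Notation E := 'rV[R]_m.

Lemma wp_map (W1 W2 W : vectType R) (op : W1 -> W2 -> W) (f : E -> E) a b s :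
  wp_rec op (fun t => a (map f t)) (fun t => b (map f t)) s =
  wp_rec op a b (map f s).
Proof.
elim: s a b => [//|v s IHs] a b.
rewrite /= -(IHs (iota_ (f v) a) b) -(IHs (gr a) (iota_ (f v) b)).
congr (_ + wp_rec op _ _ s); apply/funext => t.
by rewrite /gr size_map.
Qed.

Lemma wp_eval_scalar (V : vectType R) (Phi : 'End(V)) (a : seq E -> R^o)
    (b : seq E -> V) s :
  wp_rec (fun (f : 'End(V)) v => f v) (fun t => (a t : R) *: Phi) b s =
  Phi (wsc a b s).
Proof.
elim: s a b => [|v s IHs] a b; first by rewrite /wsc/= /scale_op scale_lfunE linearZ.
transitivity (Phi (wsc (iota_ v a) b s) + Phi (wsc (gr a) (iota_ v b) s)); last first.
  exact: (esym (linearD Phi _ _)).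
rewrite -(IHs (iota_ v a) b) -(IHs (gr a) (iota_ v b)) /=.
congr (_ + wp_rec _ _ _ s); apply/funext => t.
by rewrite /gr scalerA.
Qed.

End wedge_pullback.

(** * Frames *)

Section frames.
Context {R : realType} {m : nat} {M : manifold R m} {V : vectType R}.
Variables (E : vbundle M V) (U : set M) (e : M -> 'End(V)).
Hypothesis openU : open U.
Hypothesis frame_e : frame E U e.

Lemma open_tdom q : open (tdom E q).
Proof. by case: E q. Qed.

Lemma tdom_self q : tdom E q q.
Proof. by case: E q. Qed.

Lemma triv_ker q p : tdom E q p -> lker (triv E q p) = 0%VS.
Proof. by case: E q p. Qed.

Definition unframe (eta : mform M V) : mform M V :=
  endo_act (fun p => ((e p)^-1)%VF) eta.

Lemma unframeK eta : eq_on U (endo_act e (unframe eta)) eta.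
Proof.
move=> p Up; apply/funext => s; rewrite /endo_act /unframe/= /endo_act.
exact: lker0_lfunVK_eq (frame_e.1 p Up).
Qed.

Lemma frameK beta : eq_on U (unframe (endo_act e beta)) beta.
Proof.
move=> p Up; apply/funext => s; rewrite /unframe /endo_act.
exact: lker0_lfunK_eq (frame_e.1 p Up).
Qed.

Let G q p := (triv E q p \o e p)%VF.

Let G_ker q p : U p -> tdom E q p -> lker (G q p) = 0%VS.
Proof.
move=> Up tp; apply/eqP/lker0P => u v; rewrite !comp_lfunE => E1.
rewrite -(lker0_lfunK_eq u (frame_e.1 p Up)) -(lker0_lfunK_eq v (frame_e.1 p Up)).
congr ((e p)^-1 _)%VF.
by rewrite -(lker0_lfunK_eq (e p u) (triv_ker tp)) E1 lker0_lfunK_eq// triv_ker.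
Qed.

Let oI q (A : set M) : open A -> open (cmap q @` (A `&` cdom q)).
Proof. exact: open_chart_image. Qed.

Let oUt q : open (U `&` tdom E q).
Proof. by apply: openI => //; exact: open_tdom. Qed.

Let sG q q' : vsmooth_on (cmap q' @` ((U `&` tdom E q) `&` cdom q'))
  (fun y => G q (cinv q' y)).
Proof. by have [_ /(_ q' [::])] := frame_e.2 q. Qed.

(** Near a point, the components in a local trivialization and those in the frame differ by
    [G = triv o e], which is smooth by definition of a frame and has a smooth inverse by
    [smooth_inverse]. *)
Lemma OmegaE_unframe k (eta : mform M V) :
  OmegaE E U k eta <-> Omega U k (unframe eta).
Proof.
split=> [H|[ab sb] q].
  split=> [p Up|q s].
    have [/(_ p (conj Up (tdom_self p))) ap _] := H p.
    have tp := triv_ker (tdom_self p).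
    have -> : unframe eta p = fun s => ((e p)^-1)%VF (((triv E p p)^-1)%VF
        (endo_act (triv E p) eta p s)).
      by apply/funext => s; rewrite /endo_act lker0_lfunK_eq.
    apply: (alternating_lin (eval_linr _)).
    exact: (alternating_lin (eval_linr _) ap).
  apply: vsmooth_local => _ [p [Up qp] <-].
  exists (cmap q @` ((U `&` tdom E p) `&` cdom q)).
    by exists p => //; split => //; split => //; exact: tdom_self.
  have oD := @oI q _ (@oUt p).
  have [_ /(_ q s) sp] := H p.
  have F0 y : (cmap q @` ((U `&` tdom E p) `&` cdom q)) y -> lker (G p (cinv q y)) = 0%VS.
    by move=> [p' [[Up' tp'] qp'] <-]; rewrite cmapK//; exact: G_ker.
  have := smooth_inverse oD (sG p q) F0 sp.
  apply: vsmooth_eq => // _ [p' [[Up' tp'] qp'] <-].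
  rewrite /in_chart cmapK// /unframe /endo_act.
  set w := eta p' _; rewrite -{1}(lker0_lfunVK_eq w (frame_e.1 p' Up')).
  rewrite -[triv E p p' (e p' _)]/(triv E p p' (e p' _)) -comp_lfunE.
  exact: lker0_lfunK_eq (G_ker Up' tp').
have etaE p : U p -> eta p = endo_act e (unframe eta) p.
  by move=> Up; exact: (esym (unframeK _ Up)).
split=> [p [Up tp]|q' s].
  have -> : endo_act (triv E q) eta p = fun s => triv E q p (e p (unframe eta p s)).
    by apply/funext => s; rewrite /endo_act etaE.
  apply: (alternating_lin (eval_linr _)).
  exact: (alternating_lin (eval_linr _) (ab p Up)).
have oD := @oI q' _ (@oUt q).
have sb' : vsmooth_on (cmap q' @` ((U `&` tdom E q) `&` cdom q'))
    (fun y => in_chart q' (unframe eta) y s).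
  apply: vsmooth_sub (sb q' s) => _ [p [[Up tp] qp] <-].
  by exists p.
have := vsmooth_bilin oD eval_linl eval_linr (sG q q') sb'.
apply: vsmooth_eq => // _ [p [[Up tp] qp] <-].
by rewrite /in_chart cmapK// comp_lfunE /endo_act etaE.
Qed.

(** [flat_frame] describes [dA] on forms [endo_act e beta] only, and an arbitrary form agrees with
    one of these merely on [U]. As [U] is open, this determines the germs entering the
    derivative. *)
Lemma dA_local (A : connection E) (eta theta : mform M V) : eq_on U eta theta ->
  eq_on U (dA A eta) (dA A theta).
Proof.
move=> E1 p Up; apply/funext => s; rewrite /dA; congr ((triv E p p)^-1 _)%VF.
apply: (congr2 +%R).
  rewrite /dext; apply: eq_bigr => i _; congr (_ *: _); apply: vderive_eq.
  have Iy : (cmap p @` (U `&` cdom p)) (cmap p p) by exists p => //; split => //; exact: cdom_self.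
  apply: (@open_near_eq R _ _ (cmap p @` (U `&` cdom p))) => [||_ [p' [Up' qp'] <-]].
  - exact: oI.
  - exact: Iy.
  - by rewrite /in_chart cmapK// /endo_act E1.
rewrite /wedgeE /wedgef; apply: eq_bigr => C _; congr (_ *: _).
by rewrite /endo_act E1.
Qed.

End frames.

(** * The complex in a flat frame *)

Section flat_bundle.
Context {R : realType} {n : nat} {M : manifold R n.*2} {V : vectType R}.
Notation E := 'rV[R]_(n.*2).
Notation X := (E -> seq E -> V).
Variables (omega : mform M R^o) (Bd : vbundle M V) (A : connection Bd).
Variables (Phi : M -> 'End(V)) (U : set M) (e : M -> 'End(V)) (Phi0 : 'End(V)).
Variables (lambda : mform M R^o) (psi : M -> E) (chi : E -> M).
Hypothesis n_gt0 : (0 < n)%N.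
Hypothesis omegaS : symplectic omega.
Hypothesis openU : open U.
Hypothesis Uchi : forall x, U (chi x).
Hypothesis chiK : forall x, psi (chi x) = x.
Hypothesis psiK : forall p, U p -> chi (psi p) = p.
Hypothesis cchi : continuous chi.
Hypothesis schi : forall q, smooth_on (chi @^-1` cdom q) (cmap q \o chi).
Hypothesis spsi : forall q, smooth_on (cmap q @` (U `&` cdom q)) (psi \o cinv q).
Hypothesis lambda1 : Omega U 1 lambda.
Hypothesis dlambda : eq_on U (dext lambda) omega.
Hypothesis flatF : flat_frame A Phi U e Phi0 lambda.

Let frame_e : frame Bd U e. Proof. by case: flatF. Qed.

Let om : @eform R n.*2 R^o := transfer chi omega.
Let la : @eform R n.*2 R^o := transfer chi lambda.
Let tr_eq W (eta theta : mform M W) :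
  transfer chi eta = transfer chi theta <-> eq_on U eta theta :=
  transfer_eq openU Uchi chiK psiK schi spsi eta theta.
Let Om_tr (W : vectType R) k (beta : mform M W) :
  Omega U k beta <-> eOm k (transfer chi beta) :=
  Omega_transfer openU Uchi chiK psiK cchi schi spsi k beta.
Let tr_dext (W : vectType R) k (beta : mform M W) : Omega U k beta ->
  transfer chi (dext beta) = ed (transfer chi beta) :=
  @transfer_dext _ _ _ U chi openU Uchi cchi schi W k beta.

Let la1 : eOm 1 la. Proof. exact/Om_tr. Qed.

Let dla : ed la = om.
Proof. by rewrite /la -(tr_dext lambda1); exact/tr_eq. Qed.

Let om_nondeg x u : (forall v, om x [:: u; v] = 0) -> u = 0.
Proof.
move=> H; have [_ _ nd] := omegaS.
have tu : tan chi x u = 0.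
  apply: (nd (chi x)) => v.
  rewrite -(cotanK openU Uchi chiK psiK schi spsi x v).
  exact: H.
have E1 := tanK Uchi chiK cchi schi spsi x u.
have E2 := congr1 (cotan psi chi x) tu.
have E3 : cotan psi chi x 0 = 0 := linear0 (cotan psi chi x).
exact: (etrans (esym E1) (etrans E2 E3)).
Qed.

Let L : {linear X -> X} := ewedge om.
Let ell : {linear X -> X} := ewedge la.
Let Ph : {linear X -> X} := emap Phi0.
Let Lam : {linear X -> X} := econtract om.
Let C : symplectic_complex n (@eOm R n.*2 V) L Lam ell Ph (@ed R n.*2 V) :=
  @model_complex R n V om la Phi0 la1 dla om_nondeg.

(** The components of [eta] in the frame, pulled back to Euclidean space. It is onto, its fibres are
    the classes of [eq_on U], and it carries the operators of the bundle to those of the model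
    complex. *)
Let S (eta : mform M V) : X := transfer chi (unframe e eta).

Let S_eq eta theta : S eta = S theta <-> eq_on U eta theta.
Proof.
split=> [/tr_eq E1 p Up|E1].
  rewrite -(unframeK frame_e eta Up) -(unframeK frame_e theta Up).
  by apply/funext => s; rewrite /endo_act E1.
by apply/tr_eq => p Up; apply/funext => s; rewrite /unframe /endo_act E1.
Qed.

Let SP (a : R) eta theta : S (a *: eta + theta) = a *: S eta + S theta.
Proof.
apply/funext => x; apply/funext => s.
rewrite /S /transfer /unframe /endo_act.
by rewrite -[(a *: eta + theta) _ _]/(a *: eta _ _ + theta _ _) linearP.
Qed.

Let S0 : S 0 = 0.
Proof. by apply/funext => x; apply/funext => s; exact: linear0. Qed.

Let SD eta theta : S (eta + theta) = S eta + S theta.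
Proof. by have := SP 1 eta theta; rewrite !scale1r. Qed.

Let SN eta : S (- eta) = - S eta.
Proof. by have := SP (-1) eta 0; rewrite S0 !addr0 !scaleN1r. Qed.

Let SB eta theta : S (eta - theta) = S eta - S theta.
Proof. by rewrite SD SN. Qed.

Let S_lin (f : V -> mform M V) (g : V -> X) a u v : (forall w, S (f w) = g w) ->
  linear g -> S (f (a *: u + v) - (a *: f u + f v)) = 0.
Proof. by move=> fE gL; rewrite SB SP !fE gL; exact: subrr. Qed.

Let S_eq0 eta : S eta = 0 <-> eq_on U eta 0.
Proof. by rewrite -S0; exact: S_eq. Qed.

Let S_surj (theta : X) : exists eta, S eta = theta.
Proof.
exists (endo_act e (untransfer psi chi theta)).
rewrite -[RHS](untransferK Uchi chiK cchi schi spsi theta).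
by apply/tr_eq; exact: frameK frame_e _.
Qed.

Let S_Om k eta : OmegaE Bd U k eta <-> eOm k (S eta).
Proof. by rewrite (OmegaE_unframe openU frame_e) Om_tr. Qed.

Let S_wedge eta : S (wedges omega eta) = L (S eta).
Proof.
apply/funext => x; apply/funext => s; rewrite /S /transfer /unframe /endo_act.
rewrite -[wedges omega eta (chi x)]/(wedgef (@scale_op R V) omega eta (chi x)).
rewrite (wedgef_wp (@scale_opl R V)) -/(wsc _ _ _).
rewrite -(wsc_map _ _ _ (eval_linr _)).
exact: (esym (wp_map (@scale_op R V) (tan chi x) (omega (chi x)) _ s)).
Qed.

Let S_Phi eta : S (endo_act Phi eta) = Ph (S eta).
Proof.
apply/funext => x; apply/funext => s; rewrite /S /transfer /unframe /endo_act.
have [fr Pe _] := flatF; have e0 := fr.1 _ (Uchi x).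
rewrite -[RHS]/(Phi0 ((e (chi x))^-1%VF (eta (chi x) (map (tan chi x) s)))).
set w := eta _ _.
have E1 u : Phi (chi x) (e (chi x) u) = e (chi x) (Phi0 u).
  by rewrite -!comp_lfunE Pe.
have := E1 ((e (chi x))^-1%VF w); rewrite (lker0_lfunVK_eq w e0) => ->.
exact: lker0_lfunK_eq e0.
Qed.

Let S_dA k eta : OmegaE Bd U k eta -> S (dA A eta) = cov ell Ph (@ed R n.*2 V) (S eta).
Proof.
move=> H; have [_ _ fl] := flatF.
have Hb := (OmegaE_unframe openU frame_e k eta).1 H.
have E1 : eq_on U eta (endo_act e (unframe e eta)).
  by move=> p Up; rewrite (unframeK frame_e).
pose Ls : mform M 'End(V) := fun p s => (lambda p s : R) *: Phi0.
have -> : S (dA A eta) = transfer chi (dext (unframe e eta) + wedgeE Ls (unframe e eta)).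
  apply/tr_eq => p Up; apply/funext => s; rewrite /unframe {1}/endo_act.
  rewrite (dA_local openU A E1 Up) (fl _ _ Hb p Up).
  exact: lker0_lfunK_eq (frame_e.1 p Up).
have -> : transfer chi (dext (unframe e eta) + wedgeE Ls (unframe e eta)) =
    transfer chi (dext (unframe e eta)) + transfer chi (wedgeE Ls (unframe e eta)).
  by [].
rewrite (tr_dext Hb) /cov; congr (_ + _).
apply/funext => x; apply/funext => s; rewrite /transfer /wedgeE.
rewrite (wedgef_wp (@eval_linl R V)) /Ls wp_eval_scalar.
rewrite -[RHS]/(Phi0 (wsc (la x) (S eta x) s)); congr (Phi0 _).
exact: (esym (wp_map (@scale_op R V) (tan chi x) (lambda (chi x)) _ s)).
Qed.

Local Notation D := (cov ell Ph (@ed R n.*2 V)).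
Local Notation eprim := (prim n (@eOm R n.*2 V) L).
Local Notation split_ := (cov_split n (@eOm R n.*2 V) L ell Ph (@ed R n.*2 V)).
Local Notation P := (primitive omega Bd U).

Let S_iter r eta : S (wedge_omega omega r eta) = iter r L (S eta).
Proof. by elim: r => //= r <-; exact: S_wedge. Qed.

Let S_sum (I : Type) (r : seq I) (Q : pred I) (F : I -> mform M V) :
  S (\sum_(i <- r | Q i) F i) = \sum_(i <- r | Q i) S (F i).
Proof. by elim/big_rec2: _ => [|i y z _ <-]; [exact: S0|exact: SD]. Qed.

Let S_prim k eta : P k eta <-> eprim k (S eta).
Proof.
by split=> [[lek /S_Om H /S_eq0 H0]|[lek /S_Om H H0]]; split => //;
  [rewrite -S_iter|apply/S_eq0; rewrite S_iter].
Qed.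

Let sum_two (Y : nmodType) (F : nat -> Y) k : (0 < k)%N ->
  (forall r, (2 <= r)%N -> F r = 0) ->
  \sum_(0 <= r < k) F r = F 0 + (if (1 < k)%N then F 1%N else 0).
Proof.
case: k => [//|[|k]] _ F0; first by rewrite big_nat1 addr0.
rewrite big_nat_recl// big_nat_recl// big1 ?addr0// => i _.
exact: F0.
Qed.

Let Om_Linv j (de : nat -> mform M V) :
  (forall r, (1 <= r <= j.+2./2)%N -> eprim (j.+2 - r.*2) (S (de r))) ->
  eOm j (S (\sum_(1 <= r < j.+2./2.+1) wedge_omega omega r.-1 (de r))).
Proof.
move=> lp; rewrite S_sum big_nat; elim/big_ind: _ => [|x y hx hy|r /andP[r1 r2]].
- exact: eOm0.
- exact: (OmD (@eOmP R n.*2 V)).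
have [_ hr _] := lp r ltac:(lia).
rewrite S_iter (_ : j = (j.+2 - r.*2) + r.-1.*2)%N; last lia.
exact: (Om_iter (sc_OmL C)).
Qed.

(** The components in [lefschetz] are selected by [xget], so that nothing is known of them until
    some decomposition exists. One is built from [cov_split_ex]; the selected one is then a
    decomposition too, and [cov_split_uniq] identifies its two parts. *)
Lemma split_partial k beta : P k beta ->
  split_ k (S beta) (S (partial_plus omega A U k beta))
                    (S (partial_minus omega A U k beta)).
Proof.
move=> Pb; have pb := (S_prim k beta).1 Pb.
have [lek /S_Om hb _] := pb.
have [b [c bc]] := cov_split_ex C n_gt0 pb.
have [DE hb' hc'] := bc.
suff [-> ->] : S (partial_plus omega A U k beta) = b /\
  S (partial_minus omega A U k beta) = c by [].
have SdA := S_dA hb.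
have [g0 g0E] := S_surj b; have [g1 g1E] := S_surj c.
(* For a primitive [beta], the decomposition of its covariant derivative stops at [r = 1]. *)
pose g r : mform M V := if r is r'.+1 then (if r' is 0 then g1 else 0) else g0.
have lg : is_lefschetz omega Bd U k.+1 (dA A beta) g.
  split=> [r /andP[rlo rhi]|].
    case: r rlo rhi => [|[|r]] rlo rhi; apply/S_prim => /=.
    - rewrite g0E; have kn : (k < n)%N by lia.
      by rewrite kn in hb'.
    - by case: k hc' {Pb pb lek hb bc DE hb' SdA rlo} rhi => // k; rewrite g1E subn2.
    - rewrite S0; split; [by lia|exact: eOm0|exact: iterL0].
  apply/S_eq; rewrite SdA DE S_sum.
  have [kn|kn] := ltnP k n.
    rewrite (_ : k.+1 - n = 0)%N; last lia.
    rewrite (@sum_two _ (fun r => S (wedge_omega omega r (g r)))) //; last first.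
      by move=> [|[|r]]// _; rewrite S_iter /= S0 iterL0 !raddf0.
    rewrite !S_iter /= g0E g1E; case: ifP => // k1.
    by case: k hc' k1 {Pb pb lek hb bc DE hb' SdA kn} => [->|k]//; rewrite raddf0.
  (* In this case the sum starts at [k + 1 - n = 1]; the missing term [r = 0] is the component [b],
     which is zero. *)
  have kE : k = n by lia.
  rewrite (_ : k.+1 - n = 1)%N; last lia.
  rewrite ltnNge kn /= in hb'.
  have := @sum_two _ (fun r => S (wedge_omega omega r (g r))) k.+1./2.+1 isT.
  rewrite (_ : (1 < k.+1./2.+1)%N); last by lia.
  rewrite !S_iter /= g0E g1E hb' add0r => E1.
  rewrite -E1; last by move=> [|[|r]]// _; rewrite S_iter /= S0 iterL0 !raddf0.
  by rewrite [LHS]big_ltn// ?S_iter /= g0E hb' !add0r.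
have [lp le] : is_lefschetz omega Bd U k.+1 (dA A beta)
    (lefschetz omega Bd U k.+1 (dA A beta)) by exact: (xgetPex 0 (ex_intro _ g lg)).
rewrite /partial_plus /partial_minus /Pi /Linv.
set de := lefschetz omega Bd U k.+1 (dA A beta) in lp le *.
have {}lp r : (k.+1 - n <= r <= k.+1./2)%N -> eprim (k.+1 - r.*2) (S (de r)).
  by move=> H; apply/S_prim; exact: lp.
move/S_eq : le; rewrite SdA S_sum.
(* The terms with [r >= 1] are [L] of the sum defining [Linv], so that the selected decomposition
   reads as a term [r = 0] plus a value of [L]. *)
have Lsum a K : S (\sum_(a.+1 <= r < K) wedge_omega omega r (de r)) =
    L (S (\sum_(a.+1 <= r < K) wedge_omega omega r.-1 (de r))).
  rewrite !S_sum linear_sum; apply: eq_big_nat => r /andP[r1 _].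
  by rewrite !S_iter -iterS prednK//; lia.
move=> DE'.
rewrite (_ : maxn 1 (k.+1 - n) = 1)%N; last by rewrite /maxn; case: ifP; lia.
apply: (cov_split_uniq C pb bc); last 2 first.
- by case: ltnP => kn; [have := lp 0; rewrite double0 subn0; apply; lia|exact: S0].
- case: (k) lek lp => [|j] lek lp; first by rewrite big_geq// S0.
  by apply: Om_Linv => r rr; apply: lp; lia.
rewrite -(Lsum 0%N) DE' S_sum.
have [kn|kn] := ltnP k n.
  rewrite (_ : k.+1 - n = 0)%N; last lia.
  exact: big_ltn.
rewrite S0 add0r (_ : k.+1 - n = 1)%N; last lia.
reflexivity.
Qed.

(** The way to compute both operators on a given form: it is enough to exhibit a splitting of its
    covariant derivative. *)
Let partialE k beta b c : P k beta -> split_ k (S beta) b c ->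
  S (partial_plus omega A U k beta) = b /\ S (partial_minus omega A U k beta) = c.
Proof.
move=> Pb bc; have [DE hb hc] := split_partial Pb.
apply: (cov_split_uniq C ((S_prim k beta).1 Pb) bc DE hb).
by case: (k) hc => // j [].
Qed.

Local Notation Dplus := (diff_plus omega A Phi U).

Let S_Dplus k beta : (k < n)%N -> S (Dplus k beta) = S (partial_plus omega A U k beta).
Proof. by rewrite /diff_plus => ->. Qed.

Let S_Dplus_top beta : S (Dplus n beta) =
  - S (partial_plus omega A U n.-1 (partial_minus omega A U n beta)) + Ph (S beta).
Proof. by rewrite /diff_plus ltnn SD SN S_Phi. Qed.

Let P_minus k z : (0 < k)%N -> P k z -> P k.-1 (partial_minus omega A U k z).
Proof.
by case: k => // k _ Pz; have [_ _ h] := split_partial Pz; apply/S_prim.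
Qed.

Let cocycle_split k z : (0 < k)%N -> P k z -> eq_on U (Dplus k z) 0 ->
  split_ k (S z) 0 (S (partial_minus omega A U k z)) /\
  D (S (partial_minus omega A U k z)) = Ph (S z).
Proof.
move=> k0 Pz /S_eq0 Dz; have sp := split_partial Pz.
have pz := (S_prim k z).1 Pz; have [lek _ _] := pz.
have [kn|kn] := ltnP k n.
  rewrite (S_Dplus _ kn) in Dz; rewrite Dz in sp; split => //.
  by apply: (cocycle_plus C k0 pz sp); left.
have kE : k = n by apply/eqP; rewrite eqn_leq lek.
subst k; have S0' : S (partial_plus omega A U n z) = 0 by case: sp => _; rewrite ltnn.
rewrite S0' in sp; split => //; apply: (cocycle_plus C k0 pz sp); right; split => //.
(* The vanishing of the second-order differential says that the [partial_plus] component of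
   [partial_minus z] is [Phi z]; the remaining component supplies the witness. *)
exists (S (partial_minus omega A U n.-1 (partial_minus omega A U n z))).
have := split_partial (P_minus k0 Pz); move: Dz; rewrite S_Dplus_top.
by rewrite addrC => /eqP; rewrite subr_eq0 => /eqP <-.
Qed.

Let f0 (v : V) : mform M V := endo_act e (form0 (fun=> v)).
Let f1 (v : V) : mform M V := endo_act e (fun p s => (lambda p s : R) *: v).

Let S_f0 v : S (f0 v) = ecst v.
Proof.
rewrite (_ : ecst v = transfer chi (form0 (fun=> v : V) : mform M V)).
  by apply/tr_eq; exact: frameK frame_e _.
by apply/funext => x; apply/funext => -[].
Qed.

Let S_f1 v : S (f1 v) = ell (ecst v).
Proof.
rewrite -[ell _]ewedge_ecst.
rewrite -[RHS]/(transfer chi ((fun p s => (lambda p s : R) *: v) : mform M V)).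
by apply/tr_eq; exact: frameK frame_e _.
Qed.

Let prim_cst v : eprim 0 (ecst v).
Proof. by apply: (prim_low C) => //; exact: eOm_ecst. Qed.

Let prim_ell v : eprim 1 (ell (ecst v)).
Proof. by apply: (prim_low C) => //; apply: (sc_Omell C); exact: eOm_ecst. Qed.

(** The differential of a constant section [v] is [lambda Phi v]. This produces [ker Phi] in degree
    0, and in degree 1 the coboundaries by which [coker Phi] is a quotient. *)
Let split_cst v : split_ 0 (ecst v) (ell (ecst (Phi0 v))) 0.
Proof.
split; rewrite ?n_gt0 ?raddf0 ?addr0//.
by rewrite /cov ed_ecst add0r -(sc_ellPhi C) -emap_ecst.
Qed.

Let cov_ell v : D (ell (ecst v)) = L (ecst v).
Proof. by rewrite (covell C (eOm_ecst v)) ed_ecst raddf0 subr0. Qed.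

Let split_ell v : split_ 1 (ell (ecst v)) 0 (ecst v).
Proof.
split; [by rewrite add0r cov_ell| |exact: prim_cst].
case: ltnP => // n1; split=> //; [exact: (sc_Om0 C)|exact: iterL0].
Qed.

Lemma ker_iso : induces_iso f0 (ker_sq Phi0) (PHplus omega A Phi U 0).
Proof.
have P0 v : P 0 (f0 v) by apply/S_prim; rewrite S_f0.
split=> /=.
- move=> v; rewrite memv_ker => /eqP v0; split=> //; apply/S_eq0.
  rewrite (S_Dplus _ n_gt0).
  have := split_cst v; rewrite -S_f0 => /(partialE (P0 v))[-> _].
  by rewrite v0 !raddf0.
- move=> v _; rewrite -(S_eq0 (f0 v)) S_f0; split=> [h|->]; last exact: raddf0.
  apply: (@ecst_inj R n.*2 V); rewrite h; exact: (esym (raddf0 _)).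
- by move=> a u v _ _; apply/S_eq0; exact: S_lin S_f0 (@ecst_is_linear R n.*2 V).
- move=> z [Pz /S_eq0 Dz]; rewrite (S_Dplus _ n_gt0) in Dz.
  have [Dz' _ /= c0] := split_partial Pz; rewrite Dz c0 raddf0 addr0 in Dz'.
  have [_ /S_Om hz _] := Pz.
  (* A cocycle [z] in degree 0 has [D z = 0], so that [L (Phi z) = D (D z) = 0], and [L] is
     injective on 0-forms. Then [D z] reduces to [d z], and [z] is constant. *)
  have Pz0 : Ph (S z) = 0.
    apply: (L_inj0 C n_gt0 (sc_OmPhi C hz)).
    by rewrite (sc_LPhi C) -(cov_cov C hz) Dz' (cov0 C).
  have dz : ed (S z) = 0.
    by rewrite -Dz' /cov -(sc_ellPhi C) Pz0 raddf0 addr0.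
  have [v zE] := closed_form0 hz dz; exists v.
    rewrite memv_ker; apply/eqP/(@ecst_inj R n.*2 V).
    by rewrite -emap_ecst -zE raddf0.
  by apply/S_eq0; rewrite SB S_f0 zE subrr.
Qed.

Lemma coker_iso : induces_iso f1 (coker_sq Phi0) (PHplus omega A Phi U 1).
Proof.
have P1 v : P 1 (f1 v) by apply/S_prim; rewrite S_f1.
have P0 v : P 0 (f0 v) by apply/S_prim; rewrite S_f0.
have f1E v := partialE (P1 v) ltac:(rewrite S_f1; exact: (split_ell v)).
have f0E v := partialE (P0 v) ltac:(rewrite S_f0; exact: (split_cst v)).
split=> /=.
- move=> v _; split=> //; apply/S_eq0; have [n1|n1] := ltnP 1 n.
    by rewrite (S_Dplus _ n1); exact: (f1E v).1.
  (* Here [n = 1] and the differential leaving degree 1 is of second order: [partial_minus] sends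
     [lambda v] to [v], [partial_plus] sends [v] to [lambda Phi v], and this cancels against the
     term [Phi (lambda v)]. *)
  have sc := split_cst v; rewrite -{1}(f1E v).2 in sc.
  have [E1 _] := partialE (P_minus (ltn0Sn 0) (P1 v)) sc.
  rewrite /diff_plus ltnNge n1 SD SN S_Phi S_f1 E1 -emap_ecst (sc_ellPhi C).
  exact: addNr.
- move=> v _; split.
    move=> [g Pg /S_eq]; rewrite (S_Dplus _ n_gt0) S_f1 => gE.
    have [Dg _ /= c0] := split_partial Pg; rewrite -gE c0 raddf0 addr0 in Dg.
    have [_ /S_Om hg _] := Pg.
    (* If [lambda v = D g], then [L (Phi g) = D (D g) = D (lambda v) = L v], hence [Phi g = v] as
       functions. Evaluating at the origin shows that [v] is in the image of [Phi]. *)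
    have gv : Ph (S g) = ecst v.
      apply/eqP; rewrite -subr_eq0; apply/eqP; apply: (L_inj0 C n_gt0).
        by apply: (OmB (sc_Om0 C) (sc_OmP C)); [exact: (sc_OmPhi C)|exact: eOm_ecst].
      by rewrite raddfB/= (sc_LPhi C) -(cov_cov C hg) Dg cov_ell subrr.
    have := congr1 (fun h => h 0 [::]) gv => /= <-.
    exact: memv_img (memvf _).
  move=> /memv_imgP[u _ ->]; exists (f0 u) => //.
  by apply/S_eq; rewrite (S_Dplus _ n_gt0) S_f1 (f0E u).1.
- move=> a u v _ _; exists (f0 0) => //; apply/S_eq.
  rewrite (S_lin _ _ _ S_f1) => [|b x y]; last first.
    by rewrite (ecst_is_linear b x y) linearP.
  by rewrite (S_Dplus _ n_gt0) (f0E 0).1 !raddf0.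
- move=> z [Pz Dz]; have [sp Dc] := cocycle_split (ltn0Sn 0) Pz Dz.
  set c := S (partial_minus _ _ _ _ _) in sp Dc.
  have pz := (S_prim 1 z).1 Pz; have [_ hz _] := pz.
  have [Dz' _ [_ hc _]] := sp; rewrite add0r in Dz'.
  have [m hm [mE dcm]] := potential_plus C hz hc Dz' Dc.
  have hcm : eOm 0 (c - Ph m).
    by apply: (OmB (sc_Om0 C) (sc_OmP C)) => //; exact: (sc_OmPhi C).
  have [v vE] := closed_form0 hcm dcm; exists v => //.
  have [g gE] := S_surj m; exists g; first by apply/S_prim; rewrite gE; exact: (prim_low C).
  (* Substitute [c = v + Phi m] in [z - lambda c = d m]. *)
  have Dm : D m = S z - ell (ecst v).
    by rewrite -vE raddfB/= opprB addrA [_ + _ - _]addrAC mE (sc_ellPhi C).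
  have Pg : P 0 g by apply/S_prim; rewrite gE; exact: (prim_low C).
  apply/S_eq; rewrite (S_Dplus _ n_gt0) SB S_f1.
  have [|-> _ //] := partialE (b := S z - ell (ecst v)) (c := 0) Pg.
  rewrite gE; split; rewrite ?raddf0 ?addr0 ?n_gt0//.
  by apply: (primB C).
Qed.

Lemma PHplus_trivial k : (2 <= k <= n)%N -> sq_trivial (PHplus omega A Phi U k).
Proof.
case: k => [|[|k]]// /andP[_ lek] z /= [Pz Dz].
have [[Dz' _ [_ hc _]] Dc] := cocycle_split (ltn0Sn _) Pz Dz.
rewrite add0r in Dz'.
have [m pm [c' sm]] := exact_plus C ((S_prim _ z).1 Pz) Dz' hc Dc.
have [g gE] := S_surj m; rewrite -gE in pm sm.
have Pg := (S_prim _ g).2 pm; exists g => //.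
by apply/S_eq; rewrite S_Dplus// (partialE Pg sm).1.
Qed.

Lemma PHminus_trivial k : (k <= n)%N -> sq_trivial (PHminus omega A Phi U k).
Proof.
move=> lek z /= [Pz Dz]; have pz := (S_prim k z).1 Pz.
have [Dz' hb hc] := split_partial Pz.
have c0 : S (partial_minus omega A U k z) = 0.
  case: (k) Dz hc => // j /(_ isT)/S_eq0; rewrite /diff_minus SN => /eqP.
  by rewrite oppr_eq0 => /eqP.
rewrite c0 raddf0 addr0 in Dz'.
case: ltnP => kn.
  rewrite kn in hb.
  have [|m pm [b sm]] := exact_minus C kn pz.
    by case: (k) Dz' hb => // j Dz' hb; eexists; [exact: Dz'|exact: hb].
  (* The differential is [- partial_minus], whence the sign. *)
  have [g gE] := S_surj (- m).
  have Pg : P k.+1 g by apply/S_prim; rewrite gE; exact: (primN C).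
  have := cov_splitN C pm sm; rewrite -gE => sg.
  by exists g => //; apply/S_eq; rewrite /diff_minus SN (partialE Pg sg).2 opprK.
have kE : k = n by lia.
rewrite kE in pz Dz' hb *; rewrite ltnn in hb; rewrite hb in Dz'.
have [m pm [c [b [c' [sm sc mE]]]]] := exact_middle C n_gt0 pz Dz'.
(* [exact_middle] gives [z = b - Phi m] with [b] the image of [m] under [partial_plus] after
   [partial_minus], the opposite of the middle differential applied to [m]. *)
have [g gE] := S_surj (- m).
have Pg : P n g by apply/S_prim; rewrite gE; exact: (primN C).
have := cov_splitN C pm sm; rewrite -gE => /(partialE Pg)[_ cE].
have Pc := P_minus n_gt0 Pg.
have := (S_prim _ _).1 Pc; rewrite cE => /(primN C); rewrite opprK => pc.
have := cov_splitN C pc sc; rewrite -cE => /(partialE Pc)[bE _].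
exists g => //; apply/S_eq; rewrite S_Dplus_top bE opprK gE.
by rewrite mE raddfN.
Qed.

End flat_bundle.

Theorem theorem4p4 (R : realType) (n : nat) (n_gt0 : (0 < n)%N)
  (M : manifold R n.*2) (omega : mform M R^o) (omegaS : symplectic omega)
  (V : vectType R) (E : vbundle M V) (A : connection E)
  (Phi : M -> 'End(V)) (PhiF : symplectically_flat A omega Phi)
  (U : set M) (openU : open U) (diffU : diffeo_to_Rm U)
  (e : M -> 'End(V)) (Phi0 : 'End(V)) (lambda : mform M R^o)
  (lambda1 : Omega U 1 lambda) (dlambda : eq_on U (dext lambda) omega)
  (flatF : flat_frame A Phi U e Phi0 lambda) :
  [/\ induces_iso (fun v : V => endo_act e (form0 (fun _ => v)))
        (ker_sq Phi0) (PHplus omega A Phi U 0),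
      induces_iso (fun v : V => endo_act e (fun p s => (lambda p s : R) *: v))
        (coker_sq Phi0) (PHplus omega A Phi U 1),
      forall k, (2 <= k <= n)%N -> sq_trivial (PHplus omega A Phi U k) &
      forall k, (k <= n)%N -> sq_trivial (PHminus omega A Phi U k)].
Proof.
have [psi [chi [Uchi chiK psiK [cchi schi spsi]]]] := diffU.
split.
- exact: (ker_iso n_gt0 omegaS openU Uchi chiK psiK cchi schi spsi lambda1 dlambda flatF).
- exact: (coker_iso n_gt0 omegaS openU Uchi chiK psiK cchi schi spsi lambda1 dlambda flatF).
- exact: (PHplus_trivial n_gt0 omegaS openU Uchi chiK psiK cchi schi spsi lambda1 dlambda flatF).
- exact: (PHminus_trivial n_gt0 omegaS openU Uchi chiK psiK cchi schi spsi lambda1 dlambda flatF).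
Qed.
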